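(* Let $s>5/2$, $u_0\in H_0^s(\mathbb T_L)$ and $\Phi\in\mathcal L_2(\mathcal U;H_0^{s-2}(\mathbb T_L))$. Consider the stochastic Camassa--Holm equation $$d(u-u_{xx})+\bigl(3uu_x-2u_xu_{xx}-uu_{xxx}\bigr)\,dt=\Phi\,dW(t),\qquad u(0)=u_0. \tag{SCH}$$ Put $G_0:=\Lambda\Phi$, $H(u):=u^2+\tfrac12u_x^2$, $F(u):=-uu_x-\Lambda\partial_xH(u)$, and introduce the auxiliary variables $$p:=u_x,\qquad w:=-\tfrac14u^2-\tfrac12\Lambda H(u),\qquad v:=up+\tfrac12F(u),$$ and $\phi$ defined by $d\phi=2w\,dt+\partial_x^{-1}G_0\,dW(t)$, $\phi(0)=\phi_0$, where $(\phi_0)_x=u_0$. Let $B(t):=\int_0^t\partial_x^{-1}\Phi\,dW(r)$. Then (SCH) is equivalent to the first-order system $$\left\{\begin{aligned} &\tfrac12d\phi-\tfrac12dp-v_x\,dt=\Bigl(-w-\tfrac32u^2-\tfrac12p^2\Bigr)dt+\tfrac12dB(t),\\ &-\tfrac12du+w_x\,dt=-\tfrac12G_0\,dW(t),\\ &-\phi_x\,dt=-u\,dt,\\ &u_x\,dt=p\,dt,\\ &\tfrac12du=(-up+v)\,dt+\tfrac12G_0\,dW(t). \end{aligned}\right.$$ Equivalently, with $\mathbf z=[u,\phi,w,v,p]^{\mathrm T}$, $$M\,d\mathbf z+K\mathbf z_x\,dt=\nabla_{\mathbf z}S_1(\mathbf z)\,dt+\mathcal G\,dW(t),$$ where $S_1(\mathbf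 z)=-wu-\frac12u^3-\frac12up^2+pv$ and $$M=\begin{bmatrix}0&\frac12&0&0&-\frac12\\-\frac12&0&0&0&0\\0&0&0&0&0\\0&0&0&0&0\\\frac12&0&0&0&0\end{bmatrix},\quad K=\begin{bmatrix}0&0&0&-1&0\\0&0&1&0&0\\0&-1&0&0&0\\1&0&0&0&0\\0&0&0&0&0\end{bmatrix},\quad \mathcal Gh=\frac12\begin{bmatrix}\partial_x^{-1}\Phi h\\-\Lambda\Phi h\\0\\0\\\Lambda\Phi h\end{bmatrix}\quad(h\in\mathcal U).$$
   Context: $\mathbb T_L=\mathbb R/L\mathbb Z$ is identified with the periodic interval $[a,b)$, $L=b-a$, $\mu=2\pi/L$; all spatial operators are periodic. Fourier coefficients: $\widehat f(k)=\frac1L\int_a^bf(x)e^{-\mathrm ik\mu(x-a)}dx$. Norm: $\|f\|_{H^r}^2=\sum_{k\in\mathbb Z}(1+|k\mu|^2)^r|\widehat f(k)|^2$; $H_0^r(\mathbb T_L)=\{f\in H^r(\mathbb T_L):\widehat f(0)=0\}$. $\Lambda:=(1-\partial_x^2)^{-1}$. For $f\in H_0^r$, $\partial_x^{-1}f$ is the zero-mean antiderivative: $\widehat{\partial_x^{-1}f}(k)=(\mathrm ik\mu)^{-1}\widehat f(k)$ for $k\ne0$ and $\widehat{\partial_x^{-1}f}(0)=0$. $W$ is a cylindrical Wiener process on the separable Hilbert space $\mathcal U=L_0^2(\mathbb T_L)$ (zero-mean $L^2$ functions), and $\mathcal L_2$ denotes Hilbert--Schmidt operators. Equation (SCH) is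 understood through its equivalent nonlocal form $du=F(u)\,dt+\Lambda\Phi\,dW(t)$, for the deterministic initial datum $u_0$, on the maximal interval of existence $[0,\tau_\infty)$ of its unique maximal pathwise solution $u\in C([0,\tau_\infty);H^s(\mathbb T_L))$ a.s.; the solution satisfies $u(t)\in H_0^s(\mathbb T_L)$ for $t<\tau_\infty$. Here $d$ denotes the stochastic time differential. *)

(* Defs.v *)
From HB Require Import structures.
From mathcomp Require Import all_boot all_order all_algebra.
From mathcomp Require Import all_classical all_reals all_analysis.
From mathcomp Require Import complex.

Set Implicit Arguments.
Unset Strict Implicit.
Unset Printing Implicit Defensive.

Import Order.TTheory GRing.Theory Num.Theory.
Import numFieldNormedType.Exports.

Local Open Scope classical_set_scope.
Local Open Scope ring_scope.
Local Open Scope complex_scope.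

(* A function on T_L = R/LZ, L = b - a, is an L-periodic function R -> R.  The
   endpoints a < b are explicit arguments throughout. *)

Definition wavenum (R : realType) (a b : R) (k : int) : R :=
  k%:~R * (2 * pi / (b - a)).

Definition fourier (R : realType) (a b : R) (f : R -> R) (k : int) : R[i] :=
  ((b - a)^-1 * \int[lebesgue_measure]_(x in `[a, b])
                  (f x * cos (wavenum a b k * (x - a))))
  -i* ((b - a)^-1 * \int[lebesgue_measure]_(x in `[a, b])
                  (f x * sin (wavenum a b k * (x - a)))).

Definition fourier_mode (R : realType) (a b : R) (k : int) (x : R) : R[i] :=
  cos (wavenum a b k * (x - a)) +i* sin (wavenum a b k * (x - a)).

Definition normsq (R : realType) (z : R[i]) : R := complex.Re z ^+ 2 + complex.Im z ^+ 2.

(* The square of the H^r norm, possibly +oo. *)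
Definition sobolev_normsq (R : realType) (a b r : R) (f : R -> R) : \bar R :=
  \esum_(k in [set: int])
    (powR (1 + wavenum a b k ^+ 2) r * normsq (fourier a b f k))%:E.

(* H^r(T_L) for r > 1/2: by Sobolev embedding every class has exactly one
   continuous representative, and H^r is modelled by these representatives.
   Only exponents r > 1/2 are ever used below. *)
Definition sobolev (R : realType) (a b r : R) (f : R -> R) : Prop :=
  [/\ continuous f, periodic f (b - a) & (sobolev_normsq a b r f < +oo)%E].

Definition sobolev0 (R : realType) (a b r : R) (f : R -> R) : Prop :=
  sobolev a b r f /\ fourier a b f 0 = 0.

(* Real Fourier multiplier with symbol m, as the limit of the symmetric partial
   sums over |k| <= n.  For the two symbols used below, the series converges
   absolutely and uniformly as soon as f is square integrable. *)
Definition fourier_mult (R : realType) (a b : R) (m : int -> R[i])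
    (f : R -> R) (x : R) : R :=
  lim ((fun n : nat => \sum_(j < n.*2.+1)
          let k := (j%:Z - n%:Z)%R in
          complex.Re (m k * fourier a b f k * fourier_mode a b k x)) @ \oo).

(* Lambda = (1 - d_x^2)^-1 with periodic boundary conditions *)
Definition Lambda (R : realType) (a b : R) : (R -> R) -> R -> R :=
  fourier_mult a b (fun k => ((1 + wavenum a b k ^+ 2)^-1 +i* 0)).

(* d_x^-1: the zero-mean antiderivative of a zero-mean function *)
Definition dxinv (R : realType) (a b : R) : (R -> R) -> R -> R :=
  fourier_mult a b
    (fun k => if k == 0 then 0 else (0 +i* wavenum a b k)^-1).

(* Elements of U are square-integrable functions; two of them are the same
   element of U when their difference has zero L^2 norm. *)
Definition L2zero (R : realType) (a b : R) (f : R -> R) : Prop :=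
  [/\ measurable_fun setT f, periodic f (b - a),
      (\int[lebesgue_measure]_(x in `[a, b]) ((f x ^+ 2)%:E) < +oo)%E
    & \int[lebesgue_measure]_(x in `[a, b]) f x = 0].

Definition L2dot (R : realType) (a b : R) (f g : R -> R) : R :=
  \int[lebesgue_measure]_(x in `[a, b]) (f x * g x).

Definition orthonormal_basis (R : realType) (a b : R) (e : nat -> R -> R) :
    Prop :=
  [/\ forall j, L2zero a b (e j),
      forall i j, L2dot a b (e i) (e j) = (i == j)%:R
    & forall f, L2zero a b f -> (forall j, L2dot a b f (e j) = 0) ->
        L2dot a b f f = 0].

(* Psi in L_2(U; H^r_0), r > 1/2.  Linearity and boundedness make Psi compatible
   with equality in U. *)
Definition hilbert_schmidt (R : realType) (a b r : R)
    (Psi : (R -> R) -> R -> R) : Prop :=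
  [/\ forall f, L2zero a b f -> sobolev0 a b r (Psi f),
      forall (c : R) f g, L2zero a b f -> L2zero a b g ->
        Psi (fun x => c * f x + g x) = (fun x => c * Psi f x + Psi g x),
      exists C : R, forall f, L2zero a b f ->
        (sobolev_normsq a b r (Psi f) <= (C * L2dot a b f f)%:E)%E
    & forall e, orthonormal_basis a b e ->
        (\sum_(0 <= j <oo) sobolev_normsq a b r (Psi (e j)) < +oo)%E].

(* t, omega, x |-> X(t, omega)(x); only the times t >= 0 are meaningful. *)
Definition process (R : realType) (Omega : Type) := R -> Omega -> R -> R.

Definition filtration (R : realType) (d : measure_display)
    (Omega : measurableType d) (F : R -> set (set Omega)) : Prop :=
  [/\ forall t, 0 <= t -> sigma_algebra setT (F t),
      forall t A, 0 <= t -> F t A -> measurable A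
    & forall s t, 0 <= s -> s <= t -> F s `<=` F t].

(* The cylindrical Wiener process W = sum_j beta_j e_j on U, given by an
   orthonormal basis e and independent real F-Brownian motions beta_j.  In the
   last clause, mutual independence of the increments over ]s, t] of the
   beta_j, and of the past F s, is stated jointly. *)
Definition cylindrical_wiener (R : realType) (a b : R) (d : measure_display)
    (Omega : measurableType d) (P : probability Omega R)
    (F : R -> set (set Omega)) (e : nat -> R -> R)
    (beta : nat -> R -> Omega -> R) : Prop :=
  let incr j s t (A : set R) := [set w | A (beta j t w - beta j s w)] in
  [/\ orthonormal_basis a b e,
      forall j t (A : set R), 0 <= t -> measurable A -> F t (beta j t @^-1` A),
      {ae P, forall w, forall j, beta j 0 w = 0 /\
        {within `[0, +oo[, continuous (fun t => beta j t w)}},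
      forall j s t (A : set R), 0 <= s -> s < t -> measurable A ->
        P (incr j s t A) = normal_prob 0 (Num.sqrt (t - s)) A
    & forall n s t (A : nat -> set R) E, 0 <= s -> s < t ->
        (forall j, measurable (A j)) -> F s E ->
        P (E `&` \bigcap_(j in `I_n) incr j s t (A j)) =
        (P E * \prod_(j < n) P (incr j s t (A j)))%E].

(* I(t) = \int_0^t Psi dW in H^r, for a Hilbert-Schmidt operator Psi which is
   deterministic and constant in time: the version with continuous paths in H^r
   of sum_j beta_j(t) Psi(e_j), the series converging in L^2(Omega; H^r). *)
Definition wiener_integral (R : realType) (a b : R) (d : measure_display)
    (Omega : measurableType d) (P : probability Omega R)
    (e : nat -> R -> R) (beta : nat -> R -> Omega -> R)
    (r : R) (Psi : (R -> R) -> R -> R) (I : process R Omega) : Prop :=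
  [/\ forall t x, 0 <= t -> measurable_fun setT (fun w => I t w x),
      forall t w, 0 <= t -> sobolev a b r (I t w),
      forall t0 w, 0 <= t0 ->
        sobolev_normsq a b r (fun x => I t w x - I t0 w x)
          @[t --> within `[0, +oo[ (nbhs t0)] --> 0%E
    & forall t, 0 <= t ->
        (\int[P]_w sobolev_normsq a b r
            (fun x => I t w x - \sum_(j < n) beta j t w * Psi (e j) x)%R)%E
          @[n --> \oo] --> 0%E].

Definition alive (R : realType) (Omega : Type) (tau : Omega -> \bar R)
    (w : Omega) : set R := [set t | 0 <= t /\ (t%:E < tau w)%E].

Definition stopping_time (R : realType) (d : measure_display)
    (Omega : measurableType d) (F : R -> set (set Omega))
    (tau : Omega -> \bar R) : Prop :=
  forall t : R, 0 <= t -> F t [set w | (tau w <= t%:E)%E].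

(* Evaluations at points generate the Borel sigma-algebra of H^r, r > 1/2. *)
Definition adapted (R : realType) (d : measure_display)
    (Omega : measurableType d) (F : R -> set (set Omega))
    (tau : Omega -> \bar R) (X : process R Omega) : Prop :=
  forall t x (A : set R), 0 <= t -> measurable A ->
    F t [set w | (t%:E < tau w)%E /\ A (X t w x)].

Definition sobolev_path (R : realType) (a b r : R) (D : set R)
    (f : R -> R -> R) : Prop :=
  (forall t, D t -> sobolev a b r (f t)) /\
  (forall t0, D t0 ->
     sobolev_normsq a b r (fun x => f t x - f t0 x)
       @[t --> within D (nbhs t0)] --> 0%E).

(* f in C(D; C^1(T_L)) *)
Definition C1_path (R : realType) (a b : R) (D : set R)
    (f : R -> R -> R) : Prop :=
  [/\ forall t, D t -> periodic (f t) (b - a),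
      forall t x, D t -> derivable (f t) x 1,
      {within D `*` [set: R], continuous (fun tx : R * R => f tx.1 tx.2)}
    & {within D `*` [set: R],
        continuous (fun tx : R * R => derive1 (f tx.1) tx.2)}].

(* dX + A dt = C dt + dY on [0, tau), almost surely.  All terms are continuous
   in (t, x) wherever this is used, so that an identity between integrals with
   values in a space of continuous functions is the same as the identity at
   every point x. *)
Definition sde (R : realType) (d : measure_display) (Omega : measurableType d)
    (P : probability Omega R) (tau : Omega -> \bar R)
    (X A C Y : process R Omega) : Prop :=
  {ae P, forall w, forall t, alive tau w t -> forall x,
    (X t w x - X 0 w x) + \int[lebesgue_measure]_(r in `[0, t]) A r w x =
    \int[lebesgue_measure]_(r in `[0, t]) C r w x + (Y t w x - Y 0 w x)}.

(* The same with values in 'cV_n, for M dX + K X_x dt = C dt + dY. *)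
Definition vsde (R : realType) (n : nat) (d : measure_display)
    (Omega : measurableType d) (P : probability Omega R)
    (tau : Omega -> \bar R) (M K : 'M[R]_n)
    (X Xx C Y : R -> Omega -> R -> 'cV[R]_n) : Prop :=
  let vint t (f : R -> 'cV[R]_n) : 'cV[R]_n :=
    \col_i \int[lebesgue_measure]_(r in `[0, t]) f r i 0 in
  {ae P, forall w, forall t, alive tau w t -> forall x,
    M *m (X t w x - X 0 w x) + vint t (fun r => K *m Xx r w x) =
    vint t (fun r => C r w x) + (Y t w x - Y 0 w x)}.

Definition CH_H (R : realType) (u : R -> R) (x : R) : R :=
  u x ^+ 2 + 2^-1 * derive1 u x ^+ 2.

Definition CH_F (R : realType) (a b : R) (u : R -> R) (x : R) : R :=
  - u x * derive1 u x - Lambda a b (derive1 (CH_H u)) x.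

(* The equation d(u - u_xx) + (3 u u_x - 2 u_x u_xx - u u_xxx) dt = Phi dW is
   taken in its nonlocal form du = F(u) dt + Lambda Phi dW on [0, tau). *)
Definition pathwise_solution (R : realType) (a b s : R) (d : measure_display)
    (Omega : measurableType d) (P : probability Omega R)
    (F : R -> set (set Omega)) (e : nat -> R -> R)
    (beta : nat -> R -> Omega -> R) (Phi : (R -> R) -> R -> R) (u0 : R -> R)
    (u : process R Omega) (tau : Omega -> \bar R) : Prop :=
  [/\ stopping_time F tau /\ {ae P, forall w, (0 < tau w)%E},
      adapted F tau u,
      {ae P, forall w, sobolev_path a b s (alive tau w) (fun t => u t w)},
      {ae P, forall w, u 0 w = u0}
    & exists2 I, wiener_integral a b P e beta s (Lambda a b \o Phi) I
        & sde P tau u (fun _ _ _ => 0) (fun t w => CH_F a b (u t w)) I].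

(* Maximality of (u, tau) among the solutions of an evolution problem: every
   solution is a restriction of u to a smaller stochastic interval. *)
Definition maximal_solution (R : realType) (d : measure_display)
    (Omega : measurableType d) (P : probability Omega R)
    (sol : process R Omega -> (Omega -> \bar R) -> Prop)
    (u : process R Omega) (tau : Omega -> \bar R) : Prop :=
  sol u tau /\
  forall u' tau', sol u' tau' ->
    {ae P, forall w, (tau' w <= tau w)%E /\
                     forall t, alive tau' w t -> u' t w = u t w}.

Definition auxiliary_variables (R : realType) (a b s : R)
    (d : measure_display) (Omega : measurableType d) (P : probability Omega R)
    (e : nat -> R -> R) (beta : nat -> R -> Omega -> R)
    (Phi : (R -> R) -> R -> R) (phi0 : R -> R)
    (u phi w v p : process R Omega) (tau : Omega -> \bar R) : Prop :=
  [/\ {ae P, forall om, forall t, alive tau om t ->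
        let U := u t om in
        [/\ p t om = derive1 U,
            w t om = (fun x => - 4^-1 * U x ^+ 2
                               - 2^-1 * Lambda a b (CH_H U) x)
          & v t om = (fun x => U x * p t om x + 2^-1 * CH_F a b U x)]},
      {ae P, forall om, phi 0 om = phi0}
    & exists2 J,
        wiener_integral a b P e beta (s + 1) (dxinv a b \o (Lambda a b \o Phi)) J
        & sde P tau phi (fun _ _ _ => 0) (fun t om x => 2 * w t om x) J].

(* What is common to the two forms of the system: the time interval, the
   initial data, and a class of processes in which every term of the equations
   is a continuous function of (t, x). *)
Definition system_class (R : realType) (a b s : R) (d : measure_display)
    (Omega : measurableType d) (P : probability Omega R)
    (F : R -> set (set Omega)) (u0 phi0 : R -> R)
    (u phi w v p : process R Omega) (tau : Omega -> \bar R) : Prop :=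
  [/\ stopping_time F tau /\ {ae P, forall om, (0 < tau om)%E},
      adapted F tau u,
      {ae P, forall om, sobolev_path a b s (alive tau om) (fun t => u t om)},
      {ae P, forall om,
        [/\ C1_path a b (alive tau om) (fun t => phi t om),
            C1_path a b (alive tau om) (fun t => w t om),
            C1_path a b (alive tau om) (fun t => v t om)
          & C1_path a b (alive tau om) (fun t => p t om)]}
    & {ae P, forall om, u 0 om = u0 /\ phi 0 om = phi0}].

Definition system_equations (R : realType) (a b s : R) (d : measure_display)
    (Omega : measurableType d) (P : probability Omega R) (e : nat -> R -> R)
    (beta : nat -> R -> Omega -> R) (Phi : (R -> R) -> R -> R)
    (B : process R Omega)
    (u phi w v p : process R Omega) (tau : Omega -> \bar R) : Prop :=
  let zero : process R Omega := fun _ _ _ => 0 in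
  exists2 I, wiener_integral a b P e beta s (Lambda a b \o Phi) I &
  [/\ sde P tau (fun t om x => 2^-1 * phi t om x - 2^-1 * p t om x)
        (fun t om x => - derive1 (v t om) x)
        (fun t om x => - w t om x - (3 / 2) * u t om x ^+ 2
                       - 2^-1 * p t om x ^+ 2)
        (fun t om x => 2^-1 * B t om x),
      sde P tau (fun t om x => - (2^-1 * u t om x))
        (fun t om x => derive1 (w t om) x) zero
        (fun t om x => - (2^-1 * I t om x)),
      sde P tau zero (fun t om x => - derive1 (phi t om) x)
        (fun t om x => - u t om x) zero,
      sde P tau zero (fun t om x => derive1 (u t om) x) p zero
    & sde P tau (fun t om x => 2^-1 * u t om x) zero
        (fun t om x => - (u t om x * p t om x) + v t om x)
        (fun t om x => 2^-1 * I t om x)].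

Definition system_solution (R : realType) (a b s : R) (d : measure_display)
    (Omega : measurableType d) (P : probability Omega R)
    (F : R -> set (set Omega)) (e : nat -> R -> R)
    (beta : nat -> R -> Omega -> R) (Phi : (R -> R) -> R -> R)
    (u0 phi0 : R -> R) (B : process R Omega)
    (u phi w v p : process R Omega) (tau : Omega -> \bar R) : Prop :=
  system_class a b s P F u0 phi0 u phi w v p tau /\
  system_equations a b s P e beta Phi B u phi w v p tau.

Definition col5 (R : realType) (z0 z1 z2 z3 z4 : R) : 'cV[R]_5 :=
  \col_i nth 0 [:: z0; z1; z2; z3; z4] i.

Definition mx5 (R : realType) (rows : seq (seq R)) : 'M[R]_5 :=
  \matrix_(i, j) nth 0 (nth [::] rows i) j.

Definition CH_M (R : realType) : 'M[R]_5 := mx5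
  [:: [:: 0;        2^-1; 0; 0; - 2^-1];
      [:: - 2^-1;   0;    0; 0; 0];
      [:: 0;        0;    0; 0; 0];
      [:: 0;        0;    0; 0; 0];
      [:: 2^-1;     0;    0; 0; 0]].

Definition CH_K (R : realType) : 'M[R]_5 := mx5
  [:: [:: 0;    0;    0;    - 1;  0];
      [:: 0;    0;    1;    0;    0];
      [:: 0;    - 1;  0;    0;    0];
      [:: 1;    0;    0;    0;    0];
      [:: 0;    0;    0;    0;    0]].

Definition CH_S1 (R : realType) (z : 'cV[R]_5) : R :=
  let u := z (@Ordinal 5 0 isT) 0 in
  let w := z (@Ordinal 5 2 isT) 0 in
  let v := z (@Ordinal 5 3 isT) 0 in
  let p := z (@Ordinal 5 4 isT) 0 in
  - (w * u) - 2^-1 * u ^+ 3 - 2^-1 * (u * p ^+ 2) + p * v.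

Definition grad (R : realType) (n : nat) (S : 'cV[R]_n.+1 -> R)
    (z : 'cV[R]_n.+1) : 'cV[R]_n.+1 :=
  \col_i 'D_(delta_mx i 0 : 'cV[R]_n.+1) S z.

Definition CH_G (R : realType) (a b : R) (Phi : (R -> R) -> R -> R)
    (h : R -> R) (x : R) : 'cV[R]_5 :=
  2^-1 *: col5 (dxinv a b (Phi h) x) (- Lambda a b (Phi h) x) 0 0
               (Lambda a b (Phi h) x).

(* Y = \int_0^. G dW takes values in H^(s-1) x (H^s)^4. *)
Definition matrix_equation (R : realType) (a b s : R) (d : measure_display)
    (Omega : measurableType d) (P : probability Omega R) (e : nat -> R -> R)
    (beta : nat -> R -> Omega -> R) (Phi : (R -> R) -> R -> R)
    (u phi w v p : process R Omega) (tau : Omega -> \bar R) : Prop :=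
  let z t om x :=
    col5 (u t om x) (phi t om x) (w t om x) (v t om x) (p t om x) in
  let zx t om x : 'cV[R]_5 := \col_i derive1 (fun y => z t om y i 0) x in
  exists2 Y : R -> Omega -> R -> 'cV[R]_5,
    forall i : 'I_5,
      wiener_integral a b P e beta (if i == 0 then s - 1 else s)
        (fun h x => CH_G a b Phi h x i 0) (fun t om x => Y t om x i 0)
    & vsde P tau (CH_M R) (CH_K R) z zx
        (fun t om x => grad (@CH_S1 R) (z t om x)) Y.

(* Main.v *)
(* The noises I = ∫ΛΦ dW, J = ∫∂ₓ⁻¹ΛΦ dW and B = ∫∂ₓ⁻¹Φ dW have deterministic integrands, so every
   linear relation between the Fourier coefficients of the integrands passes to those of the
   integrals, almost surely for all rational times and then, by continuity, for all times.  Hence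
   J_x = I and I_x = J - B, and the rest is an argument about a single path.

   If u solves (SCH), differentiating du = F(u) dt + dI in x gives dp = F(u)_x dt + d(J - B), where
   F(u)_x is computed from Λ∂ₓ² = Λ - 1; and (2w)_x = F(u), so phi_x = u.  The system follows.

   If conversely the system holds, with phi, w, v, p arbitrary, then phi_x = u, p = u_x and
   w_x = v - up at positive times.  The time derivatives of phi/2 - p/2 - B/2 and of u/2 - I/2 are
   A = v_x - w - 3u²/2 - p²/2 and w_x.  As the relations above are linear in Fourier space, the k-th
   coefficients satisfy ikμ Â = (1 + k²μ²) ŵ_x; eliminating v = up + w_x leaves w_x = F(u)/2, which
   turns the last equation of the system into (SCH).

   In the matrix form the noise is an unknown process Y, whose components are identified by the
   uniqueness of Wiener integrals. *)
Require Import Defs.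
From HB Require Import structures.
From mathcomp Require Import all_boot all_order all_algebra.
From mathcomp Require Import all_classical all_reals all_analysis.
From mathcomp Require Import measurable_realfun complex ring lra zify.

Set Implicit Arguments.
Unset Strict Implicit.
Unset Printing Implicit Defensive.

Import Order.TTheory GRing.Theory Num.Theory.
Import numFieldNormedType.Exports.
Local Open Scope classical_set_scope.
Local Open Scope ring_scope.

(** Elements of Sobolev spaces are continuous representatives here, so identities between them are
    proved by comparing cosine and sine coefficients, which determine a continuous periodic
    function. Since s > 5/2, the functions u, u_x and u_xx are continuous and B, the roughest noise,
    is C^1 in x; u_xxx need not exist. This lack of regularity shapes the converse. Formally B_x =
    (1 - ∂ₓ²)I, so the constraints give Z_x = (1 - ∂ₓ²)Y for Z = φ/2 - p/2 - B/2 and Y = u/2 - I/2,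
    and a time derivative gives A_x = (1 - ∂ₓ²)w_x. But A is only continuous in x and w only C^1, so
    neither side need exist classically; testing against the modes gives the relation a meaning. The
    noise is subtracted before differentiating in time because u and p need not be differentiable in
    t. Time 0 needs care as well: the integrated equations are differentiated at interior times
    only, so the constraints are known for t > 0. This suffices, since a single instant does not
    contribute to the time integral in the last equation. *)

Lemma continuous_sum {K : numFieldType} {T : topologicalType} (I : Type) (s : seq I)
    (F : I -> T -> K) : (forall i, continuous (F i)) ->
  continuous (fun x => \sum_(i <- s) F i x).
Proof.
move=> cF; elim: s => [|i s IH] x.
  by rewrite /continuous_at big_nil; under eq_fun do rewrite big_nil; exact: cvg_cst.
rewrite /continuous_at big_cons; under eq_fun do rewrite big_cons.
by apply: cvgD; [exact: cF|exact: IH].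
Qed.

Lemma continuous_fun_exp {K : numFieldType} {T : topologicalType} (f : T -> K) n :
  continuous f -> continuous (fun x => f x ^+ n).
Proof.
move=> cf x; rewrite /continuous_at; elim: n => [|n IH].
  by rewrite expr0; under eq_fun do rewrite expr0; exact: cvg_cst.
by rewrite exprS; under eq_fun do rewrite exprS; apply: cvgM; [exact: cf|exact: IH].
Qed.

(** * Integrals over intervals and primitives of continuous functions *)

Section interval_integral.
Context {R : realType}.
Notation mu := (@lebesgue_measure R).
Implicit Types (f g F : R -> R) (c d : R).

Lemma near_dist_lt (x e : R) : 0 < e -> \forall y \near x, `|y - x| < e.
Proof. by move=> e0; exact: (cvgrPdistC_lt _ _).1 (@cvg_id _ (nbhs x)) e e0. Qed.

Lemma within_continuous_integrable f c d :
  {within `[c, d], continuous f} -> mu.-integrable `[c, d] (EFin \o f).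
Proof. by move=> cf; apply: continuous_compact_integrable => //; exact: segment_compact. Qed.

Lemma continuous_within f (A : set R) : continuous f -> {within A, continuous f}.
Proof. by move=> cf; apply: continuous_subspaceT. Qed.

Lemma Rintegral_itv_cst c d (r : R) : c <= d ->
  \int[mu]_(x in `[c, d]) r = r * (d - c).
Proof.
move=> cd; rewrite Rintegral_cst//; congr (_ * _).
suff /(congr1 fine) : mu `[c, d] = (d - c)%:E by [].
rewrite lebesgue_measure_itv/= lte_fin; case: ltP => // dc.
by rewrite (_ : d = c) ?subrr//; apply/eqP; rewrite eq_le cd dc.
Qed.

Lemma le_norm_Rintegral_itv f c d (M : R) : c <= d ->
  {within `[c, d], continuous f} -> (forall x, x \in `[c, d] -> `|f x| <= M) ->
  `|\int[mu]_(x in `[c, d]) f x| <= M * (d - c).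
Proof.
move=> cd cf fM.
apply: (le_trans (le_normr_Rintegral _ _)) => //.
  exact: within_continuous_integrable.
rewrite -Rintegral_itv_cst//; apply: le_Rintegral => //.
- apply: (@within_continuous_integrable (fun x => `|f x|)).
  by move=> x; apply: continuous_comp; [exact: cf|exact: norm_continuous].
- by apply: within_continuous_integrable; apply: continuous_within => x; exact: cvg_cst.
Qed.

Lemma is_derive_continuous F x (l : R) : is_derive x (1 : R) F l -> {for x, continuous F}.
Proof. by move=> dF; apply/differentiable_continuous/derivable1_diffP. Qed.

Lemma Rintegral_is_derive F f c d : c <= d -> {within `[c, d], continuous f} ->
  (forall x, is_derive x (1 : R) F (f x)) ->
  \int[mu]_(x in `[c, d]) f x = F d - F c.
Proof.
rewrite le_eqVlt => /predU1P[<- _ _|cd cf dF].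
  by rewrite set_itv1 Rintegral_set1 subrr.
have cF : continuous F by move=> x; exact: is_derive_continuous (dF x).
rewrite /Rintegral (@continuous_FTC2 _ _ F)//.
- split => [x _||].
  + by have [] := dF x.
  + by apply: cvg_at_right_filter; exact: cF.
  + by apply: cvg_at_left_filter; exact: cF.
- by move=> x _; rewrite derive1E; have [_] := dF x.
Qed.

Lemma is_derive_Rintegral f c d x : {within `[c, d], continuous f} ->
  x \in `]c, d[ -> is_derive x (1 : R) (fun y => \int[mu]_(t in `[c, y]) f t) (f x).
Proof.
move=> cf xcd; have := xcd; rewrite in_itv/= => /andP[cx xd].
have cd := lt_trans cx xd.
have [] := @continuous_FTC1_closed _ f c x d xd (within_continuous_integrable cf) cx.
  by move: cf => /(continuous_within_itvP _ cd)[+ _ _]; apply.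
rewrite derive1E => df f'; exact: DeriveDef df f'.
Qed.

(** Differentiation in the upper limit uses both sides of t, which is why the endpoints are left out
    of the conclusion. *)
Lemma eq_within_continuous_integral f g T : 
  {within `[0, T], continuous f} -> {within `[0, T], continuous g} ->
  (forall t, t \in `]0, T[ -> \int[mu]_(r in `[0, t]) f r = \int[mu]_(r in `[0, t]) g r) ->
  {in `]0, T[, f =1 g}.
Proof.
move=> cf cg fg t t0T.
have [_ <-] := is_derive_Rintegral cf t0T.
have [_ <-] := is_derive_Rintegral cg t0T.
apply: near_eq_derive.
by apply: filterS (near_in_itvoo t0T) => y; exact: fg.
Qed.

Lemma continuous_has_primitive f : continuous f ->
  exists F, forall x, is_derive x (1 : R) F (f x).
Proof.
move=> cf; have cfw c d : {within `[c, d], continuous f} by exact: continuous_within.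
(* An integral from a fixed base point is a primitive only to the right of that point. The
   primitives based at -n, normalised at 0, agree where two of them apply, so they glue to one on
   the whole line. *)
pose G n y := \int[mu]_(t in `[- n, y]) f t - \int[mu]_(t in `[- n, 0]) f t.
have GE n m y : 0 < n -> n <= m -> `|y| <= n -> G n y = G m y.
  move=> n0 nm yn; rewrite /G.
  have H z : `|z| <= n -> \int[mu]_(t in `[- m, z]) f t =
      \int[mu]_(t in `[- m, - n]) f t + \int[mu]_(t in `[- n, z]) f t.
    rewrite ler_norml => /andP[nz zn].
    apply/eqP; rewrite addrC -subr_eq; apply/eqP.
    rewrite Rintegral_itvB ?bnd_simp ?lerN2//; last exact: within_continuous_integrable.
    rewrite Rintegral_itv_obnd_cbnd//.
    apply: integrableS (within_continuous_integrable (cfw (- n) z)) => //.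
    by apply: subset_itv; rewrite bnd_simp.
  rewrite (H y)// (H 0) ?normr0 ?(ltW n0)//; ring.
exists (fun y => G (`|y| + 1) y) => x.
have [Gd Gv] : is_derive x (1 : R) (G (`|x| + 2)) (f x).
  pose c := \int[mu]_(t in `[- (`|x| + 2), 0]) f t.
  rewrite -[f x]subr0; apply: (@is_deriveB _ _ _ _ (cst c)).
  apply: (@is_derive_Rintegral f _ (`|x| + 1)) => //.
  rewrite in_itv/=; apply/andP; split.
    by rewrite ltrNl (@le_lt_trans _ _ `|x|)// ?ltrDl// -normrN ler_norm.
  by rewrite (@le_lt_trans _ _ `|x|)// ?ltrDl// ler_norm.
apply: near_eq_is_derive (DeriveDef Gd Gv).
near=> y; have yx : `|y| <= `|x| + 1.
  have yx1 : `|y - x| < 1 by near: y; exact: near_dist_lt.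
  by rewrite -lerBlDl (le_trans (lerB_dist _ _))// ltW.
rewrite -(GE (`|y| + 1) (`|x| + 2))//.
- lra.
- by rewrite lerDl.
Unshelve. all: end_near. Qed.

End interval_integral.

(** * Real Fourier coefficients *)

Section trigonometric_modes.
Context {R : realType} (a b : R).
Hypothesis ab : a < b.
Notation mu := (@lebesgue_measure R).
Notation L := (b - a).
Local Notation lam k := (wavenum a b k).
Implicit Types (f g : R -> R) (c : bool) (k j : int).

(** The boolean selects cosine or sine. Differentiation then becomes [~~] on the boolean together
    with a sign and the factor [lam k], so that one statement covers both kinds of coefficients. *)
Definition mode c k (x : R) : R :=
  if c then cos (lam k * (x - a)) else sin (lam k * (x - a)).

(* Locked, so that unification does not unfold coefficients into integrals. *)
Fact fcoef_key : unit. Proof. by []. Qed.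

Definition fcoef c f k : R :=
  locked_with fcoef_key (L^-1 * \int[mu]_(x in `[a, b]) (f x * mode c k x)).

Lemma fcoefE c f k : fcoef c f k = L^-1 * \int[mu]_(x in `[a, b]) (f x * mode c k x).
Proof. by rewrite /fcoef unlock. Qed.

Lemma fourierE f k : fourier a b f k = (fcoef true f k -i* fcoef false f k)%C.
Proof. by rewrite !fcoefE. Qed.

Lemma period_gt0 : 0 < L. Proof. by rewrite subr_gt0. Qed.

Lemma wavenum0 : lam 0 = 0. Proof. by rewrite /wavenum mul0r. Qed.

Lemma wavenumN k : lam (- k) = - lam k.
Proof. by rewrite /wavenum mulrNz mulNr. Qed.

Lemma wavenumD j k : lam (j + k) = lam j + lam k.
Proof. by rewrite /wavenum mulrzDr mulrDl. Qed.

Lemma wavenum1_gt0 : 0 < lam 1.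
Proof. by rewrite /wavenum mul1r divr_gt0 ?period_gt0// mulr_gt0 ?pi_gt0. Qed.

Lemma wavenumE k : lam k = k%:~R * lam 1.
Proof. by rewrite /wavenum mul1r. Qed.

Lemma wavenum_eq0 k : (lam k == 0) = (k == 0).
Proof. by rewrite wavenumE mulf_eq0 intr_eq0 (gt_eqF wavenum1_gt0) orbF. Qed.

Lemma modeN c k x : mode c (- k) x = (if c then 1 else -1) * mode c k x.
Proof. by rewrite /mode wavenumN mulNr; case: c; rewrite ?cosN ?sinN ?mul1r ?mulN1r. Qed.

Lemma mode_le1 c k x : `|mode c k x| <= 1.
Proof. by rewrite /mode; case: c; [exact: cos_max|exact: sin_max]. Qed.

Lemma mode0 c x : mode c 0 x = c%:R.
Proof. by rewrite /mode wavenum0 mul0r cos0 sin0; case: c. Qed.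

Lemma is_derive_mode c k x :
  is_derive x (1 : R) (mode c k) ((if c then -1 else 1) * lam k * mode (~~ c) k x).
Proof.
have d1 : is_derive x (1 : R) (fun y => lam k * (y - a)) (lam k).
  apply: is_derive_eq; by rewrite /GRing.scale/= subr0 mulr1.
rewrite /mode; case: c => /=.
- apply: (is_derive_eq (@is_derive1_comp _ (@cos R) (fun y => lam k * (y - a)) x _ _
    (is_derive_cos (lam k * (x - a))) d1)); ring.
- apply: (is_derive_eq (@is_derive1_comp _ (@sin R) (fun y => lam k * (y - a)) x _ _
    (is_derive_sin (lam k * (x - a))) d1)); ring.
Qed.

Lemma continuous_mode c k : continuous (mode c k).
Proof. by move=> x; apply: is_derive_continuous (is_derive_mode c k x). Qed.

Lemma mode_periodic c k : periodic (mode c k) L.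
Proof.
have P (n : nat) : periodic (mode c n%:Z) L.
  move=> x; rewrite /mode.
  have -> : lam n%:Z * (x + L - a) = lam n%:Z * (x - a) + n%:R * (2 * pi).
    rewrite /wavenum; field; rewrite subr_eq0; by rewrite gt_eqF.
  rewrite [n%:R * _]mulr_natl [2 * pi]mulr_natl.
  by case: c; [rewrite (periodicn (@cosD2pi R))|rewrite (periodicn (@sinD2pi R))].
case: k => n //; rewrite NegzE => x.
by rewrite !modeN P.
Qed.

Lemma mode_bound c k : mode c k b = mode c k a.
Proof. by rewrite -(mode_periodic c k a) addrC subrK. Qed.

Lemma modeM c j k x : mode c j x * mode true k x =
  2^-1 * (mode c (j + k) x + mode c (j - k) x).
Proof.
rewrite /mode !wavenumD wavenumN !mulrDl mulNr.
by case: c; rewrite ?cosD ?sinD ?cosN ?sinN; lra.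
Qed.

Lemma mode_sinM j k x : mode false j x * mode false k x =
  2^-1 * (mode true (j - k) x - mode true (j + k) x).
Proof. by rewrite /mode !wavenumD wavenumN !mulrDl mulNr !cosD ?cosN ?sinN; lra. Qed.

Lemma integral_mode c k :
  \int[mu]_(x in `[a, b]) mode c k x = (c && (k == 0))%:R * L.
Proof.
have [->|k0] := eqVneq k 0.
  under eq_Rintegral do rewrite mode0.
  by rewrite Rintegral_itv_cst ?ltW// andbT.
rewrite andbF mul0r.
have lk : lam k != 0 by rewrite wavenum_eq0.
have d x : is_derive x (1 : R)
    (fun y => (if c then 1 else -1) / lam k * mode (~~ c) k y) (mode c k x).
  apply: (is_derive_eq (is_deriveZ ((if c then 1 else -1) / lam k) (is_derive_mode (~~ c) k x))).
  rewrite /GRing.scale/= negbK; case: c => /=; field; exact: lk.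
rewrite (Rintegral_is_derive (ltW ab) (continuous_within (@continuous_mode c k)) d).
by rewrite mode_bound subrr.
Qed.

Lemma continuousM_mode f c k : continuous f -> continuous (fun x => f x * mode c k x).
Proof. by move=> cf x; apply: cvgM; [exact: cf|exact: continuous_mode]. Qed.

Lemma integrable_itv f : continuous f -> mu.-integrable `[a, b] (EFin \o f).
Proof. by move=> cf; exact/within_continuous_integrable/continuous_within. Qed.

Lemma fcoef_lin c f g k (r s : R) : continuous f -> continuous g ->
  fcoef c (fun x => r * f x + s * g x) k = r * fcoef c f k + s * fcoef c g k.
Proof.
move=> cf cg; rewrite !fcoefE.
under eq_Rintegral do rewrite mulrDl -!mulrA.
have cfm : continuous (fun x => f x * mode c k x) by exact: continuousM_mode.
have cgm : continuous (fun x => g x * mode c k x) by exact: continuousM_mode.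
rewrite RintegralD//; last 2 first.
- by apply: integrable_itv => x; apply: cvgM; [exact: cvg_cst|exact: cfm].
- by apply: integrable_itv => x; apply: cvgM; [exact: cvg_cst|exact: cgm].
rewrite !RintegralZl//; [ring|exact: integrable_itv|exact: integrable_itv].
Qed.

Lemma fcoefB c f g k : continuous f -> continuous g ->
  fcoef c (fun x => f x - g x) k = fcoef c f k - fcoef c g k.
Proof.
move=> cf cg; have := fcoef_lin c k 1 (-1) cf cg; rewrite mul1r mulN1r => <-.
by congr fcoef; apply/funext => x; rewrite mul1r mulN1r.
Qed.

Lemma fcoefD c f g k : continuous f -> continuous g ->
  fcoef c (fun x => f x + g x) k = fcoef c f k + fcoef c g k.
Proof.
move=> cf cg; have := fcoef_lin c k 1 1 cf cg; rewrite !mul1r => <-.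
by congr fcoef; apply/funext => x; rewrite !mul1r.
Qed.

Lemma fcoefZ c f k r : continuous f -> fcoef c (fun x => r * f x) k = r * fcoef c f k.
Proof.
move=> cf; have := fcoef_lin c k r 0 cf cf; rewrite mul0r addr0 => <-.
by congr fcoef; apply/funext => x; rewrite mul0r addr0.
Qed.

Lemma fcoefN c f k : continuous f -> fcoef c f (- k) = (if c then 1 else -1) * fcoef c f k.
Proof.
move=> cf; rewrite !fcoefE mulrCA; congr (_ * _).
rewrite -RintegralZl//; last exact/integrable_itv/continuousM_mode.
by apply: eq_Rintegral => x _; rewrite modeN mulrCA.
Qed.

Lemma fcoef_cst c r k : fcoef c (fun=> r) k = (c && (k == 0))%:R * r.
Proof.
rewrite !fcoefE RintegralZl//; last exact/integrable_itv/continuous_mode.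
rewrite integral_mode; field; rewrite subr_eq0; by rewrite gt_eqF.
Qed.

Lemma fcoef_sum c (I : Type) (s : seq I) (F : I -> R -> R) (r : I -> R) k :
  (forall i, continuous (F i)) ->
  fcoef c (fun x => \sum_(i <- s) r i * F i x) k = \sum_(i <- s) r i * fcoef c (F i) k.
Proof.
move=> cF; elim: s => [|i s IH].
  rewrite big_nil (_ : (fun=> _) = fun=> 0) ?fcoef_cst ?mulr0//.
  by apply/funext => x; rewrite big_nil.
rewrite big_cons -IH -fcoefZ// -fcoefD//.
- by congr fcoef; apply/funext => x; rewrite big_cons.
- by move=> x; apply: cvgM; [exact: cvg_cst|exact: cF].
- by apply: continuous_sum => j x; apply: cvgM; [exact: cvg_cst|exact: cF].
Qed.

Lemma fcoef_le c f k M : continuous f -> (forall x, x \in `[a, b] -> `|f x| <= M) ->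
  `|fcoef c f k| <= M.
Proof.
move=> cf fM; have L0 := period_gt0.
rewrite !fcoefE normrM (gtr0_norm (_ : 0 < L^-1)) ?invr_gt0// mulrC ler_pdivrMr//.
apply: le_norm_Rintegral_itv; first exact: ltW.
  by apply: continuous_within; exact: continuousM_mode.
move=> x xab; rewrite normrM; apply: le_trans (fM _ xab).
by rewrite ler_piMr// mode_le1.
Qed.

(** Integration by parts; the boundary terms cancel because [f] and the modes both have period L. *)
Lemma fcoef_is_derive c f g k : periodic f L -> continuous g ->
  (forall x, is_derive x (1 : R) f (g x)) ->
  fcoef c g k = (if c then 1 else -1) * lam k * fcoef (~~ c) f k.
Proof.
move=> pf cg df.
have cf : continuous f by move=> x; exact: is_derive_continuous (df x).
have ec : - (if c then -1 else 1) = (if c then 1 else -1) :> R by case: c; rewrite ?opprK.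
have d x : is_derive x (1 : R) (fun y => f y * mode c k y)
    (g x * mode c k x - (if c then 1 else -1) * lam k * (f x * mode (~~ c) k x)).
  apply: (is_derive_eq (is_deriveM (df x) (is_derive_mode c k x))).
  by rewrite -[LHS]/(f x * _ + mode c k x * g x) -ec; ring.
have H : \int[mu]_(x in `[a, b])
    (g x * mode c k x - (if c then 1 else -1) * lam k * (f x * mode (~~ c) k x)) = 0.
  rewrite (Rintegral_is_derive (ltW ab) _ d).
    by rewrite mode_bound -(pf a) (addrC a) subrK subrr.
  apply: continuous_within => x; apply: cvgB; first exact: continuousM_mode.
  by apply: cvgM; [exact: cvg_cst|exact: continuousM_mode].
move: H; rewrite RintegralB//; last 2 first.
- exact/integrable_itv/continuousM_mode.
- apply: integrable_itv => x; apply: cvgM; first exact: cvg_cst.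
  exact: continuousM_mode.
rewrite RintegralZl//; last exact/integrable_itv/continuousM_mode.
by move/eqP; rewrite subr_eq0 !fcoefE => /eqP ->; ring.
Qed.

End trigonometric_modes.

Arguments mode : simpl never.

(** * Completeness of the trigonometric system *)

Lemma bernoulli_le {R : realFieldType} (x : R) n : 0 <= x -> 1 + n%:R * x <= (1 + x) ^+ n.
Proof.
move=> x0; elim: n => [|n IH]; first by rewrite mul0r addr0 expr0.
rewrite exprSr; apply: le_trans (ler_wpM2r _ IH); last by rewrite addr_ge0.
rewrite -natr1; have : 0 <= n%:R * (x * x) by rewrite !mulr_ge0.
by lra.
Qed.

Section fourier_uniqueness.
Context {R : realType} (a b : R).
Hypothesis ab : a < b.
Notation mu := (@lebesgue_measure R).
Notation L := (b - a).
Local Notation lam k := (wavenum a b k).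
Local Notation mode := (mode a b).
Local Notation fcoef := (fcoef a b).
Implicit Types (f g : R -> R) (c : bool) (k j : int).

Lemma periodic_rep (x : R) :
  exists2 y, y \in `[a, b[ & forall f, periodic f L -> f x = f y.
Proof.
have L0 := period_gt0 ab.
set n := Num.floor ((x - a) / L).
have /andP[n1 n2] := floor_itv ((x - a) / L).
exists (x - n%:~R * L).
  rewrite in_itv/=; apply/andP; split.
    by move: n1; rewrite -/n ler_pdivlMr//; lra.
  by move: n2; rewrite -/n ltr_pdivrMr// intrD; lra.
move=> f pf; case: n {n1 n2} => m.
  rewrite -[RHS](periodicn pf m); congr f; rewrite -[L *+ m]mulr_natl.
  by rewrite (_ : m%:~R = m%:R :> R)// subrK.
rewrite NegzE -(periodicn pf m.+1 x); congr f; rewrite -[L *+ _]mulr_natl mulrNz.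
by rewrite (_ : m.+1%:~R = m.+1%:R :> R)// mulNr opprK.
Qed.

Lemma within_continuous_bounded f (c d : R) : {within `[c, d], continuous f} ->
  exists2 M, 0 < M & forall x, x \in `[c, d] -> `|f x| <= M.
Proof.
move=> cf; have [dc|cd] := ltP d c.
  exists 1 => // x; rewrite in_itv/= => /andP[/le_trans h /h]; by rewrite leNgt dc.
have [z _ zM] := @EVT_max _ (fun x => `|f x|) c d cd (fun x =>
  continuous_comp (cf x) (@norm_continuous _ _ (f x))).
by exists (`|f z| + 1); [rewrite ltr_wpDl|move=> x /zM h; rewrite (le_trans h)// lerDl].
Qed.

Lemma periodic_bounded f : continuous f -> periodic f L ->
  exists2 M, 0 < M & forall x, `|f x| <= M.
Proof.
move=> cf pf; have [M M0 fM] := within_continuous_bounded (@continuous_within _ f `[a, b] cf).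
exists M => // x; have [y yab ->//] := periodic_rep x.
by apply: fM; exact: subset_itv_co_cc yab.
Qed.

(* The kernel of Rudin's proof of the completeness of the trigonometric system: it exceeds 1
   near x0 and its absolute value is at most 1 elsewhere in the period. *)
Let peak (x0 dl x : R) := 1 + cos (lam 1 * (x - x0)) - cos (lam 1 * dl).

Let continuous_peak x0 dl : continuous (peak x0 dl).
Proof.
move=> x; apply: cvgB; last exact: cvg_cst.
apply: cvgD; first exact: cvg_cst.
apply: continuous_cvg; first exact: continuous_cos.
by apply: cvgM; [exact: cvg_cst|apply: cvgB; [exact: cvg_id|exact: cvg_cst]].
Qed.

Let peakE x0 dl x : peak x0 dl x = (1 - cos (lam 1 * dl)) +
  cos (lam 1 * (x0 - a)) * mode true 1 x + sin (lam 1 * (x0 - a)) * mode false 1 x.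
Proof.
rewrite /peak /mode (_ : lam 1 * (x - x0) = lam 1 * (x - a) - lam 1 * (x0 - a)); last ring.
by rewrite cosB; ring.
Qed.

(** The peak is a trigonometric polynomial of degree one. By the product formulas, multiplication by
    it only shifts wave numbers by one, so orthogonality to all modes survives every power. *)
Let peak_orthogonal f x0 dl : continuous f -> (forall c k, fcoef c f k = 0) ->
  forall n c k, fcoef c (fun x => f x * peak x0 dl x ^+ n) k = 0.
Proof.
move=> cf f0; elim => [|n IH] c k.
  by rewrite -[RHS](f0 c k); congr fcoef; apply/funext => x; rewrite expr0 mulr1.
pose g x := f x * peak x0 dl x ^+ n.
have cg : continuous g.
  move=> x; apply: cvgM; first exact: cf.
  by apply: continuous_fun_exp; exact: continuous_peak.
have cgm d j : continuous (fun x => g x * mode d j x) by exact: continuousM_mode.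
have gc d j : fcoef d (fun x => g x * mode true 1 x) j = 0.
  rewrite (_ : fcoef _ _ _ = 2^-1 * (fcoef d g (j + 1) + fcoef d g (j - 1))).
    by rewrite !IH addr0 mulr0.
  rewrite !fcoefE -mulrDr mulrCA; congr (_ * _).
  rewrite -RintegralD//; [|exact/integrable_itv/cgm..].
  rewrite -RintegralZl//; last first.
    by apply: integrable_itv => x; apply: cvgD; exact: cgm.
  apply: eq_Rintegral => x _.
  by rewrite -mulrA [_ true _ _ * _]mulrC modeM; ring.
have gs d j : fcoef d (fun x => g x * mode false 1 x) j = 0.
  case: d.
    rewrite (_ : fcoef _ _ _ = 2^-1 * (fcoef false g (1 + j) + fcoef false g (1 - j))).
      by rewrite !IH addr0 mulr0.
    rewrite !fcoefE -mulrDr mulrCA; congr (_ * _).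
    rewrite -RintegralD//; [|exact/integrable_itv/cgm..].
    rewrite -RintegralZl//; last first.
      by apply: integrable_itv => x; apply: cvgD; exact: cgm.
    by apply: eq_Rintegral => x _; rewrite -mulrA modeM; ring.
  rewrite (_ : fcoef _ _ _ = 2^-1 * (fcoef true g (1 - j) - fcoef true g (1 + j))).
    by rewrite !IH subr0 mulr0.
  rewrite !fcoefE -mulrBr mulrCA; congr (_ * _).
  rewrite -RintegralB//; [|exact/integrable_itv/cgm..].
  rewrite -RintegralZl//; last first.
    by apply: integrable_itv => x; apply: cvgB; exact: cgm.
  by apply: eq_Rintegral => x _; rewrite -mulrA mode_sinM; ring.
rewrite (_ : (fun x => _) = fun x => 1 * ((1 - cos (lam 1 * dl)) * g x +
    cos (lam 1 * (x0 - a)) * (g x * mode true 1 x)) +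
    sin (lam 1 * (x0 - a)) * (g x * mode false 1 x)); last first.
  by apply/funext => x; rewrite exprSr mulrA -/(g x) peakE; ring.
rewrite fcoef_lin//; last first.
  move=> x; apply: cvgD; first by apply: cvgM; [exact: cvg_cst|exact: cg].
  by apply: cvgM; [exact: cvg_cst|exact: cgm].
by rewrite fcoef_lin// IH gc gs !mulr0 !addr0 mulr0.
Qed.

(** Cosine decreases on [0, π] and is symmetric about π, so on [x, 2π - x] it is largest at the
    ends. *)
Let cos_le (x y : R) : 0 <= x -> x <= y -> y <= pi *+ 2 - x -> cos y <= cos x.
Proof.
move=> x0 xy y2; have xpi : x <= pi by move: y2; rewrite mulr2n; lra.
have cm (u v : R) : 0 <= u -> u <= v -> v <= pi -> cos v <= cos u.
  rewrite [u <= v]le_eqVlt => u0 /predU1P[->//|uv] vpi.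
  by apply/ltW; rewrite ltr_cos// in_itv/=; apply/andP; split; lra.
have [ypi|ypi] := leP y pi; first exact: cm.
have -> : cos y = cos (pi *+ 2 - y) by rewrite -(cosN (_ - y)) opprB -[RHS]cosD2pi subrK.
by apply: cm; move: y2 ypi; rewrite mulr2n; lra.
Qed.

(** Suppose f x0 > 0. Against each power of the peak f integrates to 0, whereas the part near x0
    contributes at least a fixed multiple of 1 + n eta, by Bernoulli's inequality, and the rest of
    the period at least -M per unit length. For large n this is a contradiction. *)
Let fcoef_eq0_le0 f x0 : continuous f -> (forall c k, fcoef c f k = 0) ->
  x0 \in `]a, b[ -> f x0 <= 0.
Proof.
move=> cf f0 x0ab; rewrite leNgt; apply/negP => fx0.
have L0 := period_gt0 ab; have l0 := wavenum1_gt0 ab.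
have l1L : lam 1 * L = pi *+ 2.
  by rewrite /wavenum mul1r divfK ?gt_eqF// mulr_natl.
set m := f x0 in fx0.
have [M M0 fM] := within_continuous_bounded (@continuous_within _ f `[a, b] cf).
have : \forall y \near x0, m / 2 < f y.
  by apply: (cvgr_gt (f x0) (cf x0)); rewrite -/m ltr_pdivrMr// ltr_pMr// ltr1n.
move=> /nbhs_ballP[e1 /= e10 fe1].
move: (x0ab); rewrite in_itv/= => /andP[ax0 x0b].
(* The bound by e1 keeps f above m/2 on the window. The other two keep the window inside [a, b],
   make lam 1 * dl at most π, and give |x - x0| <= L - dl on [a, b], the range in which [cos_le]
   applies. *)
pose dl := Num.min (e1 / 2) (Num.min ((x0 - a) / 2) ((b - x0) / 2)).
have dl0 : 0 < dl by rewrite !lt_min !divr_gt0 ?subr_gt0.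
have dle : dl < e1 by rewrite gt_min ltr_pdivrMr// ltr_pMr// ltr1n.
have dla : dl <= (x0 - a) / 2 by rewrite !ge_min lexx orbT.
have dlb : dl <= (b - x0) / 2 by rewrite !ge_min lexx !orbT.
have ldl : lam 1 * dl <= pi.
  rewrite -(ler_pM2l (_ : 0 < 2)) // mulrCA [2 * pi]mulr_natl -l1L ler_pM2l//; lra.
have nrm x : lam 1 * `|x - x0| = `|lam 1 * (x - x0)| by rewrite normrM gtr0_norm.
(* On the inner half of the window the peak is at least 1 + eta. *)
pose eta := cos (lam 1 * (dl / 2)) - cos (lam 1 * dl).
have eta0 : 0 < eta.
  have h : lam 1 * (dl / 2) < lam 1 * dl by rewrite ltr_pM2l//; lra.
  rewrite subr_gt0 ltr_cos ?in_itv//=; apply/andP; split => //.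
  - by rewrite mulr_ge0 ?(ltW l0)// divr_ge0 ?ltW.
  - exact: le_trans (ltW h) ldl.
  - by rewrite mulr_ge0 ?ltW.
have cosle x : x \in `[a, b] -> dl <= `|x - x0| -> cos (lam 1 * (x - x0)) <= cos (lam 1 * dl).
  rewrite in_itv/= => /andP[ax xb] dx; rewrite -cos_norm -nrm; apply: cos_le.
  - by rewrite mulr_ge0 ?ltW.
  - by rewrite ler_pM2l.
  - by rewrite -l1L -mulrBr ler_pM2l// ler_norml; lra.
have cosge x r : 0 <= r -> r <= dl -> `|x - x0| <= r ->
    cos (lam 1 * r) <= cos (lam 1 * (x - x0)).
  move=> r0 rdl xr; rewrite -(cos_norm (_ * (x - _))) -nrm; apply: cos_le.
  - by rewrite mulr_ge0// ltW.
  - by rewrite ler_pM2l.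
  - rewrite -l1L -mulrBr ler_pM2l//; lra.
have peakge0 n x : x \in `[a, b] -> - M <= f x * peak x0 dl x ^+ n.
  move=> xab; have [dx|dx] := leP dl `|x - x0|.
    have pk : `|peak x0 dl x| <= 1.
      have := cosle _ xab dx; have := cos_geN1 (lam 1 * (x - x0)).
      have := cos_le1 (lam 1 * dl).
      by rewrite ler_norml /peak => ? ? ?; apply/andP; split; lra.
    have : `|f x * peak x0 dl x ^+ n| <= M.
      rewrite normrM normrX; apply: le_trans (fM _ xab).
      by rewrite ler_piMr// exprn_ile1.
    by rewrite ler_norml => /andP[].
  have fx : 0 <= f x.
    have : m / 2 < f x by apply: fe1; rewrite /ball/= distrC (lt_trans dx).
    by move=> /ltW; apply: le_trans; rewrite divr_ge0// ltW.
  have pk : 0 <= peak x0 dl x.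
    by have := cosge x _ (ltW dl0) (lexx _) (ltW dx); rewrite /peak; lra.
  by apply: (@le_trans _ _ 0); [rewrite oppr_le0 ltW|rewrite mulr_ge0// exprn_ge0].
have peakbig n x : x \in `[x0 - dl / 2, x0 + dl / 2] ->
    m / 2 * (1 + n%:R * eta) <= f x * peak x0 dl x ^+ n.
  rewrite in_itv/= => /andP[h1 h2].
  have dx : `|x - x0| <= dl / 2 by rewrite ler_norml; apply/andP; split; lra.
  have fx : m / 2 < f x by apply: fe1; rewrite /ball/= distrC (le_lt_trans dx)//; lra.
  apply: ler_pM.
  - by rewrite divr_ge0// ltW.
  - by rewrite addr_ge0// mulr_ge0// ltW.
  - exact: ltW.
  - apply: le_trans (bernoulli_le n (ltW eta0)) _.
    have dl20 : 0 <= dl / 2 by rewrite divr_ge0// ltW.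
    have dl2 : dl / 2 <= dl by move: dl0; lra.
    have pk : 1 + eta <= peak x0 dl x by have := cosge x _ dl20 dl2 dx; rewrite /peak /eta; lra.
    have eta1 : 0 <= 1 + eta by rewrite addr_ge0// ltW.
    by apply: lerXn2r => //; rewrite nnegrE// (le_trans eta1).
have cfp n : continuous (fun x => f x * peak x0 dl x ^+ n + M).
  move=> x; apply: cvgD; last exact: cvg_cst.
  apply: cvgM; first exact: cf.
  by apply: continuous_fun_exp; exact: continuous_peak.
(* Adding M makes the integrand nonnegative on [a, b], so restricting it to the inner half of the
   window can only lower its integral. *)
have key n : m / 2 * (1 + n%:R * eta) * dl <= M * L.
  have H1 : \int[mu]_(x in `[a, b]) (f x * peak x0 dl x ^+ n + M) = M * L.
    have := peak_orthogonal x0 dl cf f0 n true 0.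
    move/eqP; rewrite !fcoefE mulf_eq0 invr_eq0 (gt_eqF L0)/= => /eqP.
    under eq_Rintegral do rewrite mode0 mulr1.
    move=> h; rewrite RintegralD//.
    - by rewrite h add0r Rintegral_itv_cst// ltW.
    - apply: integrable_itv => x; apply: cvgM; first exact: cf.
      by apply: continuous_fun_exp; exact: continuous_peak.
    - by apply: integrable_itv => x; exact: cvg_cst.
  rewrite -H1.
  have sub : `[x0 - dl / 2, x0 + dl / 2] `<=` `[a, b].
    by apply: subset_itv; rewrite bnd_simp; lra.
  have H2 : \int[mu]_(x in `[x0 - dl / 2, x0 + dl / 2]) (f x * peak x0 dl x ^+ n + M) <=
      \int[mu]_(x in `[a, b]) (f x * peak x0 dl x ^+ n + M).
    apply: fine_le.
    - apply: integrable_fin_num => //.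
      by apply: within_continuous_integrable; exact: continuous_within.
    - by apply: integrable_fin_num => //; exact: integrable_itv.
    - apply: ge0_subset_integral => //.
      + by have /integrableP[mf _] := @integrable_itv _ a b _ (cfp n); exact: mf.
      + by move=> x xab; rewrite lee_fin -lerBlDr sub0r peakge0.
  apply: le_trans H2.
  rewrite [leLHS](_ : _ = m / 2 * (1 + n%:R * eta) *
    (x0 + dl / 2 - (x0 - dl / 2))); last by congr (_ * _); lra.
  rewrite -Rintegral_itv_cst; last lra.
  apply: le_Rintegral => //.
  - by apply: within_continuous_integrable; apply: continuous_within => x; exact: cvg_cst.
  - by apply: within_continuous_integrable; exact: continuous_within.
  - by move=> x /peakbig h; rewrite (le_trans (h n))// lerDl ltW.
have p0 : 0 < m / 2 * dl * eta by rewrite !mulr_gt0 ?divr_gt0.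
have [n nM] : exists n : nat, M * L / (m / 2 * dl * eta) < n%:R.
  exists (Num.bound (M * L / (m / 2 * dl * eta))); apply: archi_boundP.
  by rewrite divr_ge0 ?(ltW p0)// mulr_ge0 ?(ltW M0) ?(ltW L0).
have := key n; move: nM; rewrite ltr_pdivrMr// => h1 h2.
have : 0 < m / 2 * dl by rewrite !mulr_gt0 ?divr_gt0.
by lra.
Qed.

Lemma fcoef_eq0 f : continuous f -> periodic f L -> (forall c k, fcoef c f k = 0) ->
  forall x, f x = 0.
Proof.
move=> cf pf f0.
have I x : x \in `]a, b[ -> f x = 0.
  move=> xab; apply/eqP; rewrite eq_le (fcoef_eq0_le0 cf f0 xab)/= -oppr_le0.
  apply: (@fcoef_eq0_le0 (fun x => - f x)) => //.
    by move=> y; apply: cvgN; exact: cf.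
  move=> c k; rewrite -[RHS]oppr0 -(f0 c k) -mulN1r -fcoefZ//.
  by congr fcoef; apply/funext => y; rewrite mulN1r.
move=> x; have [y + ->//] := periodic_rep x.
rewrite in_itv/= => /andP[]; rewrite le_eqVlt => /predU1P[<- _|ay yb]; last first.
  by apply: I; rewrite in_itv/= ay.
(* The interior argument does not reach the endpoint a, which is a limit of interior points from the
   right. *)
have h : (f z @[z --> a^'+] --> f a) by apply: cvg_at_right_filter; exact: cf.
apply: (cvg_unique _ h) => //; apply: cvg_near_cst.
near=> z; apply: I; rewrite in_itv/=; apply/andP; split; near: z.
  exact: nbhs_right_gt.
exact: nbhs_right_lt.
Unshelve. all: end_near. Qed.

Lemma fcoef_inj f g : continuous f -> continuous g -> periodic f L -> periodic g L ->
  (forall c (k : nat), fcoef c f k%:Z = fcoef c g k%:Z) -> f = g.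
Proof.
move=> cf cg pf pg fg; apply/funext => x; apply/eqP; rewrite -subr_eq0; apply/eqP.
have cfg : continuous (fun x => f x - g x) by move=> y; apply: cvgB; [exact: cf|exact: cg].
apply: (@fcoef_eq0 (fun x => f x - g x)) => //.
  by move=> y; rewrite pf pg.
by move=> c [k|k]; rewrite ?NegzE ?fcoefN// fcoefB// fg subrr ?mulr0.
Qed.

(** The way back from coefficients to classical derivatives: a primitive of g is periodic and has
    the coefficients of f except possibly the mean, so f differs from it by a constant. *)
Lemma is_derive_fcoef f g : continuous f -> periodic f L -> continuous g -> periodic g L ->
  (forall c (k : nat), fcoef c g k%:Z = (if c then 1 else -1) * lam k%:Z * fcoef (~~ c) f k%:Z) ->
  forall x, is_derive x (1 : R) f (g x).
Proof.
move=> cf pf cg pg fg.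
have [G dG] := continuous_has_primitive cg.
have cG : continuous G by move=> x; exact: is_derive_continuous (dG x).
have L0 := period_gt0 ab.
have pG : periodic G L.
  have dsh x : is_derive x (1 : R) (fun y => G (y + L) - G y) 0.
    have d1 : is_derive x (1 : R) (fun y => G (y + L)) (g (x + L)).
      apply: (is_derive_eq (@is_derive1_comp _ G (shift L) x _ _ (dG (x + L)) _)).
      by rewrite addr0 mulr1.
    by apply: (is_derive_eq (is_deriveB d1 (dG x))); rewrite pg subrr.
  move=> x; apply/eqP; rewrite -subr_eq0.
  have -> := @is_derive_0_is_cst _ (fun y => G (y + L) - G y) x a dsh.
  rewrite (addrC a) subrK -(Rintegral_is_derive (ltW ab) (continuous_within cg) dG).
  (* At k = 0 the relation says that g has mean zero, which makes its primitive periodic. *)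
  have := fg true 0%N; rewrite wavenum0 mulr0 mul0r => /eqP.
  rewrite !fcoefE mulf_eq0 invr_eq0 (gt_eqF L0)/=.
  by under eq_Rintegral do rewrite mode0 mulr1.
have fG : f = (fun x => G x + (fcoef true f 0 - fcoef true G 0)).
  apply: fcoef_inj => //.
  - by move=> x; apply: cvgD; [exact: cG|exact: cvg_cst].
  - by move=> x; rewrite pG.
  move=> c k; rewrite fcoefD//; last by move=> x; exact: cvg_cst.
  rewrite fcoef_cst//.
  have [->|k0] := eqVneq k 0%N.
    case: c; first by rewrite mul1r addrC subrK.
    rewrite mul0r addr0 !fcoefE; congr (_ * _); apply: eq_Rintegral => x _.
    by rewrite !mode0 !mulr0.
  rewrite [(_ == 0)](negbTE k0) andbF mul0r addr0.
  have lk : lam k != 0 by rewrite wavenum_eq0.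
  have := fg (~~ c) k; rewrite (fcoef_is_derive ab (~~ c) k pG cg dG) negbK.
  move=> /mulfI -> //; rewrite mulf_neq0//; case: (c) => //=; exact: oner_neq0.
move=> x; rewrite fG -[g x]addr0.
by apply: is_deriveD.
Qed.

End fourier_uniqueness.

(** * Absolutely convergent trigonometric series *)

Lemma esumZl_le {R : realType} (T : choiceType) (D : set T) (f : T -> \bar R) (C : R) :
  0 <= C -> (forall i, (0 <= f i)%E) ->
  (\esum_(i in D) (C%:E * f i) <= C%:E * \esum_(i in D) f i)%E.
Proof.
move=> C0 f0; apply: ge_ereal_sup => _ [X [fX XD] <-].
rewrite -ge0_mule_fsumr//.
by apply: lee_wpmul2l; [rewrite lee_fin|apply: esum_ge; exists X].
Qed.

Lemma sum_symmetric {V : zmodType} (h : int -> V) n :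
  \sum_(j < n.*2.+1) h (j%:Z - n%:Z) =
  h 0 + \sum_(k < n) (h k.+1%:Z + h (- k.+1%:Z)).
Proof.
elim: n => [|n IH]; first by rewrite big_ord_recl !big_ord0 subrr.
rewrite doubleS big_ord_recl big_ord_recr/= [in RHS]big_ord_recr/= [in RHS]addrA -IH.
rewrite sub0r [LHS]addrC -addrA; congr (_ + (_ + _)).
  by apply: eq_bigr => j _; congr h; rewrite /bump/=; lia.
by congr h; rewrite /bump/= -addnn; lia.
Qed.

(** The induction carries a telescoping majorant, the value of the integral of x^-(1 + e). Its step
    reduces to (y / x)^e >= 1 + e / y for y = x + 1, which follows from ln (1 - 1/y) <= - 1/y. *)
Lemma riemann_sum_le {R : realType} (e : R) n : 0 < e ->
  \sum_(k < n) (k.+1%:R `^ (1 + e))^-1 <= 1 + e^-1.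
Proof.
move=> e0; suff H m : \sum_(k < m.+1) (k.+1%:R `^ (1 + e))^-1 <= 1 + e^-1 * (1 - (m.+1%:R `^ e)^-1).
  case: n => [|n]; first by rewrite big_ord0 addr_ge0// invr_ge0 ltW.
  apply: le_trans (H n) _; rewrite lerD2l -[leRHS]mulr1 ler_pM2l ?invr_gt0//.
elim: m => [|m IH]; first by rewrite big_ord1 !powR1 invr1 subrr mulr0 addr0.
rewrite big_ord_recr/=; apply: le_trans (lerD IH (lexx _)) _.
set x : R := m.+1%:R; set y : R := m.+2%:R.
have x0 : 0 < x by rewrite ltr0n.
have y0 : 0 < y by rewrite ltr0n.
have yx : y = x + 1 by rewrite /y /x -[in LHS]natr1.
have ye : 0 < y `^ e by exact: powR_gt0.
have xe : 0 < x `^ e by exact: powR_gt0.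
have step : 1 + e / y <= y `^ e / x `^ e.
  have -> : y `^ e / x `^ e = expR (e * - ln (1 + - y^-1)).
    have y1 : y - 1 = x by rewrite yx addrK.
    have -> : 1 + - y^-1 = x / y by rewrite -y1; field; rewrite gt_eqF.
    rewrite ln_div ?posrE// opprB mulrBr expRB.
    by rewrite /powR !gt_eqF.
  apply: le_trans (expR_ge1Dx _); rewrite lerD2l ler_pM2l//.
  rewrite -[leLHS]opprK lerN2 le_ln1Dx// ltrN2 invf_lt1// yx ltrDr//.
have key : (y `^ (1 + e))^-1 <= e^-1 * ((x `^ e)^-1 - (y `^ e)^-1).
  rewrite powRD; last by rewrite (gt_eqF y0) implybT.
  rewrite (powRr1 (ltW y0)) ler_pdivlMl//.
  have h : (1 + e / y) * (y `^ e)^-1 <= (x `^ e)^-1.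
    apply: le_trans (ler_wpM2r _ step) _; first by rewrite invr_ge0 ltW.
    by rewrite mulrAC mulfV ?mul1r ?gt_eqF.
  rewrite lerBrDr; apply: le_trans h; rewrite le_eqVlt; apply/orP; left; apply/eqP.
  by field; rewrite !gt_eqF.
apply: le_trans (lerD (lexx _) key) _; rewrite le_eqVlt; apply/orP; left; apply/eqP.
by ring.
Qed.

Section trigonometric_series.
Context {R : realType} (a b : R).
Hypothesis ab : a < b.
Notation mu := (@lebesgue_measure R).
Notation L := (b - a).
Local Notation lam k := (wavenum a b k).
Local Notation mode := (mode a b).
Local Notation fcoef := (fcoef a b).
Implicit Types (f g : R -> R) (c : bool) (k j n : nat) (A : bool -> nat -> R).

Definition abs_sum A n : R := \sum_(k < n) (`|A true k| + `|A false k|).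

(* The modes of wave numbers k and -k of a real function, taken together. *)
Definition trig_term A k (x : R) : R :=
  (if k == 0%N then 1 else 2) * (A true k * mode true k x + A false k * mode false k x).

Definition trig_series A (x : R) : R := limn (series (trig_term A ^~ x)).

(** The last summand corrects the generic value 1/2 at wave number zero: it becomes 1 for the cosine
    and 0 for the sine. *)
Lemma fcoef_mode c d j k : fcoef c (mode d j) k =
  (c == d)%:R * 2^-1 * ((j == k)%:R + (if c then 1 else -1) * ((j == 0%N) && (k == 0%N))%:R).
Proof.
have L0 := period_gt0 ab; have Lneq : b - a != 0 by rewrite gt_eqF.
have jkD : (j%:Z + k%:Z == 0) = (j == 0%N) && (k == 0%N) by case: j k => [|j] [|k].
have jkB : (j%:Z - k%:Z == 0) = (j == k) by rewrite subr_eq0.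
have im d' i : mu.-integrable `[a, b] (EFin \o mode d' i).
  by apply: integrable_itv; exact: continuous_mode.
have cD d' i i' : continuous (fun x => mode d' i x + mode d' i' x).
  by move=> x; apply: cvgD; exact: continuous_mode.
have cB d' i i' : continuous (fun x => mode d' i x - mode d' i' x).
  by move=> x; apply: cvgB; exact: continuous_mode.
rewrite !fcoefE; case: c.
  under eq_Rintegral do rewrite modeM.
  rewrite RintegralZl//; last exact/integrable_itv/cD.
  rewrite RintegralD// !integral_mode// jkD jkB.
  by case: d; rewrite /= ?mul1r; [field|rewrite !mul0r addr0 !mulr0].
case: d.
  under eq_Rintegral do rewrite mulrC modeM.
  rewrite RintegralZl//; last exact/integrable_itv/cD.
  by rewrite RintegralD// !integral_mode//= !mul0r addr0 !mulr0.
under eq_Rintegral do rewrite mode_sinM.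
rewrite RintegralZl//; last exact/integrable_itv/cB.
by rewrite RintegralB// !integral_mode// jkD jkB/=; field.
Qed.

Lemma continuous_trig_term A k : continuous (trig_term A k).
Proof.
move=> x; apply: cvgM; first exact: cvg_cst.
by apply: cvgD; apply: cvgM; (exact: cvg_cst || exact: continuous_mode).
Qed.

(** The number [A false 0] multiplies the zero function, so only the value 0 can be recovered from
    the term. *)
Lemma fcoef_trig_term A c j k : A false 0%N = 0 ->
  fcoef c (trig_term A j) k = (j == k)%:R * A c k.
Proof.
move=> A0; rewrite /trig_term fcoefZ//; last first.
  by move=> x; apply: cvgD; apply: cvgM; (exact: cvg_cst || exact: continuous_mode).
rewrite fcoef_lin//; [|exact: continuous_mode..].
have jk0 : (j == 0%N) && (k == 0%N) = (j == k) && (j == 0%N).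
  by case: j k => [|j] [|k]//=; rewrite andbF.
rewrite !fcoef_mode !jk0; have [<-|_] := eqVneq j k; last by rewrite /= !(mulr0, addr0, mul0r).
by have [->|_] := eqVneq j 0%N; case: c => /=; rewrite ?A0; field.
Qed.

Lemma trig_term_le A k x : `|trig_term A k x| <= 2 * (`|A true k| + `|A false k|).
Proof.
rewrite /trig_term normrM; apply: ler_pM => //.
  by case: ifP => _; rewrite ?normr1 ?normr_nat ?ler1n.
apply: le_trans (ler_normD _ _) _; rewrite !normrM.
by apply: lerD; rewrite ler_piMr// mode_le1.
Qed.

Section convergence.
Variables (A : bool -> nat -> R) (M : R).
Hypothesis AM : forall n, abs_sum A n <= M.

(** Weierstrass test: [S] majorises the partial sums independently of x, so [limn S - S n] bounds
    the tails uniformly. *)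
Let S n := 2 * abs_sum A n.

Let S_homo : {homo S : n m / (n <= m)%N >-> n <= m}.
Proof.
move=> n m /subnK <-; elim: (m - n)%N => // p IH.
apply: le_trans IH _; rewrite ler_pM2l// /abs_sum addSn big_ord_recr/=.
by rewrite lerDl addr_ge0.
Qed.

Let cvg_S : cvgn S.
Proof.
apply: nondecreasing_is_cvgn; first exact: S_homo.
by exists (2 * M) => _ [n _ <-]; rewrite ler_pM2l.
Qed.

Lemma trig_series_cvg x : series (trig_term A ^~ x) @ \oo --> trig_series A x.
Proof.
suff : cvgn (series (trig_term A ^~ x)) by [].
apply: normed_cvg; apply: nondecreasing_is_cvgn.
  by move=> n m; apply: (@nondecreasing_series _ (fun k => `|trig_term A k x|) predT 0%N).
exists (2 * M) => _ [n _ <-].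
rewrite /normed_series_of seriesEord/=; apply: (@le_trans _ _ (S n)); last by rewrite ler_pM2l.
by rewrite /S /abs_sum mulr_sumr; apply: ler_sum => k _; exact: trig_term_le.
Qed.

Let tail_le n m x : (n <= m)%N ->
  `|series (trig_term A ^~ x) m - series (trig_term A ^~ x) n| <= S m - S n.
Proof.
move=> nm; rewrite sub_series_geq// /S -mulrBr /abs_sum.
have := sub_series_geq (fun k => `|A true k| + `|A false k|) nm; rewrite seriesEord => ->.
rewrite mulr_sumr.
apply: le_trans (ler_norm_sum _ _ _) _.
by apply: ler_sum => k _; exact: trig_term_le.
Qed.

Lemma trig_series_tail n x :
  `|trig_series A x - series (trig_term A ^~ x) n| <= limn S - S n.
Proof.
have c1 : `|series (trig_term A ^~ x) m - series (trig_term A ^~ x) n| @[m --> \oo]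
    --> `|trig_series A x - series (trig_term A ^~ x) n|.
  by apply: cvg_norm; apply: cvgB; [exact: trig_series_cvg|exact: cvg_cst].
apply: (cvgr_to_le c1); near=> m; apply: (@le_trans _ _ (S m - S n)).
  by apply: tail_le; near: m; exact: nbhs_infty_ge.
by rewrite lerD2r; exact: nondecreasing_cvgn_le.
Unshelve. all: end_near. Qed.

Lemma trig_series_bound x : `|trig_series A x| <= 2 * M.
Proof.
have := trig_series_tail 0 x; rewrite seriesEord/= big_ord0 subr0 => h.
have S0 : S 0%N = 0 by rewrite /S /abs_sum big_ord0 mulr0.
apply: le_trans h _; rewrite S0 subr0.
apply: limr_le; first exact: cvg_S.
by apply: nearW => n; rewrite ler_pM2l.
Qed.

Let tail_small (e : R) : 0 < e -> exists n, limn S - S n < e.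
Proof.
move=> e0; have [n _ h] := (cvgrPdist_lt _ _).1 cvg_S e e0.
exists n; have := h n (leqnn n); apply: le_lt_trans; exact: ler_norm.
Qed.

Let continuous_partial n : continuous (fun x => series (trig_term A ^~ x) n).
Proof.
under eq_fun do rewrite seriesEord.
by apply: continuous_sum => k; exact: continuous_trig_term.
Qed.

Lemma continuous_trig_series : continuous (trig_series A).
Proof.
move=> x; apply/cvgrPdist_lt => e e0.
have e3 : 0 < e / 3 by rewrite divr_gt0.
have [n tn] := tail_small e3.
have /cvgrPdist_lt /(_ _ e3) hn := @continuous_partial n x.
near=> y.
have H : `|series (trig_term A ^~ x) n - series (trig_term A ^~ y) n| < e / 3.
  by near: y.
have := trig_series_tail n x; have := trig_series_tail n y; move: H.
rewrite !ltr_norml !ler_norml => /andP[? ?] /andP[? ?] /andP[? ?].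
by apply/andP; split; lra.
Unshelve. all: end_near. Qed.

Lemma trig_series_periodic : periodic (trig_series A) L.
Proof.
move=> x; rewrite /trig_series; congr (limn (series _)); apply/funext => k.
by rewrite /trig_term !mode_periodic.
Qed.

(** As soon as n exceeds k, the partial sum has exactly the coefficient [A c k], and the remainder
    changes it by at most the uniform tail. *)
Lemma fcoef_trig_series c k : A false 0%N = 0 -> fcoef c (trig_series A) k = A c k.
Proof.
move=> A0; apply/eqP; rewrite -subr_eq0 -normr_le0.
apply/ler_addgt0Pl => e e0; rewrite addr0.
have [n0 tn0] := tail_small e0; pose n := maxn n0 k.+1.
have tn : limn S - S n <= e.
  by apply/ltW; apply: le_lt_trans tn0; rewrite lerD2l lerN2 S_homo// leq_maxl.
have cn : fcoef c (fun x => series (trig_term A ^~ x) n) k = A c k.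
  under eq_fun do rewrite seriesEord/=.
  have -> : (fun x => \sum_(i < n) trig_term A i x) =
      (fun x => \sum_(i < n) 1 * trig_term A i x).
    by apply/funext => x; apply: eq_bigr => i _; rewrite mul1r.
  rewrite (fcoef_sum ab c (index_enum _) (fun=> 1)); last first.
    by move=> i; exact: continuous_trig_term.
  have kn : (k < n)%N by rewrite leq_max leqnn orbT.
  rewrite (bigD1 (Ordinal kn))//= fcoef_trig_term// eqxx !mul1r big1 ?addr0//.
  move=> i; rewrite -val_eqE/= => /negbTE ik.
  by rewrite fcoef_trig_term// ik mul0r mulr0.
rewrite -{1}cn -fcoefB//; last exact: continuous_trig_series.
apply: fcoef_le => //; last by move=> x _; exact: le_trans (trig_series_tail n x) tn.
by move=> x; apply: cvgB; [exact: continuous_trig_series|exact: continuous_partial].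
Qed.

End convergence.

Lemma fcoef_false0 f : fcoef false f 0%N = 0.
Proof.
rewrite !fcoefE; under eq_Rintegral do rewrite mode0 mulr0.
by rewrite Rintegral_itv_cst ?ltW// mul0r mulr0.
Qed.

Lemma fourier_multE (m : int -> R[i]) f A M : (forall n, abs_sum A n <= M) ->
  (forall x, complex.Re (m 0 * fourier a b f 0 * fourier_mode a b 0 x)%C = A true 0%N) ->
  (forall k x, complex.Re (m k.+1%:Z * fourier a b f k.+1%:Z * fourier_mode a b k.+1%:Z x)%C +
    complex.Re (m (- k.+1%:Z) * fourier a b f (- k.+1%:Z) * fourier_mode a b (- k.+1%:Z) x)%C
    = 2 * (A true k.+1 * mode true k.+1 x + A false k.+1 * mode false k.+1 x)) ->
  fourier_mult a b m f = trig_series A.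
Proof.
move=> AM H0 H; apply/funext => x.
have c := @trig_series_cvg _ _ AM x.
rewrite /fourier_mult; apply: cvg_lim => //.
(* The symmetric sum over |k| <= n consists of the mode 0 and n pairs, hence of n + 1 terms of the
   series. *)
rewrite -cvg_shiftS in c; apply: cvg_trans c.
rewrite [X in X @ \oo --> _](_ : _ = (fun n => series (trig_term A ^~ x) n.+1))//.
apply/funext => n.
rewrite (sum_symmetric
  (fun k : int => complex.Re (m k * fourier a b f k * fourier_mode a b k x)%C)).
rewrite H0 seriesEord/= big_ord_recl/=; congr (_ + _).
  by rewrite /trig_term eqxx !mode0 mulr1 mulr0 addr0 mul1r.
by apply: eq_bigr => k _; rewrite H /trig_term.
Qed.

End trigonometric_series.

#[global] Opaque mode wavenum.

(** * Sobolev spaces and nonlocal operators *)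

Section sobolev_spaces.
Context {R : realType} (a b : R).
Hypothesis ab : a < b.
Notation mu := (@lebesgue_measure R).
Notation L := (b - a).
Local Notation lam k := (wavenum a b k).
Local Notation mode := (mode a b).
Local Notation fcoef := (fcoef a b).
Local Notation normsq_H := (sobolev_normsq a b).
Implicit Types (f g : R -> R) (c : bool) (k j n : nat) (A : bool -> nat -> R) (r : R).

Definition weight r (k : int) : R := (1 + lam k ^+ 2) `^ r.

Lemma weight_base_gt0 (k : int) : 0 < 1 + lam k ^+ 2.
Proof. by rewrite ltr_wpDr// sqr_ge0. Qed.

Lemma weight_gt0 r (k : int) : 0 < weight r k.
Proof. by rewrite powR_gt0// weight_base_gt0. Qed.

Lemma weight_ge1 r (k : int) : 0 <= r -> 1 <= weight r k.
Proof.
move=> r0; rewrite -(powRr0 (1 + lam k ^+ 2)) ler_powR//.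
by rewrite lerDl sqr_ge0.
Qed.

Lemma weightD1 r (k : int) : weight (r + 1) k = weight r k * (1 + lam k ^+ 2).
Proof.
rewrite /weight powRD; last by rewrite (gt_eqF (weight_base_gt0 k)) implybT.
by rewrite powRr1// ltW// weight_base_gt0.
Qed.

Lemma sum_inv_weight_le r : 1 / 2 < r ->
  exists2 K, 0 < K & forall n, \sum_(k < n) (weight r k)^-1 <= K.
Proof.
move=> r2; have l0 := wavenum1_gt0 ab.
have e0 : 0 < 2 * r - 1 by lra.
set C := ((lam 1 ^+ 2) `^ r)^-1.
have C0 : 0 < C by rewrite invr_gt0 powR_gt0// exprn_gt0.
(* The summand 1 is the term k = 0. The other terms are at most C k^-(2r), and 2r - 1 is the excess
   over 1 in [riemann_sum_le]. *)
exists (1 + C * (1 + (2 * r - 1)^-1)).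
  by rewrite addr_gt0// mulr_gt0// addr_gt0// invr_gt0.
case=> [|n].
  by rewrite big_ord0 addr_ge0// mulr_ge0 ?(ltW C0)// addr_ge0// invr_ge0 ltW.
rewrite big_ord_recl/=; apply: lerD.
  by rewrite /weight wavenum0 expr0n addr0 powR1 invr1.
apply: le_trans (ler_wpM2l (ltW C0) (riemann_sum_le n e0)).
rewrite mulr_sumr; apply: ler_sum => k _.
rewrite /C -invfM lef_pV2 ?posrE ?weight_gt0//; last first.
  by rewrite mulr_gt0// powR_gt0// exprn_gt0.
rewrite (_ : 1 + (2 * r - 1) = 2%:R * r); last by lra.
rewrite powRrM powR_mulrn// -powRM ?sqr_ge0//.
apply: ge0_ler_powR.
- by lra.
- by rewrite nnegrE -exprMn sqr_ge0.
- by rewrite nnegrE ltW// weight_base_gt0.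
have -> : lam (bump 0 k) = k.+1%:R * lam 1 by rewrite wavenumE /bump/= add1n.
by rewrite -exprMn mulrC lerDr.
Qed.

Definition wsum r A n : R :=
  \sum_(k < n) weight r k * (A true k ^+ 2 + A false k ^+ 2).

(* Weighted AM-GM: [2 |x| <= theta w x^2 + 1 / (theta w)] *)
Lemma abs_sum_le r : 1 / 2 < r -> exists2 K, 0 < K &
  forall A N theta, 0 < theta -> (forall n, wsum r A n <= N) ->
  forall n, abs_sum A n <= theta * N + K / theta.
Proof.
move=> r2; have [K K0 HK] := sum_inv_weight_le r2.
exists K => // A N th th0 AN n.
have wN : 0 <= wsum r A n.
  apply: sumr_ge0 => k _; rewrite mulr_ge0 ?(ltW (weight_gt0 _ _))//.
  by rewrite addr_ge0// sqr_ge0.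
apply: (@le_trans _ _ (th * wsum r A n + \sum_(k < n) (weight r k)^-1 / th)); last first.
  by apply: lerD; [rewrite ler_pM2l|rewrite -mulr_suml ler_pM2r ?invr_gt0].
rewrite /wsum mulr_sumr -big_split/=; apply: ler_sum => k _.
have w0 := weight_gt0 r k; set w := weight r k in w0 *.
have amgm (x : R) : `|x| <= 2^-1 * (th * w * x ^+ 2 + w^-1 / th).
  have tw0 : 0 < th * w by rewrite mulr_gt0.
  rewrite -(ler_pM2l (_ : 0 < 2 * (th * w))) ?mulr_gt0//.
  rewrite -subr_ge0 (_ : _ - _ = (th * w * `|x| - 1) ^+ 2) ?sqr_ge0//.
  have -> : x ^+ 2 = `|x| ^+ 2 by rewrite real_normK// num_real.
  by field; rewrite !gt_eqF.
have := amgm (A true k); have := amgm (A false k).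
have : 0 <= th * w * (A true k ^+ 2 + A false k ^+ 2).
  by rewrite !mulr_ge0 ?(ltW th0) ?(ltW w0)// addr_ge0// sqr_ge0.
by rewrite mulrA; lra.
Qed.

Lemma normsq_fourier f (k : int) :
  normsq (fourier a b f k) = fcoef true f k ^+ 2 + fcoef false f k ^+ 2.
Proof. by rewrite /normsq fourierE/= sqrrN. Qed.

Lemma normsq_ge0 (z : R[i]) : 0 <= normsq z.
Proof. by rewrite /normsq addr_ge0// sqr_ge0. Qed.

Lemma sobolev_term_ge0 r f (k : int) :
  (0 <= (powR (1 + lam k ^+ 2) r * normsq (fourier a b f k))%:E)%E.
Proof. by rewrite lee_fin mulr_ge0 ?powR_ge0 ?normsq_ge0. Qed.

Lemma sobolev_normsq_ge0 r f : (0 <= normsq_H r f)%E.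
Proof. by apply: esum_ge0 => k _; exact: sobolev_term_ge0. Qed.

Lemma sobolev_normsq_fin r f : (normsq_H r f < +oo)%E -> normsq_H r f \is a fin_num.
Proof. by move=> fy; rewrite ge0_fin_numE// sobolev_normsq_ge0. Qed.

Lemma sobolev_normsq_term r f (k : int) :
  ((weight r k * normsq (fourier a b f k))%:E <= normsq_H r f)%E.
Proof.
apply: esum_ge; exists [set k]; first by split => //; exact: finite_set1.
by rewrite fsbig_set1.
Qed.

Lemma wsum_sobolev r f n : (normsq_H r f < +oo)%E ->
  wsum r (fun c k => fcoef c f k) n <= fine (normsq_H r f).
Proof.
move=> fy; rewrite -lee_fin fineK ?sobolev_normsq_fin//.
apply: esum_ge; exists (Posz @` `I_n).
  by split => //; exact/finite_image/finite_II.
rewrite fsbig_image; last by move=> i j _ _ [].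
rewrite -fsbig_ord/= sumEFin lee_fin; apply: ler_sum => k _.
by rewrite normsq_fourier.
Qed.

Lemma sobolev_normsq_ge_fcoef r f c (k : int) : 0 <= r ->
  ((fcoef c f k ^+ 2)%:E <= normsq_H r f)%E.
Proof.
move=> r0; apply: le_trans (sobolev_normsq_term r f k).
rewrite lee_fin normsq_fourier; apply: (@le_trans _ _ (fcoef true f k ^+ 2 + fcoef false f k ^+ 2)).
  by case: c; rewrite ?lerDl ?lerDr sqr_ge0.
by rewrite ler_peMl ?weight_ge1// addr_ge0// sqr_ge0.
Qed.

Lemma le_sobolev_normsq r1 r2 f g (C : R) : 0 <= C ->
  (forall k : int, weight r1 k * normsq (fourier a b f k) <=
    C * (weight r2 k * normsq (fourier a b g k))) ->
  (normsq_H r1 f <= C%:E * normsq_H r2 g)%E.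
Proof.
move=> C0 H; apply: le_trans (esumZl_le _ C0 (sobolev_term_ge0 r2 g)).
by apply: le_esum => k _; rewrite -EFinM lee_fin H.
Qed.

(** Sobolev embedding: r > 1/2 makes the coefficients absolutely summable, and the sum of the series
    has the coefficients of f. The parameter theta stays free so that the bound can be made small
    with the norm. *)
Lemma sobolevP r : 1 / 2 < r -> exists2 K, 0 < K &
  forall f theta, sobolev a b r f -> 0 < theta ->
    f = trig_series a b (fun c k => fcoef c f k) /\
    forall n, abs_sum (fun c k => fcoef c f k) n <=
      theta * fine (normsq_H r f) + K / theta.
Proof.
move=> r2; have [K K0 HK] := abs_sum_le r2; exists K => // f th [cf pf fy] th0.
have AM := HK _ _ _ th0 (fun n => wsum_sobolev n fy).
split => //; apply: (fcoef_inj ab) => //.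
- exact: continuous_trig_series AM.
- exact: trig_series_periodic.
by move=> c k; rewrite (fcoef_trig_series _ AM)// fcoef_false0.
Qed.

Lemma sobolev_sup_lt r : 1 / 2 < r -> forall e, 0 < e ->
  exists2 dl : R, 0 < dl & forall f, continuous f -> periodic f L ->
    (normsq_H r f < dl%:E)%E -> forall x, `|f x| < e.
Proof.
move=> r2 e e0; have [K K0 HK] := sobolevP r2.
(* This choice makes K / th equal to e / 6, and a squared norm below e / (6 * th) bounds the other
   summand by e / 6. The series is at most twice their sum, 2e / 3. *)
pose th := 6 * K / e; have th0 : 0 < th by rewrite divr_gt0// mulr_gt0.
exists (e / (6 * th)); first by rewrite divr_gt0// mulr_gt0.
move=> f cf pf fd x.
have fy : (normsq_H r f < +oo)%E by apply: lt_trans fd _; rewrite ltry.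
have sf : sobolev a b r f by split.
have [fE AM] := HK f th sf th0.
have := @trig_series_bound _ a b _ _ AM x; rewrite -fE => hb; apply: le_lt_trans hb _.
have : fine (normsq_H r f) < e / (6 * th).
  by rewrite -lte_fin fineK// sobolev_normsq_fin.
move=> h; have h2 : th * fine (normsq_H r f) < e / 6.
  have -> : e / 6 = th * (e / (6 * th)) by field; rewrite gt_eqF.
  by rewrite ltr_pM2l.
have h3 : K / th = e / 6 by rewrite /th; field; rewrite !gt_eqF.
by rewrite h3; lra.
Qed.

(** The termwise differentiated series has a finite H^(r-1) norm and converges absolutely because r
    - 1 > 1/2; [is_derive_fcoef] then shows that its sum is the classical derivative. *)
Lemma sobolev_derive r f : 3 / 2 < r -> sobolev a b r f ->
  [/\ forall x, is_derive x (1 : R) f (derive1 f x),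
      sobolev a b (r - 1) (derive1 f) &
      (normsq_H (r - 1) (derive1 f) <= normsq_H r f)%E].
Proof.
move=> r3 [cf pf fy].
pose A c k := (if c then 1 else -1) * lam k * fcoef (~~ c) f k.
have wstep (k : int) : weight (r - 1) k * lam k ^+ 2 <= weight r k.
  rewrite -{2}(subrK 1 r) weightD1 ler_pM2l ?weight_gt0//; by rewrite lerDr.
have sq c k : A c k ^+ 2 = lam k ^+ 2 * fcoef (~~ c) f k ^+ 2.
  by rewrite /A !exprMn; case: c; rewrite ?sqrrN expr1n mul1r.
have AN n : wsum (r - 1) A n <= fine (normsq_H r f).
  apply: le_trans (wsum_sobolev n fy); apply: ler_sum => k _.
  rewrite !sq/= -mulrDr mulrA [X in _ <= _ * X]addrC.
  by apply: ler_wpM2r; [rewrite addr_ge0// sqr_ge0|exact: wstep].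
have r12 : 1 / 2 < r - 1 by lra.
have [K K0 HK] := abs_sum_le r12.
have AM := HK A _ 1 ltr01 AN.
pose g := trig_series a b A.
have A0 : A false 0%N = 0 by rewrite /A wavenum0 mulr0 mul0r.
have cg : continuous g by exact: continuous_trig_series AM.
have pg : periodic g L by exact: trig_series_periodic.
have dfg : forall x, is_derive x (1 : R) f (g x).
  by apply: (is_derive_fcoef ab) => // c k; rewrite (fcoef_trig_series _ AM).
have f'g : derive1 f = g by apply/funext => x; rewrite derive1E; have [_] := dfg x.
have gN : (normsq_H (r - 1) g <= normsq_H r f)%E.
  apply: le_esum => k _; rewrite lee_fin !normsq_fourier !(fcoef_is_derive ab _ _ pf cg dfg)/=.
  have := wstep k; rewrite /weight.
  move: (fcoef true f k) (fcoef false f k) (lam k) => x y l h.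
  have -> : (1 * l * y) ^+ 2 + (-1 * l * x) ^+ 2 = l ^+ 2 * (x ^+ 2 + y ^+ 2) by ring.
  by rewrite mulrA; apply: ler_wpM2r; [rewrite addr_ge0// sqr_ge0|exact: h].
rewrite f'g; split; [exact: dfg| |exact: gN].
by split; [exact: cg|exact: pg|exact: le_lt_trans gN fy].
Qed.

End sobolev_spaces.

(** * The operators Λ and ∂ₓ⁻¹ *)

Section nonlocal_operators.
Context {R : realType} (a b : R).
Hypothesis ab : a < b.
Notation L := (b - a).
Local Notation lam k := (wavenum a b k).
Local Notation mode := (mode a b).
Local Notation fcoef := (fcoef a b).
Local Notation Lam := (Lambda a b).
Implicit Types (f g : R -> R) (c : bool) (k j n : nat) (r : R).

Lemma fourier_modeE (k : int) x :
  fourier_mode a b k x = (mode true k x +i* mode false k x)%C.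
Proof. by []. Qed.

Lemma Re_mult3 (m1 m2 x y u v : R) :
  complex.Re ((m1 +i* m2) * (x -i* y) * (u +i* v))%C =
  m1 * (x * u + y * v) + m2 * (y * u - x * v).
Proof. by simpc; rewrite /=; ring. Qed.

Lemma inv_imaginary (y : R) : y != 0 -> ((0 +i* y)^-1)%C = (0 +i* (- y^-1))%C :> R[i].
Proof.
move=> y0; have z0 : (0 +i* y)%C != 0 :> R[i] by rewrite eq_complex/= negb_and y0 orbT.
apply: (mulfI z0); rewrite mulfV//; simpc.
by rewrite mulfV.
Qed.

(** The symbol of Λ is the inverse weight of order 1, which is summable since 1 > 1/2. A bound on
    sup |f| is therefore enough, and Λ is bounded in the uniform norm. *)
Lemma abs_sum_Lambda : exists2 K, 0 < K & forall f M, continuous f ->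
  (forall x, `|f x| <= M) -> forall n,
  abs_sum (fun c k => (1 + lam k ^+ 2)^-1 * fcoef c f k) n <= K * M.
Proof.
have h : 1 / 2 < 1 :> R by lra.
have [K K0 HK] := sum_inv_weight_le ab h.
exists (2 * K); first by rewrite mulr_gt0.
move=> f M cf fM n.
have M0 : 0 <= M by apply: le_trans (fM 0).
rewrite -mulrA [K * M]mulrC mulrA; apply: le_trans (ler_wpM2l _ (HK n)); last by rewrite mulr_ge0.
rewrite mulr_sumr; apply: ler_sum => k _.
rewrite /weight powRr1 ?(ltW (weight_base_gt0 _ _ _))// !normrM -mulrDr.
rewrite ger0_norm ?invr_ge0 ?(ltW (weight_base_gt0 _ _ _))// mulrC ler_wpM2r//.
  by rewrite invr_ge0 ltW// weight_base_gt0.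
rewrite mulr_natl mulr2n; apply: lerD; apply: fcoef_le => // x _; exact: fM.
Qed.

Lemma Lambda_series f M : continuous f -> (forall x, `|f x| <= M) ->
  Lam f = trig_series a b (fun c k => (1 + lam k ^+ 2)^-1 * fcoef c f k).
Proof.
move=> cf fM; have [K K0 HK] := abs_sum_Lambda.
apply: fourier_multE (HK _ _ cf fM) _ _ => [x|k x].
  rewrite fourierE fourier_modeE Re_mult3 !mode0/= mul0r addr0.
  by rewrite mulr1 mulr0 addr0.
rewrite !fourierE !fourier_modeE !Re_mult3 !mul0r !addr0.
rewrite wavenumN sqrrN !fcoefN// !modeN; ring.
Qed.

#[local] Opaque Lambda.

Lemma LambdaP f : continuous f -> periodic f L ->
  [/\ continuous (Lam f), periodic (Lam f) L &
      forall c k, fcoef c (Lam f) k = (1 + lam k ^+ 2)^-1 * fcoef c f k].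
Proof.
move=> cf pf; have [M _ fM] := periodic_bounded ab cf pf.
have [K K0 HK] := abs_sum_Lambda; have AM := HK _ _ cf fM.
rewrite (Lambda_series cf fM); split.
- exact: continuous_trig_series AM.
- exact: trig_series_periodic.
by move=> c k; rewrite (fcoef_trig_series _ AM)// fcoef_false0// mulr0.
Qed.

Lemma Lambda_bound : exists2 K, 0 < K & forall f M, continuous f ->
  (forall x, `|f x| <= M) -> forall x, `|Lam f x| <= K * M.
Proof.
have [K K0 HK] := abs_sum_Lambda; exists (2 * K); first by rewrite mulr_gt0.
move=> f M cf fM x; rewrite (Lambda_series cf fM) -mulrA.
exact: trig_series_bound (HK _ _ cf fM) x.
Qed.

Lemma LambdaB f g : continuous f -> periodic f L -> continuous g -> periodic g L ->
  (fun x => Lam f x - Lam g x) = Lam (fun x => f x - g x).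
Proof.
move=> cf pf cg pg; have [cLf pLf fLf] := LambdaP cf pf.
have [cLg pLg fLg] := LambdaP cg pg.
have cfg : continuous (fun x => f x - g x) by move=> x; apply: cvgB; [exact: cf|exact: cg].
have pfg : periodic (fun x => f x - g x) L by move=> x; rewrite pf pg.
have [cLfg pLfg fLfg] := LambdaP cfg pfg.
have cB : continuous (fun x => Lam f x - Lam g x).
  by move=> x; apply: cvgB; [exact: cLf|exact: cLg].
have pB : periodic (fun x => Lam f x - Lam g x) L by move=> x; rewrite pLf pLg.
apply: (fcoef_inj ab cB cLfg pB pLfg) => c k.
by rewrite fLfg fcoefB// [in RHS]fcoefB// fLf fLg mulrBr.
Qed.

Lemma is_derive_Lambda f g : periodic f L -> continuous g -> periodic g L ->
  (forall x, is_derive x (1 : R) f (g x)) ->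
  forall x, is_derive x (1 : R) (Lam f) (Lam g x).
Proof.
move=> pf cg pg fg.
have cf : continuous f by move=> x; exact: is_derive_continuous (fg x).
have [cLf pLf fLf] := LambdaP cf pf; have [cLg pLg fLg] := LambdaP cg pg.
apply: (is_derive_fcoef ab cLf pLf cLg pLg) => c k.
by rewrite fLg fLf (fcoef_is_derive ab c k pf cg fg); ring.
Qed.

(** This is Λ∂ₓ² = Λ - 1 applied to f, with g = f' in place of the second derivative, so that f need
    only be C^1. It is the reason why F(u)_x involves no third derivative of u. *)
Lemma is_derive_Lambda_derive f g : periodic f L -> continuous g -> periodic g L ->
  (forall x, is_derive x (1 : R) f (g x)) ->
  forall x, is_derive x (1 : R) (Lam g) (Lam f x - f x).
Proof.
move=> pf cg pg fg.
have cf : continuous f by move=> x; exact: is_derive_continuous (fg x).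
have [cLf pLf fLf] := LambdaP cf pf; have [cLg pLg fLg] := LambdaP cg pg.
have cB : continuous (fun x => Lam f x - f x).
  by move=> x; apply: cvgB; [exact: cLf|exact: cf].
have pB : periodic (fun x => Lam f x - f x) L by move=> x; rewrite pLf pf.
apply: (is_derive_fcoef ab cLg pLg cB pB) => c k.
rewrite fcoefB// fLf fLg (fcoef_is_derive ab (~~ c) k pf cg fg) negbK.
have w0 := weight_base_gt0 a b k.
by case: c; rewrite /=; field; rewrite gt_eqF.
Qed.

Lemma dxinvP f M : continuous f ->
  (forall n, abs_sum (fun c k => fcoef c f k) n <= M) ->
  [/\ continuous (dxinv a b f), periodic (dxinv a b f) L &
      forall c k, fcoef c (dxinv a b f) k =
        (if c then -1 else 1) * (lam k)^-1 * fcoef (~~ c) f k].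
Proof.
move=> cf fM.
(* At k = 0 the inverse of [lam 0] is 0 by convention, in agreement with the symbol of [dxinv]. *)
pose A c k := (if c then -1 else 1) * (lam k)^-1 * fcoef (~~ c) f k.
have l0 := wavenum1_gt0 ab.
have lle k : `|(lam k)^-1| <= (lam 1)^-1.
  case: k => [|k]; first by rewrite wavenum0 invr0 normr0 invr_ge0 ltW.
  rewrite wavenumE invfM normrM [X in _ * X]ger0_norm ?invr_ge0 ?(ltW l0)//.
  rewrite ler_piMl ?invr_ge0 ?(ltW l0)// normfV.
  have -> : (k.+1%:Z%:~R : R) = k.+1%:R by [].
  by rewrite normr_nat invf_le1 ?ltr0n// ler1n.
have AM n : abs_sum A n <= (lam 1)^-1 * M.
  apply: (@le_trans _ _ ((lam 1)^-1 * abs_sum (fun c k => fcoef c f k) n)); last first.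
    by rewrite ler_pM2l ?invr_gt0.
  rewrite /abs_sum mulr_sumr; apply: ler_sum => k _.
  rewrite /A !normrM normrN1 normr1 !mul1r -mulrDr addrC ler_wpM2r//.
have A0 : A false 0%N = 0 by rewrite /A wavenum0 invr0 mulr0 mul0r.
have E : dxinv a b f = trig_series a b A.
  apply: fourier_multE AM _ _ => [x|k x].
    by rewrite eqxx !mul0r /A wavenum0 invr0 mulr0 mul0r.
  have lk : lam k.+1 != 0 by rewrite wavenum_eq0.
  have lk' : lam (- k.+1%:Z) != 0 by rewrite wavenum_eq0.
  rewrite (_ : (k.+1%:Z == 0) = false)// (_ : (- k.+1%:Z == 0) = false)// !inv_imaginary//.
  rewrite !fourierE !fourier_modeE !Re_mult3 !mul0r !add0r.
  by rewrite /A wavenumN invrN !fcoefN// !modeN/=; ring.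
rewrite E; split.
- exact: continuous_trig_series AM.
- exact: trig_series_periodic.
by move=> c k; rewrite (fcoef_trig_series _ AM).
Qed.

Lemma le_sobolev_normsq_nat r1 r2 f g (C : R) : continuous f -> continuous g -> 0 <= C ->
  (forall k, weight a b r1 k * (fcoef true f k ^+ 2 + fcoef false f k ^+ 2) <=
    C * (weight a b r2 k * (fcoef true g k ^+ 2 + fcoef false g k ^+ 2))) ->
  (sobolev_normsq a b r1 f <= C%:E * sobolev_normsq a b r2 g)%E.
Proof.
move=> cf cg C0 H; apply: le_sobolev_normsq => // -[k|k]; rewrite !normsq_fourier//.
rewrite NegzE !fcoefN// /weight !wavenumN !mul1r !mulN1r !sqrrN.
exact: H.
Qed.

End nonlocal_operators.

#[global] Opaque Lambda dxinv.

(** * Pathwise analysis *)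

Lemma within_filterS {T : topologicalType} (D : set T) (x : T) (P Q : set T) :
  (forall t, D t -> P t -> Q t) -> within D (nbhs x) P -> within D (nbhs x) Q.
Proof.
move=> PQ; apply: (@filterS _ (nbhs x) _ [set t | D t -> P t] [set t | D t -> Q t]).
by move=> t h Dt; exact: PQ Dt (h Dt).
Qed.

(** * Integrals with a parameter and joint continuity in time and space *)

Section integrals_with_parameter.
Context {R : realType}.
Notation mu := (@lebesgue_measure R).
Implicit Types (f : R -> R -> R).

Lemma Rintegral_itvB_cc (g : R -> R) (c d e : R) : c <= d -> d <= e ->
  {within `[c, e], continuous g} ->
  \int[mu]_(x in `[c, e]) g x - \int[mu]_(x in `[c, d]) g x = \int[mu]_(x in `[d, e]) g x.
Proof.
move=> cd de cg; have ig := within_continuous_integrable cg.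
rewrite Rintegral_itvB ?bnd_simp// Rintegral_itv_obnd_cbnd//.
apply: integrableS ig => //.
by apply: subset_itv; rewrite bnd_simp.
Qed.

Lemma is_derive_under_integral f f' (c d u v p M : R) : p \in `]u, v[ ->
  (forall x, x \in `]u, v[ -> {within `[c, d], continuous (f x)}) ->
  (forall x y, x \in `]u, v[ -> y \in `[c, d] -> is_derive x (1 : R) (f ^~ y) (f' x y)) ->
  (forall x y, x \in `]u, v[ -> y \in `[c, d] -> `|f' x y| <= M) ->
  is_derive p (1 : R) (fun x => \int[mu]_(y in `[c, d]) f x y)
    (\int[mu]_(y in `[c, d]) f' p y).
Proof.
move=> puv cf df f'M.
have intf x : `]u, v[%classic x -> mu.-integrable `[c, d] (EFin \o f x).
  by move=> xuv; apply: within_continuous_integrable; exact: cf.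
have ex x y : `]u, v[%classic x -> `[c, d]%classic y -> partial1of2 f x y = f' x y.
  by move=> xuv ycd; rewrite partial1of2E; have [_ ->] := df x y xuv ycd.
have H := @cvg_differentiation_under_integral R _ _ mu f `[c, d] _ p u v puv intf _
  (fun=> `|M|) _ _ _.
have {}H : h^-1 *: (\int[mu]_(y in `[c, d]) f (h + p) y - \int[mu]_(y in `[c, d]) f p y)
    @[h --> 0^'] --> \int[mu]_(y in `[c, d]) f' p y.
  rewrite (_ : \int[mu]_(y in `[c, d]) f' p y = \int[mu]_(y in `[c, d]) partial1of2 f p y).
    apply: H => //.
    - by move=> x y xuv ycd; have [] := df x y xuv ycd.
    - apply: (@within_continuous_integrable _ (fun=> `|M|)).
      by apply: continuous_within => x; exact: cvg_cst.
    - move=> x y xuv ycd; rewrite ex//; apply: le_trans (f'M _ _ xuv ycd) _; exact: ler_norm.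
  by apply: eq_Rintegral => y; rewrite inE => ycd; rewrite ex.
apply: DeriveDef.
  apply/cvg_ex => /=; exists (\int[mu]_(y in `[c, d]) f' p y).
  by under eq_fun do rewrite scaler1.
rewrite /derive; apply/cvg_lim => //.
by under eq_fun do rewrite scaler1.
Qed.

End integrals_with_parameter.

Section joint_continuity.
Context {R : realType}.
Implicit Types (D : set R) (f : R -> R -> R).

Definition joint_continuous D f :=
  {within D `*` [set: R], continuous (fun tx : R * R => f tx.1 tx.2)}.

Lemma joint_continuous_time D f x : joint_continuous D f ->
  {within D, continuous (fun t => f t x)}.
Proof.
move=> /subspace_continuousP cf; apply/subspace_continuousP => t Dt.
have := cf (t, x) (conj Dt Logic.I) => /cvgrPdist_lt h.
apply/cvgrPdist_lt => e e0; have [[P Q] [/= tP xQ] PQ] := h e e0.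
apply: filterS tP => r Pr Dr; apply: (PQ (r, x)) => //; split => //=.
exact: nbhs_singleton xQ.
Qed.

Lemma joint_continuous_space D f t : joint_continuous D f -> D t -> continuous (f t).
Proof.
move=> /subspace_continuousP cf Dt x.
have := cf (t, x) (conj Dt Logic.I) => /cvgrPdist_lt h.
apply/cvgrPdist_lt => e e0; have [[P Q] [/= tP xQ] PQ] := h e e0.
by apply: filterS xQ => y Qy; apply: (PQ (t, y)) => //; split => //=; exact: nbhs_singleton tP.
Qed.

Lemma joint_continuous_bounded D f (s t c d : R) : joint_continuous D f ->
  `[s, t] `<=` D -> exists M, forall r x, r \in `[s, t] -> x \in `[c, d] -> `|f r x| <= M.
Proof.
move=> cf stD.
have cpt : compact (`[s, t] `*` `[c, d]).
  by apply: compact_setX; exact: segment_compact.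
have cf' : {within `[s, t] `*` `[c, d], continuous (fun tx : R * R => f tx.1 tx.2)}.
  by apply: continuous_subspaceW cf => -[r x] [/= /stD ? ?].
have /compact_bounded [M [_ hM]] := continuous_compact cf' cpt.
exists (M + 1) => r x rst xcd; apply: hM; first by rewrite ltrDl.
by exists (r, x).
Qed.

End joint_continuity.

(** * Paths in the space of continuous periodic functions *)

Section uniform_paths.
Context {R : realType} (a b : R).
Hypothesis ab : a < b.
Notation mu := (@lebesgue_measure R).
Notation L := (b - a).
Local Notation lam k := (wavenum a b k).
Local Notation Lam := (Lambda a b).
Implicit Types (D : set R) (f g : R -> R -> R).

(** The space C(D; C(T_L)). In this form stability under the nonlocal operator Λ is immediate from
    [Lambda_bound], while joint continuity in (t, x) follows by [upath_joint]. *)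
Definition upath D f :=
  (forall t, D t -> continuous (f t) /\ periodic (f t) L) /\
  (forall t0, D t0 -> forall e : R, 0 < e ->
    \forall t \near within D (nbhs t0), forall x, `|f t x - f t0 x| < e).

Lemma upath_eq D f g : (forall t, D t -> f t = g t) -> upath D g -> upath D f.
Proof.
move=> fg [gc gu]; split => [t Dt|t0 Dt0 e e0]; first by rewrite fg//; exact: gc.
by apply: within_filterS (gu t0 Dt0 e e0) => t Dt h x; rewrite !fg//; exact: h.
Qed.

Lemma upath_cst D (g : R -> R) : continuous g -> periodic g L -> upath D (fun=> g).
Proof.
by move=> cg pg; split => // t0 Dt0 e e0; apply: nearW => t x; rewrite subrr normr0.
Qed.

Lemma upathD D f g : upath D f -> upath D g -> upath D (fun t x => f t x + g t x).
Proof.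
move=> [fc fu] [gc gu]; split => [t Dt|t0 Dt0 e e0].
  have [cf pf] := fc t Dt; have [cg pg] := gc t Dt; split.
    by move=> x; apply: cvgD; [exact: cf|exact: cg].
  by move=> x; rewrite pf pg.
have e2 : 0 < e / 2 by rewrite divr_gt0.
apply: filterS2 (fu t0 Dt0 _ e2) (gu t0 Dt0 _ e2) => t h1 h2 x.
rewrite opprD addrACA; apply: le_lt_trans (ler_normD _ _) _.
by rewrite [ltRHS]splitr ltrD.
Qed.

Lemma upathM D f g : upath D f -> upath D g -> upath D (fun t x => f t x * g t x).
Proof.
move=> [fc fu] [gc gu]; split => [t Dt|t0 Dt0 e e0].
  have [cf pf] := fc t Dt; have [cg pg] := gc t Dt; split.
    by move=> x; apply: cvgM; [exact: cf|exact: cg].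
  by move=> x; rewrite pf pg.
have [cf pf] := fc t0 Dt0; have [cg pg] := gc t0 Dt0.
have [M M0 fM] := periodic_bounded ab cf pf; have [N N0 gN] := periodic_bounded ab cg pg.
have eN : 0 < e / (2 * (N + 1)) by rewrite divr_gt0// mulr_gt0// addr_gt0.
have eM : 0 < e / (2 * M) by rewrite divr_gt0// mulr_gt0.
apply: filterS3 (fu t0 Dt0 _ eN) (gu t0 Dt0 _ eM) (gu t0 Dt0 _ ltr01) => t h1 h2 h3 x.
have -> : f t x * g t x - f t0 x * g t0 x =
    (f t x - f t0 x) * g t x + f t0 x * (g t x - g t0 x) by ring.
apply: le_lt_trans (ler_normD _ _) _; rewrite !normrM.
have gt : `|g t x| <= N + 1.
  have := ltW (h3 x); have := gN x; rewrite !ler_norml => /andP[? ?] /andP[? ?].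
  by apply/andP; split; lra.
have -> : e = e / (2 * (N + 1)) * (N + 1) + M * (e / (2 * M)).
  by field; rewrite gt_eqF//= gt_eqF// addr_gt0.
apply: ltr_leD.
  apply: (@le_lt_trans _ _ (`|f t x - f t0 x| * (N + 1))); first exact: ler_wpM2l.
  by rewrite ltr_pM2r// addr_gt0.
by apply: ler_pM => //; exact: ltW.
Qed.

Lemma upathZ D f (r : R) : upath D f -> upath D (fun t x => r * f t x).
Proof. by apply: upathM; apply: upath_cst => // x; exact: cvg_cst. Qed.

Lemma upathB D f g : upath D f -> upath D g -> upath D (fun t x => f t x - g t x).
Proof.
move=> uf ug; have := upathD uf (upathZ (-1) ug).
by apply: upath_eq => t _; apply/funext => x; rewrite mulN1r.
Qed.

Lemma upath_Lambda D f : upath D f -> upath D (fun t => Lam (f t)).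
Proof.
move=> [fc fu]; split => [t Dt|t0 Dt0 e e0].
  by have [cf pf] := fc t Dt; have [? ? _] := LambdaP ab cf pf.
have [K K0 HK] := Lambda_bound ab.
have eK : 0 < e / (2 * K) by rewrite divr_gt0// mulr_gt0.
apply: within_filterS (fu t0 Dt0 _ eK) => t Dt h x.
have [cf pf] := fc t Dt; have [cf0 pf0] := fc t0 Dt0.
have cB : continuous (fun x => f t x - f t0 x) by move=> y; apply: cvgB; [exact: cf|exact: cf0].
have -> : Lam (f t) x - Lam (f t0) x = Lam (fun x => f t x - f t0 x) x.
  by rewrite -(LambdaB ab cf pf cf0 pf0).
apply: (@le_lt_trans _ _ (K * (e / (2 * K)))); first by apply: HK => // y; exact/ltW/h.
have -> : K * (e / (2 * K)) = e / 2 by field; rewrite gt_eqF.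
by rewrite ltr_pdivrMr// ltr_pMr// ltr1n.
Qed.

Lemma upath_joint D f : upath D f -> joint_continuous D f.
Proof.
move=> [fc fu]; apply/subspace_continuousP => -[t0 x0] [/= Dt0 _].
apply/cvgrPdist_lt => e e0; have e2 : 0 < e / 2 by rewrite divr_gt0.
have [cf _] := fc t0 Dt0.
have A := fu t0 Dt0 _ e2.
have /cvgrPdist_lt/(_ _ e2) B := cf x0.
exists ([set t | D t -> forall x, `|f t x - f t0 x| < e / 2],
  [set x | `|f t0 x0 - f t0 x| < e / 2]); first by split.
move=> [t x] /= [h1 h2] [/= Dt _]; have := h1 Dt x; move: h2.
by rewrite /from_subspace/= !ltr_norml => /andP[? ?] /andP[? ?]; apply/andP; split; lra.
Qed.

Lemma upath_time D f x : upath D f -> {within D, continuous (fun t => f t x)}.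
Proof. by move=> /upath_joint/joint_continuous_time; exact. Qed.

Lemma upath_bounded D f (s t : R) : upath D f -> `[s, t] `<=` D ->
  exists M, forall r x, r \in `[s, t] -> `|f r x| <= M.
Proof.
move=> uf stD; have [M fM] := joint_continuous_bounded a b (upath_joint uf) stD.
exists M => r x rst; have [y yab ->] := periodic_rep ab x; last exact: (uf.1 r (stD _ rst)).2.
by apply: fM => //; exact: subset_itv_co_cc yab.
Qed.

Lemma C1_pathI D f g : upath D f -> upath D g ->
  (forall t x, D t -> is_derive x (1 : R) (f t) (g t x)) -> C1_path a b D f.
Proof.
move=> uf ug fg; split.
- by move=> t Dt; exact: (uf.1 t Dt).2.
- by move=> t x Dt; have [] := fg t x Dt.
- exact: upath_joint.
apply: (@upath_joint D (fun t => derive1 (f t))); apply: upath_eq ug => t Dt.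
by apply/funext => x; rewrite derive1E; have [_ ->] := fg t x Dt.
Qed.

Lemma sobolev_path_upath D f r : 1 / 2 < r -> sobolev_path a b r D f -> upath D f.
Proof.
move=> r2 [fs fc]; split => [t /fs[]//|t0 Dt0 e e0].
have [dl dl0 H] := sobolev_sup_lt ab r2 e0.
have : \forall t \near within D (nbhs t0),
    (sobolev_normsq a b r (fun x => f t x - f t0 x)%R < dl%:E)%E.
  have dl0E : (0 < dl%:E)%E by rewrite lte_fin.
  exact: (fc t0 Dt0 _ (open_ereal_lt' dl0E)).
apply: within_filterS => t Dt h x; have [cf pf _] := fs t Dt; have [cf0 pf0 _] := fs t0 Dt0.
apply: (H (fun x => f t x - f t0 x)) => //.
  by move=> y; apply: cvgB; [exact: cf|exact: cf0].
by move=> y; rewrite pf pf0.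
Qed.

Lemma sobolev_path_derive D f r : 3 / 2 < r -> sobolev_path a b r D f ->
  (forall t x, D t -> is_derive x (1 : R) (f t) (derive1 (f t) x)) /\
  sobolev_path a b (r - 1) D (fun t => derive1 (f t)).
Proof.
move=> r3 [fs fc]; split => [t x Dt|].
  by have [] := sobolev_derive ab r3 (fs t Dt).
split => [t Dt|t0 Dt0]; first by have [] := sobolev_derive ab r3 (fs t Dt).
(* The derivative estimate applies only to differences of finite norm; convergence provides this for
   times near t0. *)
have fin : \forall t \near within D (nbhs t0),
    (sobolev_normsq a b r (fun x => f t x - f t0 x)%R < 1%:E)%E.
  have h01 : (0 < 1%:E :> \bar R)%E by rewrite lte_fin.
  exact: (fc t0 Dt0 _ (open_ereal_lt' h01)).
apply: (@squeeze_cvge _ _ _ _ (cst 0%E) _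
  (fun t => sobolev_normsq a b r (fun x => f t x - f t0 x)%R)).
- apply: within_filterS fin => t Dt h.
  rewrite sobolev_normsq_ge0/=.
  have [cf pf _] := fs t Dt; have [cf0 pf0 _] := fs t0 Dt0.
  have [d0 _ _] := sobolev_derive ab r3 (fs t0 Dt0).
  have [d _ _] := sobolev_derive ab r3 (fs t Dt).
  have sB : sobolev a b r (fun x => f t x - f t0 x).
    split.
    - by move=> y; apply: cvgB; [exact: cf|exact: cf0].
    - by move=> y; rewrite pf pf0.
    - by apply: lt_trans h _; rewrite ltry.
  have [dB _ le] := sobolev_derive ab r3 sB.
  suff -> : (fun x => derive1 (f t) x - derive1 (f t0) x) = derive1 (fun x => f t x - f t0 x).
    exact: le.
  apply/funext => x; rewrite [RHS]derive1E; symmetry.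
  by have [_ ->] := is_deriveB (d x) (d0 x).
- exact: cvg_cst.
- exact: fc.
Qed.

Lemma upath_integral D f g : (forall t, D t -> 0 <= t /\ `[0, t] `<=` D) ->
  upath D f -> upath D g -> (forall t x, D t -> is_derive x (1 : R) (f t) (g t x)) ->
  (forall t x, D t -> is_derive x (1 : R) (fun x => \int[mu]_(r in `[0, t]) f r x)
     (\int[mu]_(r in `[0, t]) g r x)) /\
  upath D (fun t x => \int[mu]_(r in `[0, t]) f r x).
Proof.
move=> D0 uf ug fg.
have cf t x : D t -> {within `[0, t], continuous (fun r => f r x)}.
  by move=> Dt; exact: (continuous_subspaceW (D0 t Dt).2 (upath_time uf)).
have dI t x : D t -> is_derive x (1 : R) (fun x => \int[mu]_(r in `[0, t]) f r x)
     (\int[mu]_(r in `[0, t]) g r x).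
  move=> Dt; have [t0 tD] := D0 t Dt; have [M gM] := upath_bounded ug tD.
  apply: (@is_derive_under_integral _ (fun x r => f r x) (fun x r => g r x)
    0 t (x - 1) (x + 1) x M).
  - by rewrite in_itv/= gtrBl ltrDl ltr01.
  - by move=> y _; exact: cf.
  - by move=> y r _ rt; apply: fg; exact: tD.
  - by move=> y r _ rt; exact: gM.
split => //; split => [t Dt|t0 Dt0 e e0].
  split => [x|x]; first exact: is_derive_continuous (dI t x Dt).
  apply: eq_Rintegral => r; rewrite inE => rt.
  exact: (uf.1 r ((D0 t Dt).2 _ rt)).2.
have [cf0 pf0] := uf.1 t0 Dt0.
have [M M0 fM] := periodic_bounded ab cf0 pf0.
(* Times beyond t0 matter too and [D] may be half open, so f is bounded near t0 through its uniform
   continuity there. *)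
have /nbhs_ballP[dl /= dl0 hdl] := uf.2 t0 Dt0 1 ltr01.
have eM : 0 < e / (M + 1) by rewrite divr_gt0// addr_gt0.
have bnd r x : `|r - t0| < dl -> D r -> `|f r x| <= M + 1.
  move=> rt Dr; have : `|f r x - f t0 x| < 1 by apply: hdl => //; rewrite /ball/= distrC.
  have := fM x; rewrite ler_norml ltr_norml => /andP[? ?] /andP[? ?].
  by rewrite ler_norml; apply/andP; split; lra.
have key s t x : D t -> D s -> s <= t -> (forall r, r \in `[s, t] -> `|r - t0| < dl) ->
    `|t - s| < e / (M + 1) ->
    `|\int[mu]_(r in `[0, t]) f r x - \int[mu]_(r in `[0, s]) f r x| < e.
  move=> Dt Ds st hr ts; have s0 := (D0 s Ds).1.
  rewrite (Rintegral_itvB_cc s0 st (cf t x Dt)).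
  apply: (@le_lt_trans _ _ ((M + 1) * (t - s))).
    apply: le_norm_Rintegral_itv => //.
      have sub : `[s, t] `<=` `[0, t] by apply: subset_itv; rewrite bnd_simp.
      exact: (continuous_subspaceW sub (cf t x Dt)).
    move=> r rst; apply: bnd; first exact: hr.
    apply: (D0 t Dt).2; move: rst; rewrite /= !in_itv/= => /andP[sr ->].
    by rewrite (le_trans s0 sr).
  rewrite mulrC -ltr_pdivlMr ?addr_gt0//; apply: le_lt_trans ts; exact: ler_norm.
have nr : \forall t \near t0, `|t - t0| < Num.min dl (e / (M + 1)).
  by apply: near_dist_lt; rewrite lt_min dl0.
rewrite /within/=; apply: filterS nr => t; rewrite lt_min => /andP[td te] Dt x.
have [t0t|/ltW tt0] := leP t0 t.
  apply: key => // r; rewrite in_itv/= => /andP[h1 h2].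
  by apply: le_lt_trans td; rewrite !ger0_norm ?subr_ge0// lerD2r.
rewrite distrC; apply: key => // [r|]; last by rewrite distrC.
rewrite in_itv/= => /andP[h1 h2]; apply: le_lt_trans td.
by rewrite !ler0_norm ?subr_le0// lerN2 lerD2r.
Qed.

End uniform_paths.

(** * The Camassa-Holm equation and the system along a single path *)

Definition integrated_system {R : realType} (U phi w v p B I : R -> R -> R) (t x : R) : Prop :=
  let mu := @lebesgue_measure R in [/\
  (2^-1 * phi t x - 2^-1 * p t x - (2^-1 * phi 0 x - 2^-1 * p 0 x)) +
    \int[mu]_(r in `[0, t]) (- derive1 (v r) x) =
    \int[mu]_(r in `[0, t]) (- w r x - (3 / 2) * U r x ^+ 2 - 2^-1 * p r x ^+ 2) +
    (2^-1 * B t x - 2^-1 * B 0 x),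
  (- (2^-1 * U t x) - - (2^-1 * U 0 x)) + \int[mu]_(r in `[0, t]) derive1 (w r) x =
    - (2^-1 * I t x) - - (2^-1 * I 0 x),
  \int[mu]_(r in `[0, t]) - derive1 (phi r) x = \int[mu]_(r in `[0, t]) - U r x,
  \int[mu]_(r in `[0, t]) derive1 (U r) x = \int[mu]_(r in `[0, t]) p r x
  & 2^-1 * U t x - 2^-1 * U 0 x =
    \int[mu]_(r in `[0, t]) (- (U r x * p r x) + v r x) +
    (2^-1 * I t x - 2^-1 * I 0 x)].

Section camassa_holm_paths.
Context {R : realType} (a b : R).
Hypothesis ab : a < b.
Notation mu := (@lebesgue_measure R).
Notation L := (b - a).
Local Notation lam k := (wavenum a b k).
Local Notation fcoef := (fcoef a b).
Local Notation Lam := (Lambda a b).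
Local Notation upath := (upath a b).
Local Notation sgn c := (if c then 1 else -1 : R).
Implicit Types (D : set R).

Lemma derivable_is_derive1 (f : R -> R) x : derivable f x 1 ->
  is_derive x (1 : R) f (derive1 f x).
Proof. by move=> df; apply: DeriveDef => //; rewrite derive1E. Qed.

Lemma is_derive_derive1 (f : R -> R) x l : is_derive x (1 : R) f l -> derive1 f x = l.
Proof. by rewrite derive1E => -[]. Qed.

Lemma Rintegral_lin (f g : R -> R) (c d r s : R) :
  {within `[c, d], continuous f} -> {within `[c, d], continuous g} ->
  \int[mu]_(x in `[c, d]) (r * f x + s * g x) =
  r * \int[mu]_(x in `[c, d]) f x + s * \int[mu]_(x in `[c, d]) g x.
Proof.
move=> cf cg; rewrite RintegralD//; last 2 first.
- apply: (@within_continuous_integrable _ (fun x => r * f x)).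
  by move=> x; apply: cvgM; [exact: cvg_cst|exact: cf].
- apply: (@within_continuous_integrable _ (fun x => s * g x)).
  by move=> x; apply: cvgM; [exact: cvg_cst|exact: cg].
by rewrite !RintegralZl//; exact: within_continuous_integrable.
Qed.

Lemma within_continuous_lin (S : set R) (f g : R -> R) (r s : R) :
  {within S, continuous f} -> {within S, continuous g} ->
  {within S, continuous (fun x => r * f x + s * g x)}.
Proof.
move=> cf cg z; apply: cvgD.
  by apply: cvgM; [exact: cvg_cst|exact: cf].
by apply: cvgM; [exact: cvg_cst|exact: cg].
Qed.

Lemma within_continuous_sqr (S : set R) (f : R -> R) :
  {within S, continuous f} -> {within S, continuous (fun x => f x ^+ 2)}.
Proof. by move=> cf; exact: (@continuous_fun_exp R (subspace S) f 2 cf). Qed.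

(** * Regularity of the nonlinear terms *)

Section regularity.
Variables (D : set R) (s : R) (U : R -> R -> R).
Hypotheses (hs : 5 / 2 < s) (sU : sobolev_path a b s D U).

Let P (t : R) : R -> R := derive1 (U t).
Let Q (t : R) : R -> R := derive1 (P t).
Let H t := CH_H (U t).
Let Hx (t x : R) : R := 2 * (U t x * P t x) + P t x * Q t x.

(** The threshold s > 5/2 is spent here: u_xx lies in H^(s-2) with s - 2 > 1/2, so u, u_x and u_xx
    are continuous paths and H(u) is C^1 in x. *)
Lemma CH_regular :
  [/\ [/\ upath D U, upath D P & upath D Q],
      upath D H, upath D Hx,
      (forall t x, D t -> is_derive x (1 : R) (U t) (P t x)) /\
      (forall t x, D t -> is_derive x (1 : R) (P t) (Q t x)) &
      forall t x, D t -> is_derive x (1 : R) (H t) (Hx t x)].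
Proof.
have s2 : 1 / 2 < s by move: hs; lra.
have s3 : 3 / 2 < s by move: hs; lra.
have s12 : 1 / 2 < s - 1 by move: hs; lra.
have s13 : 3 / 2 < s - 1 by move: hs; lra.
have s112 : 1 / 2 < s - 1 - 1 by move: hs; lra.
have [dU sP] := sobolev_path_derive ab s3 sU.
have [dP sQ] := sobolev_path_derive ab s13 sP.
have uU := sobolev_path_upath ab s2 sU.
have uP := sobolev_path_upath ab s12 sP.
have uQ := sobolev_path_upath ab s112 sQ.
split; [by []| | |by []|].
- have := upathD (upathM ab uU uU) (upathZ ab 2^-1 (upathM ab uP uP)).
  by apply: upath_eq => t _; apply/funext => x; rewrite /H /CH_H !expr2.
- exact (upathD (upathZ ab 2 (upathM ab uU uP)) (upathM ab uP uQ)).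
move=> t x Dt.
have e : H t = (fun x => U t x * U t x + 2^-1 * (P t x * P t x)).
  by apply/funext => y; rewrite /H /CH_H !expr2.
rewrite e; have dUt := dU t x Dt; have dPt := dP t x Dt.
apply: (is_derive_eq (is_deriveD (is_deriveM dUt dUt) (is_deriveZ 2^-1 (is_deriveM dPt dPt)))).
by rewrite /Hx /Q /P /GRing.scale/=; field.
Qed.

Lemma CH_F_E t x : D t -> CH_F a b (U t) x = - (U t x * P t x) - Lam (Hx t) x.
Proof.
move=> Dt; have [_ _ _ _ dH] := CH_regular.
have e : derive1 (CH_H (U t)) = Hx t.
  by apply/funext => y; exact: is_derive_derive1 (dH t y Dt).
by rewrite /CH_F e mulNr.
Qed.

(** The variable w is half a potential of F(u): uu_x is the derivative of u²/2, and Λ commutes with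
    ∂ₓ. *)
Lemma CH_potential_derive t x : D t ->
  is_derive x (1 : R) (fun x => - 4^-1 * U t x ^+ 2 - 2^-1 * Lam (H t) x)
    (2^-1 * CH_F a b (U t) x).
Proof.
move=> Dt; have [_ uH uHx [dU _] dH] := CH_regular; rewrite (CH_F_E x Dt).
have [cH pH] := uH.1 t Dt; have [cHx pHx] := uHx.1 t Dt.
have dL := is_derive_Lambda ab pH cHx pHx (fun x => dH t x Dt) x.
have dUt := dU t x Dt.
have e : (fun x => - 4^-1 * U t x ^+ 2 - 2^-1 * Lam (H t) x) =
    (fun x => - 4^-1 * (U t x * U t x) - 2^-1 * Lam (H t) x).
  by apply/funext => y; rewrite expr2.
rewrite e; apply: (is_derive_eq (is_deriveB (is_deriveZ (- 4^-1) (is_deriveM dUt dUt))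
  (is_deriveZ 2^-1 dL))).
by rewrite /GRing.scale/=; field.
Qed.

Lemma CH_F_derive t x : D t -> is_derive x (1 : R) (CH_F a b (U t))
  (- (P t x ^+ 2 + U t x * Q t x) - (Lam (H t) x - H t x)).
Proof.
move=> Dt; have [_ uH uHx [dU dP] dH] := CH_regular.
have [cH pH] := uH.1 t Dt; have [cHx pHx] := uHx.1 t Dt.
have dL := is_derive_Lambda_derive ab pH cHx pHx (fun x => dH t x Dt) x.
have dUt := dU t x Dt; have dPt := dP t x Dt.
have e : CH_F a b (U t) = (fun x => - (U t x * P t x) - Lam (Hx t) x).
  by apply/funext => y; exact: CH_F_E.
rewrite e; apply: (is_derive_eq (is_deriveB (is_deriveN (is_deriveM dUt dPt)) dL)).
by rewrite /GRing.scale/=; ring.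
Qed.

Lemma upath_CH_F : upath D (fun t => CH_F a b (U t)).
Proof.
have [[uU uP uQ] uH uHx _ _] := CH_regular.
apply: (@upath_eq _ _ _ _ _ (fun t x => (-1) * (U t x * P t x) - Lam (Hx t) x)).
  by move=> t Dt; apply/funext => x; rewrite (CH_F_E x Dt) mulN1r.
exact (upathB ab (upathZ ab (-1) (upathM ab uU uP)) (upath_Lambda ab uHx)).
Qed.

Lemma upath_CH_F_derive : upath D (fun t x =>
  - (P t x ^+ 2 + U t x * Q t x) - (Lam (H t) x - H t x)).
Proof.
have [[uU uP uQ] uH uHx _ _] := CH_regular.
apply: (@upath_eq _ _ _ _ _ (fun t x =>
    (-1) * (P t x * P t x + U t x * Q t x) - (Lam (H t) x - H t x))).
  by move=> t Dt; apply/funext => x; rewrite mulN1r expr2.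
exact (upathB ab (upathZ ab (-1) (upathD (upathM ab uP uP) (upathM ab uU uQ)))
  (upathB ab (upath_Lambda ab uH) uH)).
Qed.

Lemma upath_CH_potential :
  upath D (fun t x => - 4^-1 * U t x ^+ 2 - 2^-1 * Lam (H t) x).
Proof.
have [[uU uP uQ] uH uHx _ _] := CH_regular.
apply: (@upath_eq _ _ _ _ _ (fun t x => - 4^-1 * (U t x * U t x) - 2^-1 * Lam (H t) x)).
  by move=> t Dt; apply/funext => x; rewrite expr2.
exact (upathB ab (upathZ ab _ (upathM ab uU uU)) (upathZ ab _ (upath_Lambda ab uH))).
Qed.

End regularity.

Section equations.
Variables (D : set R) (s : R) (U phi w v p I B : R -> R -> R).
Hypotheses (hs : 5 / 2 < s) (D0 : forall t, D t -> 0 <= t /\ `[0, t] `<=` D).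

Let A_ (t x : R) : R := derive1 (v t) x - w t x - (3 / 2) * U t x ^+ 2 - 2^-1 * p t x ^+ 2.

(** * From the equation to the system *)

Section forward.
Variables (J : R -> R -> R) (u0 phi0 : R -> R).
Hypotheses (sU : sobolev_path a b s D U) (U0 : U 0 = u0) (phi00 : phi 0 = phi0).
Hypothesis pphi0 : periodic phi0 L.
Hypothesis dphi0 : forall x, is_derive x (1 : R) phi0 (u0 x).
Hypotheses (uJ : upath D J) (dJ : forall t x, 0 <= t -> is_derive x (1 : R) (J t) (I t x)).
Hypothesis dI : forall t x, 0 <= t -> is_derive x (1 : R) (I t) (J t x - B t x).
Hypothesis equ : forall t x, D t -> U t x - U 0 x =
  \int[mu]_(r in `[0, t]) CH_F a b (U r) x + (I t x - I 0 x).
Hypothesis eqphi : forall t x, D t -> phi t x - phi 0 x =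
  \int[mu]_(r in `[0, t]) (2 * w r x) + (J t x - J 0 x).
Hypothesis aux : forall t, D t -> [/\ p t = derive1 (U t),
  w t = (fun x => - 4^-1 * U t x ^+ 2 - 2^-1 * Lam (CH_H (U t)) x)
  & v t = (fun x => U t x * p t x + 2^-1 * CH_F a b (U t) x)].

Let P (t : R) : R -> R := derive1 (U t).
Let Q (t : R) : R -> R := derive1 (P t).
Let F' (t x : R) : R := - (P t x ^+ 2 + U t x * Q t x) - (Lam (CH_H (U t)) x - CH_H (U t) x).
Let Vx (t x : R) : R := P t x ^+ 2 + U t x * Q t x + 2^-1 * F' t x.

Let uw : upath D w.
Proof.
by apply: upath_eq (upath_CH_potential hs sU) => t Dt; have [_ -> _] := aux Dt.
Qed.

Let dw t x : D t -> is_derive x (1 : R) (w t) (2^-1 * CH_F a b (U t) x).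
Proof. by move=> Dt; have [_ -> _] := aux Dt; exact: (CH_potential_derive hs sU). Qed.

Let dv t x : D t -> is_derive x (1 : R) (v t) (Vx t x).
Proof.
move=> Dt; have [-> _ ->] := aux Dt.
have [_ _ _ [dU dP] _] := CH_regular hs sU.
apply: (is_derive_eq (is_deriveD (is_deriveM (dU t x Dt) (dP t x Dt))
  (is_deriveZ 2^-1 (CH_F_derive hs sU x Dt)))).
by rewrite /Vx /F' /Q /P /GRing.scale/=; ring.
Qed.

Let uVx : upath D Vx.
Proof.
have [[uU uP uQ] _ _ _ _] := CH_regular hs sU.
apply: (@upath_eq _ _ _ _ _ (fun t x => P t x * P t x + U t x * Q t x + 2^-1 * F' t x)).
  by move=> t Dt; apply/funext => x; rewrite /Vx expr2.
exact (upathD (upathD (upathM ab uP uP) (upathM ab uU uQ))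
  (upathZ ab _ (upath_CH_F_derive hs sU))).
Qed.

Let u2w : upath D (fun t x => 2 * w t x).
Proof. exact (upathZ ab 2 uw). Qed.

Let d2w t x : D t -> is_derive x (1 : R) (fun x => 2 * w t x) (CH_F a b (U t) x).
Proof.
move=> Dt; apply: (is_derive_eq (is_deriveZ 2 (dw x Dt))).
by rewrite /GRing.scale/= mulrA mulfV ?mul1r.
Qed.

Let phiE t : D t -> phi t =
  (fun x => phi0 x + \int[mu]_(r in `[0, t]) (2 * w r x) + (J t x - J 0 x)).
Proof. by move=> Dt; apply/funext => x; rewrite -addrA -eqphi// phi00 addrC subrK. Qed.

Let dphi t x : D t -> is_derive x (1 : R) (phi t) (U t x).
Proof.
move=> Dt; have [t0 _] := D0 Dt.
have [dint _] := upath_integral ab D0 u2w (upath_CH_F hs sU) d2w.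
rewrite phiE//.
apply: (is_derive_eq (is_deriveD (is_deriveD (dphi0 x) (dint t x Dt))
  (is_deriveB (dJ x t0) (dJ x (lexx 0))))).
by rewrite -addrA -equ// U0 addrC subrK.
Qed.

Let upphi : upath D phi.
Proof.
have [_ uint] := upath_integral ab D0 u2w (upath_CH_F hs sU) d2w.
have uJ0 : upath D (fun=> J 0).
  split => [t Dt|t Dt e e0]; last by apply: nearW => r x; rewrite subrr normr0.
  by apply: uJ.1; have [h1 h2] := D0 Dt; apply: h2; rewrite /= in_itv/= lexx.
have uphi0 : upath D (fun=> phi0).
  by apply: upath_cst => // x; exact: is_derive_continuous (dphi0 x).
apply: upath_eq (upathD (upathD uphi0 uint) (upathB ab uJ uJ0)) => t Dt.
exact: phiE.
Qed.

(** The x-derivatives of φ, w, v and p are u, F(u)/2, (up)_x + F(u)_x/2 and u_xx, each of them a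
    continuous path. *)
Lemma CH_forward_class : [/\ C1_path a b D phi, C1_path a b D w, C1_path a b D v &
  C1_path a b D p].
Proof.
have [[uU uP uQ] _ _ [dU dP] _] := CH_regular hs sU.
split.
- exact: C1_pathI upphi uU dphi.
- exact: C1_pathI uw (upathZ ab _ (upath_CH_F hs sU)) dw.
- apply: (C1_pathI _ uVx dv).
  have := upathD (upathM ab uU uP) (upathZ ab 2^-1 (upath_CH_F hs sU)).
  by apply: upath_eq => t Dt; have [-> _ ->] := aux Dt.
- apply: (C1_pathI _ uQ) => [|t x Dt].
    by apply: upath_eq uP => t Dt; have [->] := aux Dt.
  by have [-> _ _] := aux Dt; exact: dP.
Qed.

Lemma CH_forward t x : D t -> integrated_system U phi w v p B I t x.
Proof.
move=> Dt; have [t0 tD] := D0 Dt.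
have D_0 : D 0 by apply: tD; rewrite /= in_itv/= lexx.
have [[uU uP uQ] _ _ [dU dP] _] := CH_regular hs sU.
have rD r : r \in `[0, t]%classic -> D r by rewrite inE => /tD.
have wc f : upath D f -> {within `[0, t], continuous (fun r => f r x)}.
  by move=> uf; exact: (continuous_subspaceW tD (upath_time uf)).
have intF (c : R) : \int[mu]_(r in `[0, t]) (c * CH_F a b (U r) x) =
    c * \int[mu]_(r in `[0, t]) CH_F a b (U r) x.
  by rewrite RintegralZl//; apply: within_continuous_integrable; exact: wc (upath_CH_F hs sU).
split.
- have peq : P t x - P 0 x = \int[mu]_(r in `[0, t]) F' r x +
      ((J t x - B t x) - (J 0 x - B 0 x)).
    have [dint _] := upath_integral ab D0 (upath_CH_F hs sU) (upath_CH_F_derive hs sU)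
      (fun t x Dt => CH_F_derive hs sU x Dt).
    have d1 := is_deriveB (dU t x Dt) (dU 0 x D_0).
    have d2 := is_deriveD (dint t x Dt) (is_deriveB (dI x t0) (dI x (lexx 0))).
    have e : (fun x => U t x - U 0 x) = (fun x =>
        \int[mu]_(r in `[0, t]) CH_F a b (U r) x + (I t x - I 0 x)).
      by apply/funext => y; exact: equ.
    have [_ <-] := d1; have [_ <-] := d2; congr ('D_1 _ x); exact: e.
  have -> : p t = P t by have [] := aux Dt.
  have -> : p 0 = P 0 by have [] := aux D_0.
  have -> : \int[mu]_(r in `[0, t]) (- derive1 (v r) x) =
      -1 * \int[mu]_(r in `[0, t]) Vx r x + 0 * \int[mu]_(r in `[0, t]) Vx r x.
    rewrite -Rintegral_lin; [|exact: wc uVx|exact: wc uVx].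
    apply: eq_Rintegral => r /rD Dr.
    by rewrite mul0r addr0 mulN1r; congr (- _); apply: is_derive_derive1; exact: dv.
  (* Pointwise, -w - (3/2)u² - (1/2)p² = w - (1/2)F' - v_x: on the right the terms u u_xx cancel,
     and ΛH = -2w - u²/2 by definition of w. *)
  have -> : \int[mu]_(r in `[0, t])
        (- w r x - (3 / 2) * U r x ^+ 2 - 2^-1 * p r x ^+ 2) =
      1 * \int[mu]_(r in `[0, t]) (2^-1 * (2 * w r x) + (- 2^-1) * F' r x) +
      -1 * \int[mu]_(r in `[0, t]) Vx r x.
    rewrite -Rintegral_lin; last 2 first.
    - exact (@within_continuous_lin _ _ _ _ _ (wc _ u2w) (wc _ (upath_CH_F_derive hs sU))).
    - exact: wc uVx.
    apply: eq_Rintegral => r /rD Dr; have [-> -> _] := aux Dr.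
    by rewrite /Vx /F' /CH_H -/(P r); field.
  rewrite Rintegral_lin; [|exact: (wc _ u2w)|exact: (wc _ (upath_CH_F_derive hs sU))].
  by have := eqphi x Dt; move: peq; lra.
- have -> : \int[mu]_(r in `[0, t]) derive1 (w r) x =
      2^-1 * \int[mu]_(r in `[0, t]) CH_F a b (U r) x.
    rewrite -intF; apply: eq_Rintegral => r /rD Dr.
    by apply: is_derive_derive1; exact: dw.
  by have := equ x Dt; lra.
- apply: eq_Rintegral => r /rD Dr; congr (- _).
  by apply: is_derive_derive1; exact: dphi.
- by apply: eq_Rintegral => r /rD Dr; have [->] := aux Dr.
- have -> : \int[mu]_(r in `[0, t]) (- (U r x * p r x) + v r x) =
      2^-1 * \int[mu]_(r in `[0, t]) CH_F a b (U r) x.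
    rewrite -intF; apply: eq_Rintegral => r /rD Dr.
    by have [_ _ ->] := aux Dr; rewrite addKr.
  by have := equ x Dt; lra.
Qed.

End forward.

(** * From the system to the equation *)

Section backward.
Hypothesis sU : sobolev_path a b s D U.
Hypotheses (Cphi : C1_path a b D phi) (Cw : C1_path a b D w).
Hypotheses (Cv : C1_path a b D v) (Cp : C1_path a b D p).
Hypotheses (cI : forall t, 0 <= t -> continuous (I t)).
Hypotheses (cB : forall t, 0 <= t -> continuous (B t)).
Hypothesis noise : forall c (k : nat) t, 0 <= t ->
  sgn c * lam k * fcoef (~~ c) (B t) k = (1 + lam k ^+ 2) * fcoef c (I t) k.
Hypothesis Dnext : forall t, D t -> exists2 T, D T & t < T.
Hypothesis system : forall t x, D t -> integrated_system U phi w v p B I t x.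

Let P (t : R) : R -> R := derive1 (U t).
Let Q (t : R) : R -> R := derive1 (P t).

Let C1_space f t : C1_path a b D f -> D t -> [/\ continuous (f t), periodic (f t) L,
  continuous (derive1 (f t)) & forall x, is_derive x (1 : R) (f t) (derive1 (f t) x)].
Proof.
move=> [pf df cf cf'] Dt; split.
- exact: joint_continuous_space cf Dt.
- exact: pf.
- exact: (@joint_continuous_space _ D (fun t => derive1 (f t)) t cf' Dt).
- by move=> x; apply: derivable_is_derive1; exact: df.
Qed.

Let C1_time f x : C1_path a b D f -> {within D, continuous (fun t => f t x)} /\
  {within D, continuous (fun t => derive1 (f t) x)}.
Proof.
move=> [pf df cf cf']; split; first exact: joint_continuous_time cf.
exact: (@joint_continuous_time _ D (fun t => derive1 (f t)) x cf').
Qed.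

Let uU : upath D U. Proof. by have [[]] := CH_regular hs sU. Qed.
Let uP : upath D P. Proof. by have [[]] := CH_regular hs sU. Qed.

Section slab.
Variable T : R.
Hypotheses (DT : D T).

Let TD : `[0, T] `<=` D. Proof. exact: (D0 DT).2. Qed.

Let itvD t : t \in `]0, T[ -> [/\ 0 < t, D t & t < T].
Proof.
rewrite in_itv/= => /andP[t0 tT]; split => //.
by apply: TD; rewrite /= in_itv/= !ltW.
Qed.

(** The constraints are given in integrated form on [0, T]. Differentiating them yields pointwise
    identities on the open interval, which excludes time 0. *)
Let from_integrals f g : {within D, continuous f} -> {within D, continuous g} ->
  (forall t, D t -> \int[mu]_(r in `[0, t]) f r = \int[mu]_(r in `[0, t]) g r) ->
  {in `]0, T[, f =1 g}.
Proof.
move=> cf cg fg; apply: eq_within_continuous_integral.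
- exact: continuous_subspaceW TD cf.
- exact: continuous_subspaceW TD cg.
- by move=> t /itvD[_ Dt _]; exact: fg.
Qed.

Let pE t x : t \in `]0, T[ -> p t x = P t x.
Proof.
apply: (@from_integrals (fun t => p t x) (fun t => P t x)).
- exact: (C1_time x Cp).1.
- exact: upath_time uP.
- by move=> r Dr; have [_ _ _ ->] := system x Dr.
Qed.

Let phi_x t x : t \in `]0, T[ -> derive1 (phi t) x = U t x.
Proof.
move=> tT; apply: oppr_inj; move: t tT.
apply: (@from_integrals (fun t => - derive1 (phi t) x) (fun t => - U t x)).
- by move=> z; apply: cvgN; exact: (C1_time x Cphi).2.
- by move=> z; apply: cvgN; exact: (upath_time uU).
- by move=> r Dr; have [] := system x Dr.
Qed.

Let w_x t x : t \in `]0, T[ -> derive1 (w t) x = - (U t x * p t x) + v t x.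
Proof.
apply: (@from_integrals (fun t => derive1 (w t) x) (fun t => - (U t x * p t x) + v t x)).
- exact: (C1_time x Cw).2.
- move=> z; apply: cvgD; last exact: (C1_time x Cv).1.
  by apply: cvgN; apply: cvgM; [exact: (upath_time uU)|exact: (C1_time x Cp).1].
- by move=> r Dr; have [_ + _ _] := system x Dr; lra.
Qed.

(* The noise-free parts of phi/2 - p/2 and of u/2: the first two equations give their time
   derivatives, while the constraints phi_x = u and u_x = p tie them together. *)
Let Z (t x : R) : R := 2^-1 * phi t x - 2^-1 * p t x - 2^-1 * B t x.
Let Y (t x : R) : R := 2^-1 * U t x - 2^-1 * I t x.

Let cA x : {within D, continuous (fun t => A_ t x)}.
Proof.
move=> z; apply: cvgB; first apply: cvgB; first apply: cvgB.
- exact: (C1_time x Cv).2.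
- exact: (C1_time x Cw).1.
- apply: cvgM; [exact: cvg_cst|exact: (within_continuous_sqr (upath_time uU))].
- apply: cvgM; [exact: cvg_cst|exact: (within_continuous_sqr (C1_time x Cp).1)].
Qed.

Let ZE t x : D t -> Z t x = Z 0 x + \int[mu]_(r in `[0, t]) A_ r x.
Proof.
move=> Dt; have tD := (D0 Dt).2.
have wc (f : R -> R) : {within D, continuous f} -> {within `[0, t], continuous f}.
  by move=> cf; exact: (continuous_subspaceW tD cf).
have e : \int[mu]_(r in `[0, t]) A_ r x =
    1 * \int[mu]_(r in `[0, t]) (- w r x - (3 / 2) * U r x ^+ 2 - 2^-1 * p r x ^+ 2) +
    -1 * \int[mu]_(r in `[0, t]) (- derive1 (v r) x).
  rewrite -Rintegral_lin; first by apply: eq_Rintegral => r _; rewrite /A_; ring.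
  - apply: wc => z; apply: cvgB; first apply: cvgB.
    + by apply: cvgN; exact: (C1_time x Cw).1.
    + by apply: cvgM; [exact: cvg_cst|exact: (within_continuous_sqr (upath_time uU))].
    + by apply: cvgM; [exact: cvg_cst|exact: (within_continuous_sqr (C1_time x Cp).1)].
  - by apply: wc => z; apply: cvgN; exact: (C1_time x Cv).2.
by rewrite e; have [+ _ _ _ _] := system x Dt; rewrite /Z; lra.
Qed.

Let YE t x : D t -> Y t x = Y 0 x + \int[mu]_(r in `[0, t]) derive1 (w r) x.
Proof. by move=> Dt; have [_ + _ _ _] := system x Dt; rewrite /Y; lra. Qed.

(** For fixed x, f is an antiderivative of g in time, and the bound on the slab lets the time
    derivative pass under the integral in x. In this way the time derivative of a coefficient is
    available from a merely continuous g. *)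
Let is_derive_fcoef_time (f g : R -> R -> R) M c (k : nat) t : t \in `]0, T[ ->
  (forall r, D r -> continuous (f r)) ->
  (forall r x, D r -> f r x = f 0 x + \int[mu]_(q in `[0, r]) g q x) ->
  (forall x, {within D, continuous (fun r => g r x)}) ->
  (forall r x, r \in `[0, T] -> x \in `[a, b] -> `|g r x| <= M) ->
  is_derive t (1 : R) (fun t => fcoef c (f t) k) (fcoef c (g t) k).
Proof.
move=> tT cf fE cg gM.
have e h : fcoef c h k = (b - a)^-1 * \int[mu]_(x in `[a, b]) (h x * mode a b c k x).
  exact: fcoefE.
under eq_fun do rewrite e.
rewrite e; apply: is_deriveZ.
apply: (@is_derive_under_integral _ (fun r x => f r x * mode a b c k x)
  (fun r x => g r x * mode a b c k x) a b 0 T t M) => // [r rT|r x rT xab|r x rT xab].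
- have [_ Dr _] := itvD rT.
  by apply: continuous_within; apply: continuousM_mode; exact: cf.
- have [r0 Dr rT'] := itvD rT.
  have d1 : is_derive r (1 : R) (fun r => f r x) (g r x).
    have d2 := @is_derive_Rintegral _ (fun r => g r x) 0 T r (continuous_subspaceW TD (cg x)) rT.
    have d3 : is_derive r (1 : R) (fun r => f 0 x + \int[mu]_(q in `[0, r]) g q x) (g r x).
      by apply: (is_derive_eq (is_deriveD (is_derive_cst (f 0 x) r 1) d2)); rewrite add0r.
    apply: near_eq_is_derive d3.
    by apply: filterS (near_in_itvoo rT) => q /itvD[_ Dq _]; symmetry; exact: fE.
  apply: (is_derive_eq (is_deriveM d1 (is_derive_cst (mode a b c k x) r 1))).
  by rewrite scaler0 add0r /GRing.scale/= mulrC.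
- rewrite normrM; apply: (@le_trans _ _ `|g r x|); first by rewrite ler_piMr// mode_le1.
  by apply: gM => //; exact: subset_itv_oo_cc.
Qed.

Let bounded_slab f : joint_continuous D f ->
  exists M, forall r x, r \in `[0, T] -> x \in `[a, b] -> `|f r x| <= M.
Proof. by move=> cf; exact: (joint_continuous_bounded a b cf TD). Qed.

Let A_bounded : exists M, forall r x, r \in `[0, T] -> x \in `[a, b] -> `|A_ r x| <= M.
Proof.
have [M1 h1] : exists M, forall r x, r \in `[0, T] -> x \in `[a, b] -> `|derive1 (v r) x| <= M.
  by case: Cv => _ _ _ cv'; exact: (@bounded_slab (fun t => derive1 (v t)) cv').
have [M2 h2] : exists M, forall r x, r \in `[0, T] -> x \in `[a, b] -> `|w r x| <= M.
  by case: Cw => _ _ cw _; exact: bounded_slab.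
have [M3 h3] := bounded_slab (upath_joint uU).
have [M4 h4] : exists M, forall r x, r \in `[0, T] -> x \in `[a, b] -> `|p r x| <= M.
  by case: Cp => _ _ cp _; exact: bounded_slab.
exists (M1 + M2 + (3 / 2) * M3 ^+ 2 + 2^-1 * M4 ^+ 2) => r x rT xab.
rewrite /A_; do ![apply: le_trans (ler_normB _ _) _; apply: lerD]; do ?by [exact: h1|exact: h2].
- rewrite normrM ger0_norm// normrX ler_pM2l//.
  by apply: lerXn2r; rewrite ?nnegrE ?(le_trans _ (h3 r x rT xab))//; exact: h3.
- rewrite normrM ger0_norm// normrX ler_pM2l//.
  by apply: lerXn2r; rewrite ?nnegrE ?(le_trans _ (h4 r x rT xab))//; exact: h4.
Qed.

(** In Fourier space this is Z_x = (1 - ∂ₓ²)Y: the deterministic parts match because φ_x = u and p =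
    u_x, the noise because B_x = (1 - ∂ₓ²)I in the sense of [noise]. *)
Let ZY c (k : nat) t : t \in `]0, T[ ->
  sgn c * lam k * fcoef (~~ c) (Z t) k = (1 + lam k ^+ 2) * fcoef c (Y t) k.
Proof.
move=> tT; have [t0 Dt _] := itvD tT.
have [cphi pphi _ dphi] := C1_space Cphi Dt; have [cp _ _ _] := C1_space Cp Dt.
have [cU pU] := uU.1 t Dt; have [cP _] := uP.1 t Dt.
have [_ _ _ [dU _] _] := CH_regular hs sU.
have cBt := cB (ltW t0); have cIt := cI (ltW t0).
have cZl r (f : R -> R) : continuous f -> continuous (fun x => r * f x).
  by move=> cf x; apply: cvgM; [exact: cvg_cst|exact: cf].
have fp d : fcoef d (p t) k = sgn d * lam k * fcoef (~~ d) (U t) k.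
  have -> : p t = P t by apply/funext => x; exact: pE.
  exact (fcoef_is_derive ab d k pU cP (fun x => dU t x Dt)).
have fphi d : fcoef d (U t) k = sgn d * lam k * fcoef (~~ d) (phi t) k.
  apply: (fcoef_is_derive ab d k pphi cU) => x.
  by rewrite -(phi_x x tT); exact: dphi.
have e1 d : fcoef d (Z t) k =
    2^-1 * fcoef d (phi t) k - 2^-1 * fcoef d (p t) k - 2^-1 * fcoef d (B t) k.
  rewrite -!fcoefZ// -fcoefB; [|exact: cZl|exact: cZl].
  rewrite -fcoefB//; last exact: cZl.
  by move=> x; apply: cvgB; [exact: cZl|exact: cZl].
have e2 d : fcoef d (Y t) k = 2^-1 * fcoef d (U t) k - 2^-1 * fcoef d (I t) k.
  by rewrite -!fcoefZ// -fcoefB; [|exact: cZl|exact: cZl].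
have := noise c k (ltW t0); rewrite e1 e2 fp negbK.
have := fphi c.
case: c => /= h1 h2.
  have -> : 1 * lam k * (2^-1 * fcoef false (phi t) k - 2^-1 * (-1 * lam k * fcoef true (U t) k)
    - 2^-1 * fcoef false (B t) k) = 2^-1 * (1 * lam k * fcoef false (phi t) k) +
    2^-1 * lam k ^+ 2 * fcoef true (U t) k - 2^-1 * (1 * lam k * fcoef false (B t) k) by ring.
  by rewrite h2 -h1; ring.
have -> : -1 * lam k * (2^-1 * fcoef true (phi t) k - 2^-1 * (1 * lam k * fcoef false (U t) k)
    - 2^-1 * fcoef true (B t) k) = 2^-1 * (-1 * lam k * fcoef true (phi t) k) +
    2^-1 * lam k ^+ 2 * fcoef false (U t) k - 2^-1 * (-1 * lam k * fcoef true (B t) k) by ring.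
by rewrite h2 -h1; ring.
Qed.

(** The time derivative of [ZY], a weak form of A_x = (1 - ∂ₓ²)w_x; it requires no differentiability
    of [A_] in x. *)
Let Aw c (k : nat) t : t \in `]0, T[ ->
  sgn c * lam k * fcoef (~~ c) (A_ t) k = (1 + lam k ^+ 2) * fcoef c (derive1 (w t)) k.
Proof.
move=> tT; have [M AM] := A_bounded.
have [N wN] : exists M, forall r x, r \in `[0, T] -> x \in `[a, b] -> `|derive1 (w r) x| <= M.
  by case: Cw => _ _ _ cw'; exact: (@bounded_slab (fun t => derive1 (w t)) cw').
have cZl r (f : R -> R) : continuous f -> continuous (fun x => r * f x).
  by move=> cf x; apply: cvgM; [exact: cvg_cst|exact: cf].
have cZ r : D r -> continuous (Z r).
  move=> Dr; have [r0 _] := D0 Dr.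
  have [cphi _ _ _] := C1_space Cphi Dr; have [cp _ _ _] := C1_space Cp Dr.
  by move=> x; apply: cvgB; [apply: cvgB|]; apply: cZl => //; exact: cB.
have cY r : D r -> continuous (Y r).
  move=> Dr; have [r0 _] := D0 Dr; have [cU _] := uU.1 r Dr.
  by move=> x; apply: cvgB; apply: cZl => //; exact: cI.
have dZ := is_derive_fcoef_time (~~ c) k tT cZ ZE cA AM.
have dY := is_derive_fcoef_time c k tT cY YE (fun x => (C1_time x Cw).2) wN.
have d1 := is_deriveZ (sgn c * lam k) dZ.
have d2 := is_deriveZ (1 + lam k ^+ 2) dY.
have d3 : is_derive t (1 : R) (fun t => (1 + lam k ^+ 2) * fcoef c (Y t) k)
    (sgn c * lam k * fcoef (~~ c) (A_ t) k).
  by apply: near_eq_is_derive d1; apply: filterS (near_in_itvoo tT) => r rT; exact: ZY.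
by have [_ <-] := d3; have [_ ->] := d2.
Qed.

(** Formally, v = up + w_x turns A_x = (1 - ∂ₓ²)w_x into 2(1 - ∂ₓ²)w_x = -(1 - ∂ₓ²)(up) - (2up + u_x
    u_xx). The last bracket is H(u)_x, so applying Λ gives 2w_x = F(u). The computation takes place
    on coefficients because w_xxx need not exist. *)
Lemma CH_backward_pointwise t x : t \in `]0, T[ ->
  - (U t x * p t x) + v t x = 2^-1 * CH_F a b (U t) x.
Proof.
move=> tT; have [t0 Dt _] := itvD tT; rewrite -w_x//.
have [[_ _ uQ] uH uHx [dU dP] dH] := CH_regular hs sU.
have [cU pU] := uU.1 t Dt; have [cP pP] := uP.1 t Dt; have [cQ pQ] := uQ.1 t Dt.
pose UP x := U t x * P t x; pose PQ x := P t x * Q t x.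
pose Hx x := 2 * UP x + PQ x.
have cUP : continuous UP by move=> y; apply: cvgM; [exact: cU|exact: cP].
have cPQ : continuous PQ by move=> y; apply: cvgM; [exact: cP|exact: cQ].
have [cHx pHx] := uHx.1 t Dt.
have [cL pL fL] : [/\ continuous (Lam Hx), periodic (Lam Hx) L & forall c (k : nat),
    fcoef c (Lam Hx) k = (1 + lam k ^+ 2)^-1 * fcoef c Hx k] := LambdaP ab cHx pHx.
have [cw pw cwx dw] := C1_space Cw Dt; have [cv pv cvx dv] := C1_space Cv Dt.
have pwx : periodic (derive1 (w t)) L.
  move=> y; rewrite !w_x//; have [_ pp _ _] := C1_space Cp Dt.
  by rewrite pU pp pv.
suff -> : derive1 (w t) = (fun x => (- 2^-1) * UP x + (- 2^-1) * Lam Hx x).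
  by rewrite (CH_F_E hs sU x Dt) -/(P t) -/(Q t) /UP; ring.
have cR : continuous (fun x => (- 2^-1) * UP x + (- 2^-1) * Lam Hx x).
  by move=> y; apply: cvgD; apply: cvgM; [exact: cvg_cst|exact: cUP|exact: cvg_cst|exact: cL].
have pR : periodic (fun x => (- 2^-1) * UP x + (- 2^-1) * Lam Hx x) L.
  by move=> y; rewrite pL /UP pU pP.
apply: (fcoef_inj ab cwx cR pwx pR) => c k.
rewrite fcoef_lin//.
have c2UP : continuous (fun x => 2 * UP x).
  by move=> y; apply: cvgM; [exact: cvg_cst|exact: cUP].
have fHx : fcoef c Hx k = 2 * fcoef c UP k + fcoef c PQ k by rewrite /Hx fcoefD// fcoefZ.
rewrite fL fHx.
have vE : v t = (fun x => UP x + derive1 (w t) x).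
  by apply/funext => y; rewrite w_x// pE// addrA subrr add0r.
have fv : fcoef c (v t) k = fcoef c UP k + fcoef c (derive1 (w t)) k by rewrite vE fcoefD.
have fvx := fcoef_is_derive ab (~~ c) k pv cvx dv; rewrite negbK in fvx.
have fw := fcoef_is_derive ab c k pw cwx dw.
pose UU (x : R) : R := U t x * U t x; pose PP (x : R) : R := P t x * P t x.
have dUU y : is_derive y (1 : R) UU (2 * UP y).
  apply: (is_derive_eq (is_deriveM (dU t y Dt) (dU t y Dt))).
  by rewrite /UP /P /GRing.scale/=; ring.
have dPP y : is_derive y (1 : R) PP (2 * PQ y).
  apply: (is_derive_eq (is_deriveM (dP t y Dt) (dP t y Dt))).
  by rewrite /PQ /Q /P /GRing.scale/=; ring.
have c2 (f : R -> R) : continuous f -> continuous (fun x => 2 * f x).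
  by move=> cf y; apply: cvgM; [exact: cvg_cst|exact: cf].
have pUU : periodic UU L by move=> y; rewrite /UU pU.
have pPP : periodic PP L by move=> y; rewrite /PP pP.
have fUU := fcoef_is_derive ab c k pUU (c2 _ cUP) dUU.
have fPP := fcoef_is_derive ab c k pPP (c2 _ cPQ) dPP.
rewrite fcoefZ// in fUU; rewrite fcoefZ// in fPP.
have cUU : continuous UU by move=> y; apply: cvgM; exact: cU.
have cPP : continuous PP by move=> y; apply: cvgM; exact: cP.
have fA : fcoef (~~ c) (A_ t) k = fcoef (~~ c) (derive1 (v t)) k - fcoef (~~ c) (w t) k
    + ((- (3 / 2)) * fcoef (~~ c) UU k +
       (- 2^-1) * fcoef (~~ c) PP k).
  rewrite -fcoefB// -fcoef_lin// -fcoefD.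
  - congr fcoef; apply/funext => y; rewrite /A_ pE// /UU /PP; ring.
  - by move=> y; apply: cvgB; [exact: cvx|exact: cw].
  - by move=> y; apply: cvgD; apply: cvgM; [exact: cvg_cst|exact: cUU|exact: cvg_cst|exact: cPP].
have := Aw c k tT; rewrite fA fvx fv => h.
have w0 := weight_base_gt0 a b k.
have hs2 : sgn c * (sgn (~~ c)) = -1 by case: (c); rewrite /= ?mulr1 ?mul1r.
have h2 : (1 + lam k ^+ 2) * fcoef c (derive1 (w t)) k =
    sgn c * sgn (~~ c) * lam k ^+ 2 * (fcoef c UP k + fcoef c (derive1 (w t)) k)
    - (sgn c * lam k * fcoef (~~ c) (w t) k)
    - 3 / 2 * (sgn c * lam k * fcoef (~~ c) UU k)
    - 2^-1 * (sgn c * lam k * fcoef (~~ c) PP k).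
  by move: h; case: (c) => /= <-; ring.
rewrite -fw -fUU -fPP hs2 in h2.
(* The factor 2 arises because w_xxx enters twice, through v_xx and through (1 - ∂ₓ²)w_x. *)
have n0 : 2 * (1 + lam k ^+ 2) != 0 by rewrite gt_eqF// mulr_gt0.
apply: (mulfI n0).
have -> : 2 * (1 + lam k ^+ 2) * fcoef c (derive1 (w t)) k =
    (1 + lam k ^+ 2) * fcoef c (derive1 (w t)) k +
    (lam k ^+ 2 * fcoef c (derive1 (w t)) k + fcoef c (derive1 (w t)) k) by ring.
rewrite h2; move: w0.
move: (lam k) (fcoef c (derive1 (w t)) k) (fcoef c UP k) (fcoef c PQ k) => l y1 y2 y3 w0.
by field; rewrite gt_eqF.
Qed.

End slab.

Lemma CH_backward t x : D t -> U t x - U 0 x =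
  \int[mu]_(r in `[0, t]) CH_F a b (U r) x + (I t x - I 0 x).
Proof.
move=> Dt; have [T DT tT] := Dnext Dt; have [t0 tD] := D0 Dt.
suff e : \int[mu]_(r in `[0, t]) (- (U r x * p r x) + v r x) =
    2^-1 * \int[mu]_(r in `[0, t]) CH_F a b (U r) x.
  have [_ _ _ _ h] := system x Dt; rewrite e in h.
  have -> : U t x - U 0 x = 2 * (2^-1 * U t x - 2^-1 * U 0 x) by field.
  by rewrite h; field.
have cF : {within `[0, t], continuous (fun r => CH_F a b (U r) x)}.
  exact: (continuous_subspaceW tD (upath_time (upath_CH_F hs sU))).
have cl : {within `[0, t], continuous (fun r => - (U r x * p r x) + v r x)}.
  apply: (continuous_subspaceW tD) => z; apply: cvgD; last exact: (C1_time x Cv).1.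
  by apply: cvgN; apply: cvgM; [exact: (upath_time uU)|exact: (C1_time x Cp).1].
(* Removing the endpoint 0 does not change the integrals and leaves only times at which the
   pointwise identity is known. The time T beyond t makes t itself interior. *)
have sub : `]0, t] `<=` `[0, t] by apply: subset_itv; rewrite bnd_simp.
rewrite -RintegralZl//; last exact: within_continuous_integrable.
rewrite -Rintegral_itv_obnd_cbnd; last first.
  by apply: integrableS (within_continuous_integrable cl).
rewrite -[RHS]Rintegral_itv_obnd_cbnd; last first.
  apply: integrableS
    (@within_continuous_integrable _ (fun r => 2^-1 * CH_F a b (U r) x) 0 t _) => //.
  by move=> z; apply: cvgM; [exact: cvg_cst|exact: cF].
apply: eq_Rintegral => r; rewrite inE/= in_itv/= => /andP[r0 rt].
by apply: (CH_backward_pointwise DT); rewrite in_itv/= r0 (le_lt_trans rt).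
Qed.

End backward.

End equations.

End camassa_holm_paths.

(** * Wiener integrals *)

Import HBNNSimple.

(* No measurability is needed: the integral of a nonnegative function is by definition the
   supremum of the integrals of the simple functions below it. *)
Lemma ge0_integral_leZ {d} {T : measurableType d} {R : realType}
    (mu : {measure set T -> \bar R}) (C : R) (f g : T -> \bar R) : 0 < C ->
  (forall x, (0 <= f x)%E) -> (forall x, (0 <= g x)%E) ->
  (forall x, (f x <= C%:E * g x)%E) ->
  (\int[mu]_x f x <= C%:E * \int[mu]_x g x)%E.
Proof.
move=> C0 f0 g0 fg; rewrite !ge0_integralTE//; apply: ge_ereal_sup => _ [/= h hf <-].
have Ci0 : 0 <= C^-1 by rewrite invr_ge0 ltW.
rewrite -(mul1e (sintegral mu h)) -(mulfV (lt0r_neq0 C0)) EFinM -muleA.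
apply: lee_wpmul2l; first by rewrite lee_fin ltW.
apply: ereal_sup_ubound => /=; exists (scale_nnsfun h Ci0); last by rewrite -sintegralrM.
move=> x /=; rewrite EFinM.
have -> : g x = (C^-1%:E * (C%:E * g x))%E.
  by rewrite muleA -EFinM mulVf ?lt0r_neq0// mul1e.
by apply: lee_wpmul2l; [rewrite lee_fin|apply: le_trans (hf x) (fg x)].
Qed.

Lemma ge0_integral_le {d} {T : measurableType d} {R : realType}
    (mu : {measure set T -> \bar R}) (f g : T -> \bar R) :
  (forall x, (0 <= f x)%E) -> (forall x, (f x <= g x)%E) ->
  (\int[mu]_x f x <= \int[mu]_x g x)%E.
Proof.
move=> f0 fg; rewrite -[leRHS]mul1e; apply: ge0_integral_leZ => // x.
- exact: le_trans (f0 x) (fg x).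
- by rewrite mul1e.
Qed.

Lemma ae_forall_count {d} {T : measurableType d} {R : realType} (mu : {measure set T -> \bar R})
    (I : countType) (Q : I -> T -> Prop) :
  (forall i, {ae mu, forall x, Q i x}) -> {ae mu, forall x, forall i, Q i x}.
Proof.
move=> aeQ.
have : {ae mu, forall x, forall n, if unpickle n is Some i then Q i x else True}.
  apply: ae_foralln => n; case: (unpickle n) => [i|]; first exact: aeQ.
  by apply: aeW.
apply: filterS => x h i; by have := h (pickle i); rewrite pickleK.
Qed.

(** The mean value theorem is used twice in each cell, for a primitive of f and then for f
    itself. *)
Lemma Rintegral_riemann_sum_le {R : realType} (f f' : R -> R) (a b M : R) (n : nat) :
  a < b -> (forall x, is_derive x (1 : R) f (f' x)) -> (forall x, `|f' x| <= M) ->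
  `|\int[lebesgue_measure]_(x in `[a, b]) f x -
     \sum_(i < n.+1) ((b - a) / n.+1%:R) * f (a + i%:R * ((b - a) / n.+1%:R))| <=
    M * (b - a) * ((b - a) / n.+1%:R).
Proof.
move=> ab df fM; set h := (b - a) / n.+1%:R.
have cf : continuous f by move=> x; exact: is_derive_continuous (df x).
have [G dG] := continuous_has_primitive cf.
have cG : continuous G by move=> x; exact: is_derive_continuous (dG x).
have n0 : (0 : R) < n.+1%:R by rewrite ltr0n.
have h0 : 0 < h by rewrite divr_gt0// subr_gt0.
have bE : b = a + n.+1%:R * h by rewrite /h; field; rewrite gt_eqF.
rewrite (Rintegral_is_derive (ltW ab) (continuous_within cf) dG).
have -> : G b - G a = \sum_(i < n.+1) (G (a + i.+1%:R * h) - G (a + i%:R * h)).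
  rewrite -(big_mkord predT (fun i => G (a + i.+1%:R * h) - G (a + i%:R * h))).
  by rewrite (telescope_sumr (fun i => G (a + i%:R * h)))// -bE mul0r addr0.
rewrite -sumrB.
have step i : `|G (a + i.+1%:R * h) - G (a + i%:R * h) - h * f (a + i%:R * h)| <= M * h * h.
  set x := a + i%:R * h; have -> : a + i.+1%:R * h = x + h by rewrite /x -natr1; ring.
  have xh : x <= x + h by rewrite lerDl ltW.
  have [c + ->] := MVT_segment xh (fun y _ => dG y) (continuous_within cG).
  rewrite in_itv/= => /andP[xc ch].
  have [d _ e] := MVT_segment xc (fun y _ => df y) (continuous_within cf).
  have -> : f c * (x + h - x) - h * f x = (f c - f x) * h by ring.
  rewrite e normrM (gtr0_norm h0) ler_pM2r// normrM; apply: ler_pM => //.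
  by rewrite ger0_norm ?subr_ge0// lerBlDl.
apply: le_trans (ler_norm_sum _ _ _) _.
apply: (@le_trans _ _ (\sum_(i < n.+1) M * h * h)); first by apply: ler_sum => i _; exact: step.
rewrite sumr_const card_ord -mulr_natl bE le_eqVlt; apply/orP; left; apply/eqP; ring.
Qed.

(** Measurability is assumed for evaluations at single points. Riemann sums are finite combinations
    of these and converge for each [w], so joint measurability in (w, x) does not have to be
    discussed. *)
Lemma measurable_Rintegral_itv {d} {T : measurableType d} {R : realType} (a b : R)
    (f f' : T -> R -> R) : a < b ->
  (forall w x, is_derive x (1 : R) (f w) (f' w x)) ->
  (forall w, exists M, forall x, `|f' w x| <= M) ->
  (forall x, measurable_fun setT (fun w => f w x)) ->
  measurable_fun setT (fun w => \int[lebesgue_measure]_(x in `[a, b]) f w x).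
Proof.
move=> ab df fM mf.
pose S n w := \sum_(i < n.+1) ((b - a) / n.+1%:R) * f w (a + i%:R * ((b - a) / n.+1%:R)).
apply: (@measurable_fun_cvg _ _ _ _ S) => [n|w _].
  by apply: measurable_sum => i; apply: measurable_funM => //; exact: measurable_cst.
have [M HM] := fM w.
apply/cvgrPdist_le => e e0; near=> n.
apply: le_trans (Rintegral_riemann_sum_le n ab (df w) HM) _.
have L0 : 0 < b - a by rewrite subr_gt0.
rewrite mulrA ler_pdivrMr ?ltr0n//.
rewrite -ler_pdivrMl//.
apply: le_trans (ler_norm _) _.
near: n; exists (Num.truncn (`|e^-1 * (M * (b - a) * (b - a))|)) => // n /= hn.
apply: le_trans (ltW (truncnS_gt _)) _; by rewrite ler_nat ltnS.
Unshelve. all: end_near. Qed.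

(** * Fourier coefficients of Wiener integrals *)

Section stochastic_integrals.
Context {R : realType} (a b : R).
Hypothesis ab : a < b.
Notation L := (b - a).
Local Notation lam k := (wavenum a b k).
Local Notation fcoef := (fcoef a b).
Local Notation Lam := (Lambda a b).
Local Notation sgn c := (if c then 1 else -1 : R).
Context {d : measure_display} {Omega : measurableType d} (P : probability Omega R).

(** The exponent 3/2 makes the functions C^1, as the Riemann sum estimate requires. The noises meet
    it, the roughest of them being in H^(s-1) with s - 1 > 3/2. *)
Lemma measurable_fcoef (X : Omega -> R -> R) r c (k : int) : 3 / 2 < r ->
  (forall w, sobolev a b r (X w)) -> (forall x, measurable_fun setT (fun w => X w x)) ->
  measurable_fun setT (fun w => fcoef c (X w) k).
Proof.
move=> r3 sX mX.
under eq_fun do rewrite fcoefE.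
apply: measurable_funM; first exact: measurable_cst.
apply: (@measurable_Rintegral_itv _ _ _ _ _ (fun w x => X w x * mode a b c k x)
  (fun w x => X w x * ((if c then -1 else 1) * lam k * mode a b (~~ c) k x) +
    mode a b c k x * derive1 (X w) x)) => // [w x|w|x].
- have [dX _ _] := sobolev_derive ab r3 (sX w).
  exact: (is_deriveM (dX x) (is_derive_mode a b c k x)).
- have [cX pX _] := sX w; have [_ [cX' pX' _] _] := sobolev_derive ab r3 (sX w).
  have [M1 M10 h1] := periodic_bounded ab cX pX; have [M2 M20 h2] := periodic_bounded ab cX' pX'.
  exists (M1 * `|lam k| + M2) => x; apply: le_trans (ler_normD _ _) _.
  apply: lerD; rewrite normrM.
    apply: ler_pM => //; rewrite normrM normrM.
    rewrite (_ : `|if c then -1 else 1| = 1); last by case: c; rewrite ?normrN normr1.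
    by rewrite mul1r ler_piMr// mode_le1.
  by rewrite -[M2]mul1r; apply: ler_pM => //; exact: mode_le1.
- by apply: measurable_funM => //; exact: measurable_cst.
Qed.

Section coefficients.
Context (e : nat -> R -> R) (beta : nat -> R -> Omega -> R).
Hypothesis mbeta : forall j t, 0 <= t -> measurable_fun setT (beta j t).
Local Notation wiener := (wiener_integral a b P e beta).

Let remainder Psi (I : process R Omega) c k t n w : R :=
  fcoef c (I t w) k - \sum_(j < n) beta j t w * fcoef c (Psi (e j)) k.

Let measurable_remainder r Psi I c k t n : 3 / 2 < r -> wiener r Psi I -> 0 <= t ->
  measurable_fun setT (remainder Psi I c k t n).
Proof.
move=> r3 [mI sI _ _] t0; apply: measurable_funB.
  by apply: (measurable_fcoef c k r3) => [w|x]; [exact: sI|exact: mI].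
apply: measurable_sum => j; apply: measurable_funM; last exact: measurable_cst.
exact: mbeta.
Qed.

Let remainder_cvg r Psi I c (k : int) t : 3 / 2 < r -> wiener r Psi I ->
  (forall j, continuous (Psi (e j))) -> 0 <= t ->
  (\int[P]_w ((remainder Psi I c k t n w) ^+ 2)%:E)%E @[n --> \oo] --> 0%E.
Proof.
move=> r3 [mI sI _ I2] cPsi t0.
apply: (@squeeze_cvge _ _ _ _ (cst 0%E) _ _ _ _ _ (I2 t t0)); last exact: cvg_cst.
apply: nearW => n; apply/andP; split; first by apply: integral_ge0 => w _; rewrite lee_fin sqr_ge0.
apply: ge0_integral_le => w; first by rewrite lee_fin sqr_ge0.
have [cI _ _] := sI t w t0.
have cS : continuous (fun x => \sum_(j < n) beta j t w * Psi (e j) x).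
  by apply: continuous_sum => j x; apply: cvgM; [exact: cvg_cst|exact: cPsi].
have -> : remainder Psi I c k t n w =
    fcoef c (fun x => I t w x - \sum_(j < n) beta j t w * Psi (e j) x) k.
  rewrite /remainder fcoefB//; congr (_ - _); symmetry.
  exact: (fcoef_sum ab c (index_enum _) (fun j : 'I_n => beta j t w)).
by apply: sobolev_normsq_ge_fcoef; lra.
Qed.

(** For every n the partial sums cancel by the relation between the integrands, which leaves the
    difference of the two sides as a combination of remainders. Its second moment is thus bounded by
    quantities tending to 0. *)
Lemma wiener_fcoef_eq_at r1 r2 Psi1 Psi2 I1 I2 c1 c2 (k : int) (x1 x2 t : R) :
  3 / 2 < r1 -> 3 / 2 < r2 -> wiener r1 Psi1 I1 -> wiener r2 Psi2 I2 ->
  (forall j, continuous (Psi1 (e j))) -> (forall j, continuous (Psi2 (e j))) ->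
  (forall j, x1 * fcoef c1 (Psi1 (e j)) k = x2 * fcoef c2 (Psi2 (e j)) k) -> 0 <= t ->
  {ae P, forall w, x1 * fcoef c1 (I1 t w) k = x2 * fcoef c2 (I2 t w) k}.
Proof.
move=> r13 r23 W1 W2 c_1 c_2 H t0.
pose X w := x1 * fcoef c1 (I1 t w) k - x2 * fcoef c2 (I2 t w) k.
pose A1 n w := remainder Psi1 I1 c1 k t n w; pose A2 n w := remainder Psi2 I2 c2 k t n w.
have XE n w : X w = x1 * A1 n w - x2 * A2 n w.
  have key : x1 * \sum_(j < n) beta j t w * fcoef c1 (Psi1 (e j)) k =
      x2 * \sum_(j < n) beta j t w * fcoef c2 (Psi2 (e j)) k.
    by rewrite !mulr_sumr; apply: eq_bigr => j _; rewrite mulrCA H mulrCA.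
  by rewrite /X /A1 /A2 /remainder !mulrBr key; ring.
have m1 n : measurable_fun setT (A1 n) by exact: measurable_remainder W1 t0.
have m2 n : measurable_fun setT (A2 n) by exact: measurable_remainder W2 t0.
have mX : measurable_fun setT X.
  have -> : X = (fun w => x1 * A1 0%N w - x2 * A2 0%N w) by apply/funext => w; exact: XE.
  by apply: measurable_funB; apply: measurable_funM => //; exact: measurable_cst.
pose C1 := 2 * x1 ^+ 2; pose C2 := 2 * x2 ^+ 2.
have C10 : 0 <= C1 by rewrite mulr_ge0// sqr_ge0.
have C20 : 0 <= C2 by rewrite mulr_ge0// sqr_ge0.
have le n : (\int[P]_w (X w ^+ 2)%:E <= C1%:E * \int[P]_w (A1 n w ^+ 2)%:E +
    C2%:E * \int[P]_w (A2 n w ^+ 2)%:E)%E.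
  have mA1 : measurable_fun setT (fun w => (A1 n w ^+ 2)%:E).
    by apply/measurable_EFinP; exact: measurable_funX.
  have mA2 : measurable_fun setT (fun w => (A2 n w ^+ 2)%:E).
    by apply/measurable_EFinP; exact: measurable_funX.
  rewrite -!ge0_integralZl_EFin//; do ?by move=> w _; rewrite lee_fin sqr_ge0.
  rewrite -ge0_integralD//; first last.
  - by apply: measurable_funeM.
  - by move=> w _; rewrite mule_ge0// lee_fin// sqr_ge0.
  - by apply: measurable_funeM.
  - by move=> w _; rewrite mule_ge0// lee_fin// sqr_ge0.
  apply: ge0_integral_le => w; first by rewrite lee_fin sqr_ge0.
  rewrite -!EFinM -EFinD lee_fin (XE n).
  have := sqr_ge0 (x1 * A1 n w + x2 * A2 n w); rewrite /C1 /C2; nra.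
have X0 : (\int[P]_w (X w ^+ 2)%:E = 0)%E.
  apply/eqP; rewrite eq_le; apply/andP; split; last first.
    by apply: integral_ge0 => w _; rewrite lee_fin sqr_ge0.
  have : (C1%:E * \int[P]_w (A1 n w ^+ 2)%:E + C2%:E * \int[P]_w (A2 n w ^+ 2)%:E)%E
      @[n --> \oo] --> (C1%:E * 0 + C2%:E * 0)%E.
    apply: cvgeD; first by rewrite !mule0.
      by apply: cvgeZl => //; exact: remainder_cvg W1 c_1 t0.
    by apply: cvgeZl => //; exact: remainder_cvg W2 c_2 t0.
  rewrite !mule0 adde0 => h.
  by apply: (cvge_to_ge h); apply: nearW.
have mX2 : measurable_fun setT (fun w => (X w ^+ 2)%:E).
  by apply/measurable_EFinP; exact: measurable_funX.
have := (ae_eq_integral_abs P measurableT mX2).1.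
have -> : (\int[P]_w `|(X w ^+ 2)%:E| = 0)%E.
  by under eq_integral do rewrite abse_EFin ger0_norm ?sqr_ge0//.
move=> /(_ erefl); apply: filterS => w /(_ Logic.I) /= [].
by move/eqP; rewrite sqrf_eq0 subr_eq0 => /eqP.
Qed.

Lemma upath_fcoef D f c k : upath a b D f ->
  {within D, continuous (fun t => fcoef c (f t) k)}.
Proof.
move=> [cf uf]; apply/subspace_continuousP => t0 Dt0; apply/cvgrPdist_le => e0 e00.
have [cf0 _] := cf t0 Dt0.
apply: within_filterS (uf t0 Dt0 e0 e00) => t Dt h; have [cft _] := cf t Dt.
rewrite distrC -fcoefB//; apply: fcoef_le => //.
  by move=> x; apply: cvgB; [exact: cft|exact: cf0].
by move=> x _; apply/ltW; exact: h.
Qed.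

Lemma wiener_path r Psi I w : wiener r Psi I ->
  sobolev_path a b r `[0, +oo[ (fun t => I t w).
Proof.
move=> [_ sI cI _]; split => t /=; rewrite in_itv/= andbT => t0; first exact: sI.
exact: cI.
Qed.

Lemma continuous_eq_rat (f g : R -> R) :
  {within `[0, +oo[, continuous f} -> {within `[0, +oo[, continuous g} ->
  (forall q : rat, 0 <= ratr q :> R -> f (ratr q) = g (ratr q)) ->
  forall t, 0 <= t -> f t = g t.
Proof.
move=> cf cg fg t t0; apply/eqP; rewrite -subr_eq0 -normr_le0; apply/ler_addgt0Pl => e0 e00.
rewrite addr0.
have t0' : `[0, +oo[%classic t by rewrite /= in_itv/= t0.
have h : (fun x => f x - g x) y @[y --> within `[0, +oo[ (nbhs t)] --> f t - g t.
  by move/subspace_continuousP: cf => cf; move/subspace_continuousP: cg => cg; apply: cvgB;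
    [exact: cf|exact: cg].
have [dl /= dl0 H] := (cvgrPdist_le _ _).1 h e0 e00.
(* The rational is taken to the right of t, so that it is nonnegative even for t = 0. *)
have [q /andP[tq qt]] : exists q : rat, t < ratr q < t + dl.
  have tdl : t < t + dl by rewrite ltrDl.
  by have [q] := rat_in_itvoo tdl; rewrite in_itv/=; exists q.
have q0 : 0 <= ratr q :> R by rewrite (le_trans t0)// ltW.
have := H (ratr q); rewrite fg// subrr subr0; apply; last by rewrite /= in_itv/= q0.
by rewrite /ball/= distrC gtr0_norm ?subr_gt0// ltrBlDl.
Qed.

(** The map [tw] allows an exchange of cosine and sine, as differentiation demands: it is [negb] for
    odd symbols and [id] for even ones. *)
Lemma wiener_fcoef_eq r1 r2 Psi1 Psi2 I1 I2 (x1 x2 : bool -> nat -> R) (tw : bool -> bool) :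
  3 / 2 < r1 -> 3 / 2 < r2 -> wiener r1 Psi1 I1 -> wiener r2 Psi2 I2 ->
  (forall j, continuous (Psi1 (e j))) -> (forall j, continuous (Psi2 (e j))) ->
  (forall c (k : nat) j, x1 c k * fcoef (tw c) (Psi1 (e j)) k =
    x2 c k * fcoef c (Psi2 (e j)) k) ->
  {ae P, forall w, forall c (k : nat) t, 0 <= t ->
    x1 c k * fcoef (tw c) (I1 t w) k = x2 c k * fcoef c (I2 t w) k}.
Proof.
move=> r13 r23 W1 W2 c_1 c_2 H.
have : {ae P, forall w, forall ckq : bool * nat * rat, 0 <= ratr ckq.2 :> R ->
    x1 ckq.1.1 ckq.1.2 * fcoef (tw ckq.1.1) (I1 (ratr ckq.2) w) ckq.1.2 =
    x2 ckq.1.1 ckq.1.2 * fcoef ckq.1.1 (I2 (ratr ckq.2) w) ckq.1.2}.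
  apply: ae_forall_count => -[[c k] q] /=.
  have [q0|q0] := boolP (0 <= ratr q :> R); last by apply: aeW.
  have := wiener_fcoef_eq_at r13 r23 W1 W2 c_1 c_2 (H c k) q0.
  by apply: filterS => w h _.
apply: filterS => w h c k t t0.
have u1 : upath a b `[0, +oo[ (fun t => I1 t w).
  by apply: (sobolev_path_upath ab _ (wiener_path w W1)); lra.
have u2 : upath a b `[0, +oo[ (fun t => I2 t w).
  by apply: (sobolev_path_upath ab _ (wiener_path w W2)); lra.
apply: (@continuous_eq_rat
  (fun t => x1 c k * fcoef (tw c) (I1 t w) k)
  (fun t => x2 c k * fcoef c (I2 t w) k)) => //.
- by move=> z; apply: cvgM; [exact: cvg_cst|exact: upath_fcoef].
- by move=> z; apply: cvgM; [exact: cvg_cst|exact: upath_fcoef].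
- by move=> q q0; exact: (h (c, k, q)).
Qed.

Lemma wiener_eq r1 r2 Psi1 Psi2 I1 I2 : 3 / 2 < r1 -> 3 / 2 < r2 ->
  wiener r1 Psi1 I1 -> wiener r2 Psi2 I2 -> (forall j, Psi1 (e j) = Psi2 (e j)) ->
  (forall j, continuous (Psi1 (e j))) ->
  {ae P, forall w, forall t, 0 <= t -> I1 t w = I2 t w}.
Proof.
move=> r13 r23 W1 W2 E c_1; have c_2 j : continuous (Psi2 (e j)) by rewrite -E.
have H (c : bool) (k : nat) j : 1 * fcoef c (Psi1 (e j)) k = 1 * fcoef c (Psi2 (e j)) k.
  by rewrite E.
have := @wiener_fcoef_eq _ _ _ _ _ _ (fun _ _ => 1) (fun _ _ => 1) id r13 r23 W1 W2 c_1 c_2 H.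
apply: filterS => w h t t0.
have [_ s1 _ _] := W1; have [_ s2 _ _] := W2.
have [c1 p1 _] := s1 t w t0; have [c2 p2 _] := s2 t w t0.
by apply: (fcoef_inj ab) => // c k; have := h c k t t0; rewrite !mul1r.
Qed.

(** A Fourier multiplier that is bounded from H^r to H^r' commutes with the stochastic integral. The
    one deterministic estimate [le] transfers finiteness of the norm, continuity of paths and
    convergence in mean square; [tw] is true for a symbol that exchanges cosine and sine. *)
Lemma wiener_multiplier r r' Psi Psi' I I' (y : bool -> nat -> R) (tw : bool) (C : R) :
  3 / 2 < r -> 1 / 2 < r' -> 0 < C ->
  (forall c (k : nat), weight a b r' k * y c k ^+ 2 <= C * weight a b r k) ->
  wiener r Psi I -> (forall j, continuous (Psi (e j))) -> (forall j, continuous (Psi' (e j))) ->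
  (forall t w, 0 <= t -> continuous (I' t w) /\ periodic (I' t w) L) ->
  (forall t w c (k : nat), 0 <= t ->
    fcoef c (I' t w) k = y c k * fcoef (tw (+) c) (I t w) k) ->
  (forall j c (k : nat), fcoef c (Psi' (e j)) k = y c k * fcoef (tw (+) c) (Psi (e j)) k) ->
  wiener r' Psi' I'.
Proof.
move=> r3 r'1 C0 yC [mI sI cI I2] cP cP' cI' fI fP.
have le f g : continuous f -> continuous g ->
    (forall c (k : nat), fcoef c f k = y c k * fcoef (tw (+) c) g k) ->
    (sobolev_normsq a b r' f <= C%:E * sobolev_normsq a b r g)%E.
  move=> cf cg fg; apply: le_sobolev_normsq_nat => //; first exact: ltW.
  move=> k; rewrite !fg !exprMn mulrDr [C * _]mulrA.
  have h c (z : R) : weight a b r' k * (y c k ^+ 2 * z ^+ 2) <= C * weight a b r k * z ^+ 2.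
    by rewrite mulrA; apply: ler_wpM2r => //; rewrite sqr_ge0.
  apply: le_trans (lerD (h _ _) (h _ _)) _.
  by rewrite -mulrDr; case: (tw) => //=; rewrite addrC.
have sI' t w : 0 <= t -> sobolev a b r' (I' t w).
  move=> t0; have [cIt pIt] := cI' t w t0; have [cI0 _ I0] := sI t w t0; split => //.
  apply: le_lt_trans (le _ _ cIt cI0 (fun c k => fI t w c k t0)) _.
  by rewrite -(fineK (sobolev_normsq_fin I0)) -EFinM ltry.
have le0 f : (0 <= C%:E * sobolev_normsq a b r f)%E.
  by rewrite mule_ge0 ?sobolev_normsq_ge0// lee_fin ltW.
have cB (f g : R -> R) : continuous f -> continuous g -> continuous (fun x => f x - g x).
  by move=> cf cg x; apply: cvgB; [exact: cf|exact: cg].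
split; [move=> t x t0|exact: sI'|move=> t0 w t00|move=> t t0].
(* The values of I' at a point are limits of its Fourier partial sums, whose coefficients are
   multiples of the measurable coefficients of I. *)
- have [K K0 HK] := sobolevP ab r'1.
  have mfc c k : measurable_fun setT (fun w => fcoef c (I' t w) k%:Z).
    under eq_fun do rewrite fI//.
    apply: measurable_funM; first exact: measurable_cst.
    by apply: (measurable_fcoef _ _ r3) => [w|z]; [exact: sI|exact: mI].
  apply: (@measurable_fun_cvg _ _ _ _
    (fun n w => series (trig_term a b (fun c k => fcoef c (I' t w) k) ^~ x) n)).
    move=> n; under eq_fun do rewrite seriesEord/=.
    apply: measurable_sum => k; apply: measurable_funM; first exact: measurable_cst.
    by apply: measurable_funD; apply: measurable_funM => //; exact: measurable_cst.
  move=> w _; have [E AM] := HK _ 1 (sI' t w t0) ltr01.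
  rewrite (congr1 (@^~ x) E); exact: trig_series_cvg AM x.
- apply: (@squeeze_cvge _ _ _ _ (cst 0%E) _
    (fun t => C%:E * sobolev_normsq a b r (fun x => I t w x - I t0 w x)%R)%E).
  + near=> t; rewrite sobolev_normsq_ge0/=.
    have t0' : 0 <= t.
      have : `[0, +oo[%classic t by near: t; exact: withinT.
      by rewrite /= in_itv/= andbT.
    have [c1 _] := cI' t w t0'; have [c2 _] := cI' t0 w t00.
    have [d1 _ _] := sI t w t0'; have [d2 _ _] := sI t0 w t00.
    by apply: le => [||c k]; [exact: cB|exact: cB|rewrite !fcoefB// !fI// mulrBr].
  + exact: cvg_cst.
  + by rewrite -[X in _ --> X](mule0 C%:E); apply: cvgeZl => //; exact: cI.
- apply: (@squeeze_cvge _ _ _ _ (cst 0%E) _ (fun n => C%:E * \int[P]_w sobolev_normsq a b r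
      (fun x => I t w x - \sum_(j < n) beta j t w * Psi (e j) x)%R)%E).
  + apply: nearW => n; rewrite integral_ge0/=; last by move=> *; exact: sobolev_normsq_ge0.
    apply: ge0_integral_leZ => // [w|w|w]; [exact: sobolev_normsq_ge0..|].
    have [c1 _] := cI' t w t0; have [d1 _ _] := sI t w t0.
    have cS (Th : (R -> R) -> R -> R) : (forall j, continuous (Th (e j))) ->
        continuous (fun x => \sum_(j < n) beta j t w * Th (e j) x).
      by move=> cTh; apply: continuous_sum => j x; apply: cvgM; [exact: cvg_cst|exact: cTh].
    have fS (Th : (R -> R) -> R -> R) c k : (forall j, continuous (Th (e j))) ->
        fcoef c (fun x => \sum_(j < n) beta j t w * Th (e j) x) k =
        \sum_(j < n) beta j t w * fcoef c (Th (e j)) k.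
      by move=> cTh; exact: (fcoef_sum ab c (index_enum _) (fun j : 'I_n => beta j t w)).
    apply: le => [||c k]; [by apply: cB => //; exact: cS|by apply: cB => //; exact: cS|].
    rewrite !fcoefB//; [|exact: cS..].
    rewrite !fS// fI// mulrBr mulr_sumr; congr (_ - _).
    by apply: eq_bigr => j _; rewrite fP mulrCA.
  + exact: cvg_cst.
  + by rewrite -[X in _ --> X](mule0 C%:E); apply: cvgeZl => //; exact: I2.
Unshelve. all: end_near. Qed.

Lemma wiener_integralZ r Psi Psi' I (y : R) : 3 / 2 < r -> wiener r Psi I ->
  (forall j, continuous (Psi (e j))) -> (forall j, Psi' (e j) = (fun x => y * Psi (e j) x)) ->
  wiener r Psi' (fun t w x => y * I t w x).
Proof.
move=> r3 W cP E; have [_ sI _ _] := W.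
have cZ (f : R -> R) : continuous f -> continuous (fun x => y * f x).
  by move=> cf x; apply: cvgM; [exact: cvg_cst|exact: cf].
(* The constant must be positive also for y = 0, the case of the vanishing rows of the matrix
   noise. *)
apply: (@wiener_multiplier r r Psi Psi' I _ (fun _ _ => y) false (y ^+ 2 + 1)) => //.
- lra.
- by rewrite ltr_wpDl// sqr_ge0.
- move=> _ k; rewrite mulrC ler_pM2r ?weight_gt0// lerDl ler01//.
- by move=> j; rewrite E; exact: cZ.
- move=> t w t0; have [cI pI _] := sI t w t0; split; first exact: cZ.
  by move=> x; rewrite pI.
- by move=> t w c k t0; have [cI _ _] := sI t w t0; rewrite fcoefZ.
- by move=> j c k; rewrite E fcoefZ.
Qed.

End coefficients.

(** The coefficient forms of ∂ₓ∂ₓ⁻¹Λg = Λg and ∂ₓ⁻¹g = (1 - ∂ₓ²)∂ₓ⁻¹Λg. The first holds at k = 0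
    because g has zero mean. *)
Lemma dxinv_Lambda_fcoef r g : 1 / 2 < r -> sobolev0 a b r g ->
  [/\ continuous (dxinv a b g), continuous (dxinv a b (Lam g)),
      forall c (k : nat), sgn c * lam k * fcoef (~~ c) (dxinv a b (Lam g)) k = fcoef c (Lam g) k,
      forall c (k : nat), fcoef c (dxinv a b g) k =
        (1 + lam k ^+ 2) * fcoef c (dxinv a b (Lam g)) k &
      forall c (k : nat), fcoef c (dxinv a b (Lam g)) k =
        (if c then -1 else 1) * (lam k)^-1 * fcoef (~~ c) (Lam g) k].
Proof.
move=> r1 [sg g0]; have [cg pg _] := sg.
have [K K0 HK] := sobolevP ab r1; have [_ AM] := HK g 1 sg ltr01.
have [cL pL fL] := LambdaP ab cg pg.
have fLk c (k : nat) : fcoef c (Lam g) k = (1 + lam k ^+ 2)^-1 * fcoef c g k by [].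
have fL0 : fcoef true (Lam g) 0%N = 0.
  rewrite fLk; have := g0; rewrite fourierE => -[-> _]; exact: mulr0.
have w0 k : 1 + lam k ^+ 2 != 0 by rewrite gt_eqF// weight_base_gt0.
have LM n : abs_sum (fun c k => fcoef c (Lam g) k) n <= 1 * fine (sobolev_normsq a b r g) + K / 1.
  apply: le_trans (AM n); apply: ler_sum => k _.
  have h c : `|fcoef c (Lam g) k| <= `|fcoef c g k|.
    rewrite fLk normrM ler_piMl// normfV gtr0_norm ?weight_base_gt0//.
    by rewrite invf_le1 ?weight_base_gt0// lerDl sqr_ge0.
  exact: lerD.
have [cD pD fD] := dxinvP ab cg AM.
have [cDL pDL fDL] := dxinvP ab cL LM.
split; [exact cD|exact cDL|move=> c k|move=> c k|exact fDL].
  rewrite fDL negbK; have [->|k0] := eqVneq k 0%N.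
    by rewrite wavenum0 mulr0 mul0r; case: c; rewrite ?fL0 ?fcoef_false0.
  have lk : lam k != 0 by rewrite wavenum_eq0.
  by case: c => /=; field.
rewrite (fD c k) (fDL c k) (fLk (~~ c) k); have := w0 k.
move: (fcoef _ g k) (if c then -1 else 1) (lam k)^-1 (1 + lam k ^+ 2) => u z x y y0.
by field.
Qed.

(** * Relations between the noises I, J and B *)

Section noise.
Context (F : R -> set (set Omega)) (hF : filtration F).
Context (e : nat -> R -> R) (beta : nat -> R -> Omega -> R).
Hypothesis hW : cylindrical_wiener a b P F e beta.
Context (s : R) (Phi : (R -> R) -> R -> R).
Hypotheses (hs : 5 / 2 < s) (hPhi : hilbert_schmidt a b (s - 2) Phi).
Local Notation wiener := (wiener_integral a b P e beta).

Lemma measurable_brownian j t : 0 <= t -> measurable_fun setT (beta j t).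
Proof.
move=> t0 _ A mA; rewrite setTI; have [_ adb _ _ _] := hW; have [_ Fm _] := hF.
exact: Fm t0 (adb j t A t0 mA).
Qed.

Let PhiP j : sobolev0 a b (s - 2) (Phi (e j)).
Proof. by have [[eL _ _] _ _ _ _] := hW; have [+ _ _ _] := hPhi; apply. Qed.

Let s2 : 1 / 2 < s - 2. Proof. by move: hs; lra. Qed.

Let Phi_fcoef j := dxinv_Lambda_fcoef s2 (PhiP j).

Lemma continuous_Lambda_Phi j : continuous (Lam (Phi (e j))).
Proof. by have [[cg pg _] _] := PhiP j; have [] := LambdaP ab cg pg. Qed.

Lemma continuous_dxinv_Phi j : continuous (dxinv a b (Phi (e j))).
Proof. by have [h _ _ _ _] := Phi_fcoef j; exact h. Qed.

Lemma wiener_dxinv_Phi_fcoef I B : wiener s (Lam \o Phi) I -> wiener (s - 1) (dxinv a b \o Phi) B ->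
  {ae P, forall w, forall c (k : nat) t, 0 <= t ->
    sgn c * lam k * fcoef (~~ c) (B t w) k = (1 + lam k ^+ 2) * fcoef c (I t w) k}.
Proof.
move=> WI WB.
apply: (wiener_fcoef_eq measurable_brownian (x1 := fun c k => sgn c * lam k)
  (x2 := fun _ k => 1 + lam k ^+ 2) (tw := negb) _ _ WB WI).
- by move: hs; lra.
- by move: hs; lra.
- by move=> j; have [h _ _ _ _] := Phi_fcoef j; exact h.
- exact: continuous_Lambda_Phi.
- move=> c k j; have [_ _ h1 h2 _] := Phi_fcoef j.
  by rewrite /= (h2 (~~ c) k) -(h1 c k) mulrCA.
Qed.

Lemma wiener_dxinv_Lambda_derive I J : wiener s (Lam \o Phi) I ->
  wiener (s + 1) (dxinv a b \o (Lam \o Phi)) J ->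
  {ae P, forall w, forall t x, 0 <= t -> is_derive x (1 : R) (J t w) (I t w x)}.
Proof.
move=> WI WJ.
have : {ae P, forall w, forall c (k : nat) t, 0 <= t ->
    sgn c * lam k * fcoef (~~ c) (J t w) k = 1 * fcoef c (I t w) k}.
  apply: (wiener_fcoef_eq measurable_brownian (x1 := fun c k => sgn c * lam k)
    (x2 := fun _ _ => 1) (tw := negb) _ _ WJ WI).
  - by move: hs; lra.
  - by move: hs; lra.
  - by move=> j; have [_ h _ _ _] := Phi_fcoef j; exact h.
  - exact: continuous_Lambda_Phi.
  - by move=> c k j /=; have [_ _ -> _ _] := Phi_fcoef j; rewrite mul1r.
apply: filterS => w h t x t0.
have [_ /(_ t w t0)[cI pI _] _ _] := WI; have [_ /(_ t w t0)[cJ pJ _] _ _] := WJ.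
by apply: (is_derive_fcoef ab cJ pJ cI pI) => c k; rewrite h// mul1r.
Qed.

(** Since I = J_x and B = (1 - ∂ₓ²)J, one has I_x = J_xx = J - B. *)
Lemma wiener_Lambda_derive I J B : wiener s (Lam \o Phi) I ->
  wiener (s + 1) (dxinv a b \o (Lam \o Phi)) J -> wiener (s - 1) (dxinv a b \o Phi) B ->
  {ae P, forall w, forall t x, 0 <= t -> is_derive x (1 : R) (I t w) (J t w x - B t w x)}.
Proof.
move=> WI WJ WB.
have : {ae P, forall w, forall c (k : nat) t, 0 <= t ->
    1 * fcoef c (B t w) k = (1 + lam k ^+ 2) * fcoef c (J t w) k}.
  apply: (wiener_fcoef_eq measurable_brownian (x1 := fun _ _ => 1)
    (x2 := fun _ k => 1 + lam k ^+ 2) (tw := id) _ _ WB WJ).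
  - by move: hs; lra.
  - by move: hs; lra.
  - by move=> j; have [h _ _ _ _] := Phi_fcoef j; exact h.
  - by move=> j; have [_ h _ _ _] := Phi_fcoef j; exact h.
  - by move=> c k j; rewrite mul1r; have [_ _ _ h _] := Phi_fcoef j; exact (h c k).
have := wiener_dxinv_Lambda_derive WI WJ.
apply: filterS2 => w dJ h t x t0.
have [_ /(_ t w t0)[cI pI _] _ _] := WI; have [_ /(_ t w t0)[cJ pJ _] _ _] := WJ.
have [_ /(_ t w t0)[cB pB _] _ _] := WB.
apply: (is_derive_fcoef ab cI pI (g := fun x => J t w x - B t w x)) => [y|y|c k].
- by apply: cvgB; [exact: cJ|exact: cB].
- by rewrite pJ pB.
have fI d k' := fcoef_is_derive ab d k' pJ cI (fun x => dJ t x t0).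
rewrite fcoefB// fI negbK; have := h c k t t0; rewrite mul1r => ->.
by case: c => /=; ring.
Qed.

(** This constructs the noise of φ from that of u, by applying ∂ₓ⁻¹ path by path; it is what makes
    the auxiliary variables exist. *)
Lemma wiener_dxinv_Lambda I : wiener s (Lam \o Phi) I ->
  wiener (s + 1) (dxinv a b \o (Lam \o Phi)) (fun t w => dxinv a b (I t w)).
Proof.
move=> WI; have [_ sI _ _] := WI.
have s0 : 1 / 2 < s by move: hs; lra.
have dI t w (t0 : 0 <= t) :=
  let: ex_intro2 _ _ H := sobolevP ab s0 in
  let: conj _ AM := H _ 1 (sI t w t0) ltr01 in
  let: And3 cI _ _ := sI t w t0 in dxinvP ab cI AM.
have l1 := wavenum1_gt0 ab.
apply: (wiener_multiplier (y := fun c k => (if c then -1 else 1) * (lam k)^-1)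
  (tw := true) (C := 1 + (lam 1)^-1 ^+ 2) _ _ _ _ WI).
- by move: hs; lra.
- by move: hs; lra.
- by rewrite ltr_pwDl// sqr_ge0.
(* For k > 0 the squared symbol times 1 + λ² is 1 + λ^-2, largest at the lowest frequency. At k = 0
   the inverse of zero gives 0. *)
- move=> c k; rewrite weightD1 -[leLHS]mulrA [leRHS]mulrC ler_pM2l ?weight_gt0//.
  rewrite [(_ * (lam k)^-1) ^+ 2]exprMn.
  rewrite (_ : (if c then -1 else 1) ^+ 2 = 1) ?mul1r; last by case: c; rewrite ?sqrrN expr1n.
  case: k => [|k]; first by rewrite wavenum0 invr0 expr0n mulr0 addr_ge0// sqr_ge0.
  have lk : lam 1 <= lam k.+1 by rewrite [leRHS]wavenumE ler_peMl ?(ltW l1)// ler1n.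
  have lk0 : 0 < lam k.+1 := lt_le_trans l1 lk.
  rewrite mulrDl mul1r -exprMn mulfV ?lt0r_neq0// expr1n addrC lerD2l.
  by rewrite lerXn2r ?nnegrE ?invr_ge0 ?(ltW l1) ?(ltW lk0)// lef_pV2.
- exact: continuous_Lambda_Phi.
- by move=> j; have [_ h _ _ _] := Phi_fcoef j; exact h.
- by move=> t w t0; have [] := dI t w t0.
- by move=> t w c k t0; have [_ _] := dI t w t0.
- by move=> j c k; have [_ _ _ _] := Phi_fcoef j.
Qed.

End noise.

End stochastic_integrals.

(** * The matrix form and the equivalence *)

Lemma Rintegral_0 {R : realType} (A : set R) : \int[lebesgue_measure]_(r in A) (0 : R) = 0.
Proof. by rewrite /Rintegral integral0_eq. Qed.

Section matrix_form.
Context {R : realType}.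
Local Notation i0 := (@Ordinal 5 0 isT).
Local Notation i1 := (@Ordinal 5 1 isT).
Local Notation i2 := (@Ordinal 5 2 isT).
Local Notation i3 := (@Ordinal 5 3 isT).
Local Notation i4 := (@Ordinal 5 4 isT).

Lemma ord5_ind (Q : 'I_5 -> Prop) : Q i0 -> Q i1 -> Q i2 -> Q i3 -> Q i4 -> forall i, Q i.
Proof.
move=> Q0 Q1 Q2 Q3 Q4 -[i il]; case: i il => [|[|[|[|[|//]]]]] il.
- by rewrite (_ : Ordinal il = i0)//; apply/val_inj.
- by rewrite (_ : Ordinal il = i1)//; apply/val_inj.
- by rewrite (_ : Ordinal il = i2)//; apply/val_inj.
- by rewrite (_ : Ordinal il = i3)//; apply/val_inj.
- by rewrite (_ : Ordinal il = i4)//; apply/val_inj.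
Qed.

Lemma cV5P (y z : 'cV[R]_5) : y = z <->
  [/\ y i0 0 = z i0 0, y i1 0 = z i1 0, y i2 0 = z i2 0, y i3 0 = z i3 0 & y i4 0 = z i4 0].
Proof. by split=> [-> //|[e0 e1 e2 e3 e4]]; apply/colP; exact: ord5_ind. Qed.

Lemma mx5_mul rows (z : 'cV[R]_5) i : (mx5 rows *m z) i 0 =
  nth 0 (nth [::] rows i) 0 * z i0 0 + nth 0 (nth [::] rows i) 1 * z i1 0 +
  nth 0 (nth [::] rows i) 2 * z i2 0 + nth 0 (nth [::] rows i) 3 * z i3 0 +
  nth 0 (nth [::] rows i) 4 * z i4 0.
Proof.
rewrite mxE !big_ord_recl big_ord0 !mxE /= addr0 !addrA.
by congr (_ * z _ _ + _ * z _ _ + _ * z _ _ + _ * z _ _ + _ * z _ _); apply/val_inj.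
Qed.

Lemma CH_M_mul (z : 'cV[R]_5) : CH_M R *m z =
  col5 (2^-1 * z i1 0 - 2^-1 * z i4 0) (- (2^-1 * z i0 0)) 0 0 (2^-1 * z i0 0).
Proof. by apply/cV5P; rewrite !mx5_mul !mxE/=; split; ring. Qed.

Lemma CH_K_mul (z : 'cV[R]_5) : CH_K R *m z =
  col5 (- z i3 0) (z i2 0) (- z i1 0) (z i0 0) 0.
Proof. by apply/cV5P; rewrite !mx5_mul !mxE/=; split; ring. Qed.

Lemma grad_CH_S1 (u f w v p : R) : grad (@CH_S1 R) (col5 u f w v p) =
  col5 (- w - (3 / 2) * u ^+ 2 - 2^-1 * p ^+ 2) 0 (- u) p (- (u * p) + v).
Proof.
(* Along a coordinate direction S1 is a polynomial in one real variable, so each partial derivative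
   is an ordinary derivative at 0. *)
have D (i : 'I_5) (l : R) :
    is_derive (0 : R) (1 : R)
      (fun h => CH_S1 (h *: (delta_mx i 0 : 'cV[R]_5) + col5 u f w v p)) l ->
    grad (@CH_S1 R) (col5 u f w v p) i 0 = l.
  move=> [_ <-]; rewrite mxE /derive.
  apply: (congr1 (fun g : R -> R => lim (g h @[h --> 0^'])))%classic.
  by apply/funext => h /=; rewrite scale0r add0r addr0 /GRing.scale/= mulr1.
have E (i : 'I_5) h : CH_S1 (h *: (delta_mx i 0 : 'cV[R]_5) + col5 u f w v p) =
    CH_S1 (col5 (h * (i0 == i)%:R + u) (h * (i1 == i)%:R + f) (h * (i2 == i)%:R + w)
      (h * (i3 == i)%:R + v) (h * (i4 == i)%:R + p)).
  by congr CH_S1; apply/cV5P; rewrite !mxE/= !andbT.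
apply/cV5P; rewrite ![col5 (- w - _ - _) _ _ _ _ _ _]mxE/=; split; apply: D;
  under eq_fun do rewrite E /CH_S1 !mxE/= ?mulr1 ?mulr0 ?add0r; apply: is_derive_eq;
  rewrite /GRing.scale/=; (by []) || by field.
Qed.

(** The noise Y stays arbitrary, so that the same reading of the rows serves both directions of the
    equivalence. *)
Lemma matrix_rows (u phi w v p : R -> R -> R) (Y : R -> R -> 'cV[R]_5) t x :
  let z t x := col5 (u t x) (phi t x) (w t x) (v t x) (p t x) in
  let zx t x : 'cV[R]_5 := \col_i derive1 (fun y => z t y i 0) x in
  CH_M R *m (z t x - z 0 x) +
    (\col_i \int[lebesgue_measure]_(r in `[0, t]) (CH_K R *m zx r x) i 0) =
  (\col_i \int[lebesgue_measure]_(r in `[0, t]) (grad (@CH_S1 R) (z r x)) i 0) +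
    (Y t x - Y 0 x) <->
  [/\
    (2^-1 * phi t x - 2^-1 * p t x - (2^-1 * phi 0 x - 2^-1 * p 0 x)) +
      \int[lebesgue_measure]_(r in `[0, t]) (- derive1 (v r) x) =
      \int[lebesgue_measure]_(r in `[0, t])
        (- w r x - (3 / 2) * u r x ^+ 2 - 2^-1 * p r x ^+ 2) + (Y t x i0 0 - Y 0 x i0 0),
    (- (2^-1 * u t x) - - (2^-1 * u 0 x)) +
      \int[lebesgue_measure]_(r in `[0, t]) derive1 (w r) x = Y t x i1 0 - Y 0 x i1 0,
    \int[lebesgue_measure]_(r in `[0, t]) - derive1 (phi r) x =
      \int[lebesgue_measure]_(r in `[0, t]) - u r x + (Y t x i2 0 - Y 0 x i2 0),
    \int[lebesgue_measure]_(r in `[0, t]) derive1 (u r) x =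
      \int[lebesgue_measure]_(r in `[0, t]) p r x + (Y t x i3 0 - Y 0 x i3 0)
    & 2^-1 * u t x - 2^-1 * u 0 x =
      \int[lebesgue_measure]_(r in `[0, t]) (- (u r x * p r x) + v r x) +
      (Y t x i4 0 - Y 0 x i4 0)].
Proof.
move=> z zx.
have zxE r : zx r x = col5 (derive1 (u r) x) (derive1 (phi r) x) (derive1 (w r) x)
    (derive1 (v r) x) (derive1 (p r) x).
  have E i f : (forall y, z r y i 0 = f y) -> zx r x i 0 = derive1 f x.
    by move=> Ef; rewrite mxE; congr (derive1 _ x); apply/funext.
  by apply/cV5P; split; rewrite [RHS]mxE/=; apply: E => y; rewrite mxE.
have cI (f : R -> 'cV[R]_5) (f0 f1 f2 f3 f4 : R -> R) :
    (forall r, f r = col5 (f0 r) (f1 r) (f2 r) (f3 r) (f4 r)) ->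
    (\col_i \int[lebesgue_measure]_(r in `[0, t]) f r i 0) =
    col5 (\int[lebesgue_measure]_(r in `[0, t]) f0 r) (\int[lebesgue_measure]_(r in `[0, t]) f1 r)
      (\int[lebesgue_measure]_(r in `[0, t]) f2 r) (\int[lebesgue_measure]_(r in `[0, t]) f3 r)
      (\int[lebesgue_measure]_(r in `[0, t]) f4 r).
  move=> fE; apply/cV5P; rewrite !mxE/=.
  by split; apply: eq_Rintegral => r _; rewrite fE mxE.
have KE r : CH_K R *m zx r x = col5 (- derive1 (v r) x) (derive1 (w r) x)
    (- derive1 (phi r) x) (derive1 (u r) x) 0.
  by rewrite CH_K_mul zxE !mxE.
have GE r := grad_CH_S1 (u r x) (phi r x) (w r x) (v r x) (p r x).
rewrite (cI _ _ _ _ _ _ KE) (cI _ _ _ _ _ _ GE) CH_M_mul !Rintegral_0.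
rewrite cV5P !mxE/= !add0r addr0.
have e1 : 2^-1 * (phi t x - phi 0 x) - 2^-1 * (p t x - p 0 x) =
  2^-1 * phi t x - 2^-1 * p t x - (2^-1 * phi 0 x - 2^-1 * p 0 x) by ring.
have e2 : - (2^-1 * (u t x - u 0 x)) = - (2^-1 * u t x) - - (2^-1 * u 0 x) by ring.
have e3 : 2^-1 * (u t x - u 0 x) = 2^-1 * u t x - 2^-1 * u 0 x by ring.
by rewrite e1 e2 e3.
Qed.

End matrix_form.

Lemma upath_subset {R : realType} (a b : R) (D D' : set R) (f : R -> R -> R) :
  D `<=` D' -> upath a b D' f -> upath a b D f.
Proof.
move=> DD' [cf uf]; split => [t /DD'|t0 /DD' Dt0 e e0]; first exact: cf.
have := uf t0 Dt0 e e0; rewrite !near_withinE; apply: filterS => t h Dt.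
by apply: h; exact: DD'.
Qed.

Lemma ae_and {d} {T : measurableType d} {R : realType} (mu : {measure set T -> \bar R})
    (A B : T -> Prop) :
  {ae mu, forall x, A x} -> {ae mu, forall x, B x} -> {ae mu, forall x, A x /\ B x}.
Proof. by apply: filterS2 => x. Qed.

Section lifetime.
Context {R : realType} {Omega : Type} (tau : Omega -> \bar R) (om : Omega).

Lemma alive_itv t : alive tau om t -> 0 <= t /\ `[0, t] `<=` alive tau om.
Proof.
move=> [t0 tt]; split => // r /=; rewrite in_itv/= => /andP[r0 rt]; split => //.
by apply: le_lt_trans tt; rewrite lee_fin.
Qed.

Lemma alive_next t : alive tau om t -> exists2 T, alive tau om T & t < T.
Proof.
move=> [t0]; rewrite /alive; case: (tau om) => [r||]//.
  rewrite lte_fin => tr; exists ((t + r) / 2); last by rewrite midf_lt.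
  by rewrite /= lte_fin midf_lt//; split => //; rewrite divr_ge0// addr_ge0// (le_trans t0)// ltW.
move=> _; exists (t + 1); last by rewrite ltrDl.
by rewrite /= ltry; split => //; rewrite addr_ge0.
Qed.

End lifetime.

(** * Equivalence of the equation, the system and the matrix form *)

Section equivalence.
Local Notation i0 := (@Ordinal 5 0 isT).
Local Notation i1 := (@Ordinal 5 1 isT).
Local Notation i2 := (@Ordinal 5 2 isT).
Local Notation i3 := (@Ordinal 5 3 isT).
Local Notation i4 := (@Ordinal 5 4 isT).
Context {R : realType} (a b s : R).
Hypotheses (ab : a < b) (hs : 5 / 2 < s).
Context {d : measure_display} {Omega : measurableType d} (P : probability Omega R).
Context (F : R -> set (set Omega)) (hF : filtration F).
Context (e : nat -> R -> R) (beta : nat -> R -> Omega -> R).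
Hypothesis hW : cylindrical_wiener a b P F e beta.
Context (u0 : R -> R).
Context (Phi : (R -> R) -> R -> R) (hPhi : hilbert_schmidt a b (s - 2) Phi).
Context (phi0 : R -> R) (hphi0 : periodic phi0 (b - a)).
Hypothesis hphi0x : forall x : R, is_derive x (1 : R) phi0 (u0 x).
Context (B : process R Omega).
Hypothesis hB : wiener_integral a b P e beta (s - 1) (dxinv a b \o Phi) B.
Local Notation SCH := (pathwise_solution a b s P F e beta Phi u0).
Local Notation aux := (auxiliary_variables a b s P e beta Phi phi0).
Local Notation sys := (system_solution a b s P F e beta Phi u0 phi0 B).
Local Notation wiener := (wiener_integral a b P e beta).
Implicit Types (u phi w v p : process R Omega) (tau : Omega -> \bar R).

Lemma auxiliary_variables_exist u tau : SCH u tau -> exists phi w v p, aux u phi w v p tau.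
Proof.
move=> [_ _ _ _ [I WI _]].
pose J : process R Omega := fun t om => dxinv a b (I t om).
pose w : process R Omega := fun t om x =>
  - 4^-1 * u t om x ^+ 2 - 2^-1 * Lambda a b (CH_H (u t om)) x.
pose p : process R Omega := fun t om => derive1 (u t om).
pose v : process R Omega := fun t om x => u t om x * p t om x + 2^-1 * CH_F a b (u t om) x.
pose phi : process R Omega := fun t om x => phi0 x +
  \int[lebesgue_measure]_(r in `[0, t]) (2 * w r om x) + (J t om x - J 0 om x).
have phi_0 om : phi 0 om = phi0.
  apply/funext => x; rewrite /phi subrr addr0 set_itv1.
  by rewrite /Rintegral integral_set1 addr0.
exists phi, w, v, p; split.
- by apply: aeW => om t _.
- exact: aeW.
exists J; first exact (wiener_dxinv_Lambda ab hW hs hPhi WI).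
apply: aeW => om t _ x.
by rewrite Rintegral_0 addr0 phi_0 /phi -[phi0 x + _ + _]addrA [LHS]addrC addKr.
Qed.

Lemma system_equationsP u phi w v p tau :
  system_equations a b s P e beta Phi B u phi w v p tau <->
  exists2 I, wiener s (Lambda a b \o Phi) I &
    {ae P, forall om, forall t, alive tau om t -> forall x,
      integrated_system (u^~ om) (phi^~ om) (w^~ om) (v^~ om) (p^~ om) (B^~ om) (I^~ om) t x}.
Proof.
split=> -[I WI H]; exists I => //.
  have [eq1 eq2 eq3 eq4 eq5] := H.
  have := ae_and eq1 (ae_and eq2 (ae_and eq3 (ae_and eq4 eq5))).
  apply: filterS => om [e1 [e2 [e3 [e4 e5]]]] t at_ x; split.
  - exact: e1.
  - by have := e2 t at_ x; rewrite Rintegral_0 add0r.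
  - by have := e3 t at_ x; rewrite !subrr add0r addr0.
  - by have := e4 t at_ x; rewrite !subrr add0r addr0.
  - by have := e5 t at_ x; rewrite Rintegral_0 addr0.
split; apply: filterS H => om H t at_ x;
  have [e1 e2 e3 e4 e5] := H t at_ x; rewrite ?Rintegral_0 ?subrr ?addr0 ?add0r//.
Qed.

Lemma SCH_system u phi w v p tau : aux u phi w v p tau -> SCH u tau -> sys u phi w v p tau.
Proof.
move=> [auxE phi_0 [J WJ eqphi]] [tau0 adu sU u_0 [I WI equ]].
have dJ := wiener_dxinv_Lambda_derive ab hF hW hs hPhi WI WJ.
have dI := wiener_Lambda_derive ab hF hW hs hPhi WI WJ hB.
have key : {ae P, forall om,
  [/\ C1_path a b (alive tau om) (phi^~ om), C1_path a b (alive tau om) (w^~ om),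
      C1_path a b (alive tau om) (v^~ om) & C1_path a b (alive tau om) (p^~ om)] /\
  forall t, alive tau om t -> forall x,
    integrated_system (u^~ om) (phi^~ om) (w^~ om) (v^~ om) (p^~ om) (B^~ om) (I^~ om) t x}.
  have := ae_and auxE (ae_and phi_0 (ae_and eqphi (ae_and sU (ae_and u_0
    (ae_and equ (ae_and dJ dI)))))).
  apply: filterS => om [aux' [phi0' [eqphi' [sU' [u0' [equ' [dJ' dI']]]]]]].
  have eq1 t x : alive tau om t -> u t om x - u 0 om x =
      \int[lebesgue_measure]_(r in `[0, t]) CH_F a b (u r om) x + (I t om x - I 0 om x).
    by move=> at_; have := equ' t at_ x; rewrite Rintegral_0 addr0.
  have eq2 t x : alive tau om t -> phi t om x - phi 0 om x =
      \int[lebesgue_measure]_(r in `[0, t]) (2 * w r om x) + (J t om x - J 0 om x).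
    by move=> at_; have := eqphi' t at_ x; rewrite Rintegral_0 addr0.
  have uJ : upath a b (alive tau om) (J^~ om).
    apply: (@upath_subset _ _ _ _ `[0, +oo[%classic).
      by move=> t [t0 _] /=; rewrite in_itv/= t0.
    by apply: (sobolev_path_upath ab _ (wiener_path om WJ)); move: hs; lra.
  split.
    exact (CH_forward_class ab (U := u^~ om) (phi := phi^~ om) (w := w^~ om) (v := v^~ om)
      (p := p^~ om) (I := I^~ om) hs (@alive_itv _ _ tau om) sU' u0' phi0' hphi0 hphi0x uJ dJ'
      eq1 eq2 aux').
  move=> t at_ x.
  exact (CH_forward ab (U := u^~ om) (phi := phi^~ om) (w := w^~ om) (v := v^~ om)
    (p := p^~ om) (I := I^~ om) (B := B^~ om) hs (@alive_itv _ _ tau om) sU' u0' phi0' hphi0x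
    dJ' dI' eq1 eq2 aux' x at_).
split.
  split => //; first by apply: filterS key => om [].
  by apply: filterS2 u_0 phi_0 => om.
by apply/system_equationsP; exists I => //; apply: filterS key => om [].
Qed.

Lemma system_SCH u phi w v p tau : sys u phi w v p tau -> SCH u tau.
Proof.
move=> [[tau0 adu sU C1 u_0] /system_equationsP[I WI H]].
split => //; first by apply: filterS u_0 => om [].
exists I => //.
have noise := wiener_dxinv_Phi_fcoef ab hF hW hs hPhi WI hB.
have := ae_and sU (ae_and C1 (ae_and noise H)).
apply: filterS => om [sU' [[Cphi Cw Cv Cp] [noise' H']]] t at_ x.
rewrite Rintegral_0 addr0.
have [_ sI _ _] := WI; have [_ sB _ _] := hB.
apply: (CH_backward ab (U := u^~ om) (phi := phi^~ om) (w := w^~ om) (v := v^~ om)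
  (p := p^~ om) (I := I^~ om) (B := B^~ om) hs (@alive_itv _ _ tau om) sU' Cphi Cw Cv Cp _ _
  noise' (@alive_next _ _ tau om)) => //.
- by move=> r r0; have [] := sI r om r0.
- by move=> r r0; have [] := sB r om r0.
- by move=> r y ar; exact: H'.
Qed.

(** For every pair of a process and a lifetime the two notions of solution are equivalent, so
    maximality is tested against the same competitors. *)
Lemma maximal_solution_system u tau : maximal_solution P SCH u tau <->
  maximal_solution P (fun u tau => exists phi w v p, sys u phi w v p tau) u tau.
Proof.
have E u' tau' : SCH u' tau' <-> exists phi w v p, sys u' phi w v p tau'.
  split=> [S|[phi [w [v [p]]]]]; last exact: system_SCH.
  have [phi [w [v [p A]]]] := auxiliary_variables_exist S.
  by exists phi, w, v, p; exact: SCH_system.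
by split=> -[/E S M]; split => // u' tau' /E; exact: M.
Qed.

Lemma system_matrix_equation u phi w v p tau :
  system_equations a b s P e beta Phi B u phi w v p tau <->
  matrix_equation a b s P e beta Phi u phi w v p tau.
Proof.
have s3 : 3 / 2 < s by move: hs; lra.
have s13 : 3 / 2 < s - 1 by move: hs; lra.
have mbeta := measurable_brownian hF hW.
have cL := continuous_Lambda_Phi ab hW hPhi.
have cD := continuous_dxinv_Phi ab hW hs hPhi.
rewrite system_equationsP; split=> [[I WI H]|[Y WY eqY]].
  (* The vanishing rows are written as 0 * I so that they are Wiener integrals by the same scaling
     lemma as the others. *)
  pose Y t om x : 'cV[R]_5 := col5 (2^-1 * B t om x) (- 2^-1 * I t om x) (0 * I t om x)
    (0 * I t om x) (2^-1 * I t om x).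
  exists Y.
    have W (Psi : (R -> R) -> R -> R) y : (forall h, Psi h = (fun x => y * Lambda a b (Phi h) x)) ->
        wiener s Psi (fun t om x => y * I t om x).
      by move=> PsiE; apply: (wiener_integralZ ab s3 WI) => // j; rewrite PsiE.
    have GE i (f : R -> R) h : (forall x, CH_G a b Phi h x i 0 = f x) ->
      (fun x => CH_G a b Phi h x i 0) = f by move=> fE; apply/funext.
    have YE i (X : process R Omega) : (forall t om x, Y t om x i 0 = X t om x) ->
      (fun t om x => Y t om x i 0) = X.
      by move=> XE; apply/funext => t; apply/funext => om; apply/funext.
    apply: ord5_ind.
    - rewrite (YE _ (fun t om x => 2^-1 * B t om x)) => [|t om x]; last by rewrite mxE.
      by apply: (wiener_integralZ ab s13 hB) => // j; apply: GE => x; rewrite !mxE.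
    - rewrite (YE _ (fun t om x => - 2^-1 * I t om x)) => [|t om x]; last by rewrite mxE.
      by apply: W => h; apply: GE => x; rewrite !mxE/= mulNr mulrN.
    - rewrite (YE _ (fun t om x => 0 * I t om x)) => [|t om x]; last by rewrite mxE.
      by apply: W => h; apply: GE => x; rewrite !mxE/= mulr0 mul0r.
    - rewrite (YE _ (fun t om x => 0 * I t om x)) => [|t om x]; last by rewrite mxE.
      by apply: W => h; apply: GE => x; rewrite !mxE/= mulr0 mul0r.
    - rewrite (YE _ (fun t om x => 2^-1 * I t om x)) => [|t om x]; last by rewrite mxE.
      by apply: W => h; apply: GE => x; rewrite !mxE/=.
  apply: filterS H => om H t at_ x; have [e1 e2 e3 e4 e5] := H t at_ x.
  apply/(matrix_rows (u^~ om) (phi^~ om) (w^~ om) (v^~ om) (p^~ om) (Y^~ om)).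
  by rewrite /Y !mxE/= !mul0r !mulNr subrr !addr0; split.
have WY0 := WY i0; have WY1 := WY i1; have WY2 := WY i2; have WY3 := WY i3; have WY4 := WY i4.
rewrite /= in WY0 WY1 WY2 WY3 WY4.
have GE i (f : R -> R) h : (forall x, CH_G a b Phi h x i 0 = f x) ->
  (fun x => CH_G a b Phi h x i 0) = f by move=> fE; apply/funext.
have cG (j : nat) (y : R) : continuous (fun x => y * Lambda a b (Phi (e j)) x).
  by move=> x; apply: cvgM; [exact: cvg_cst|exact: cL].
(* The last row of the noise operator is half of ΛΦ, so twice the last component of Y serves as I.
   The middle rows are then compared with multiples of I, and the first one with B/2. *)
pose I : process R Omega := fun t om x => 2 * Y t om x i4 0.
have WI : wiener s (Lambda a b \o Phi) I.
  apply: (wiener_integralZ ab s3 WY4) => j.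
    by rewrite (GE _ (fun x => 2^-1 * Lambda a b (Phi (e j)) x)) => [|x]; [exact: cG|rewrite !mxE].
  by apply/funext => x; rewrite !mxE/= mulrA mulfV// mul1r.
have W y : wiener s (fun h x => y * Lambda a b (Phi h) x) (fun t om x => y * I t om x).
  by apply: (wiener_integralZ ab s3 WI).
have WB : wiener (s - 1) (fun h x => 2^-1 * dxinv a b (Phi h) x) (fun t om x => 2^-1 * B t om x).
  by apply: (wiener_integralZ ab s13 hB).
have U (r1 r2 : R) i y (Psi : (R -> R) -> R -> R) (X : process R Omega) :
    3 / 2 < r1 -> 3 / 2 < r2 ->
    wiener r1 (fun h x => CH_G a b Phi h x i 0) (fun t om x => Y t om x i 0) ->
    wiener r2 (fun h x => y * Psi h x) X ->
    (forall j, continuous (Psi (e j))) ->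
    (forall h x, CH_G a b Phi h x i 0 = y * Psi h x) ->
    {ae P, forall om, forall t, 0 <= t -> forall x, Y t om x i 0 = X t om x}.
  move=> r13 r23 Wi WX cP GP.
  have E j : (fun x => CH_G a b Phi (e j) x i 0) = (fun x => y * Psi (e j) x) by exact: GE.
  have := wiener_eq ab mbeta r13 r23 Wi WX E.
  have c1 j : continuous (fun x => CH_G a b Phi (e j) x i 0).
    by rewrite E => x; apply: cvgM; [exact: cvg_cst|exact: cP].
  by move=> /(_ c1); apply: filterS => om h t t0 x; have := congr1 (@^~ x) (h t t0).
have U0 := U _ _ i0 2^-1 (fun h => dxinv a b (Phi h)) _ s13 s13 WY0 WB cD.
have U1 := U _ _ i1 (- 2^-1) (fun h => Lambda a b (Phi h)) _ s3 s3 WY1 (W _) cL.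
have U2 := U _ _ i2 0 (fun h => Lambda a b (Phi h)) _ s3 s3 WY2 (W _) cL.
have U3 := U _ _ i3 0 (fun h => Lambda a b (Phi h)) _ s3 s3 WY3 (W _) cL.
have {}U0 : {ae P, forall om, forall t, 0 <= t -> forall x, Y t om x i0 0 = 2^-1 * B t om x}.
  by apply: U0 => h x; rewrite !mxE.
have {}U1 : {ae P, forall om, forall t, 0 <= t -> forall x, Y t om x i1 0 = - 2^-1 * I t om x}.
  by apply: U1 => h x; rewrite !mxE/= mulNr mulrN.
have {}U2 : {ae P, forall om, forall t, 0 <= t -> forall x, Y t om x i2 0 = 0 * I t om x}.
  by apply: U2 => h x; rewrite !mxE/= mulr0 mul0r.
have {}U3 : {ae P, forall om, forall t, 0 <= t -> forall x, Y t om x i3 0 = 0 * I t om x}.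
  by apply: U3 => h x; rewrite !mxE/= mulr0 mul0r.
exists I => //.
have := ae_and eqY (ae_and U0 (ae_and U1 (ae_and U2 U3))).
apply: filterS => om [H [h0 [h1 [h2 h3]]]] t at_ x; have [t0 _] := at_.
have := (matrix_rows (u^~ om) (phi^~ om) (w^~ om) (v^~ om) (p^~ om) (Y^~ om) t x).1 (H t at_ x).
rewrite !h0// !h1// !h2// !h3// !mul0r !mulNr subrr !addr0.
by rewrite /integrated_system /I !mulrA mulVf// !mul1r.
Qed.

End equivalence.

Theorem proposition2p1 (R : realType) (a b s : R) (hab : a < b)
    (hs : 5 / 2 < s)
    (d : measure_display) (Omega : measurableType d) (P : probability Omega R)
    (F : R -> set (set Omega)) (hF : filtration F)
    (e : nat -> R -> R) (beta : nat -> R -> Omega -> R)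
    (hW : cylindrical_wiener a b P F e beta)
    (u0 : R -> R) (hu0 : sobolev0 a b s u0)
    (Phi : (R -> R) -> R -> R) (hPhi : hilbert_schmidt a b (s - 2) Phi)
    (phi0 : R -> R) (hphi0 : periodic phi0 (b - a))
    (hphi0x : forall x : R, is_derive x (1 : R) phi0 (u0 x))
    (B : process R Omega)
    (hB : wiener_integral a b P e beta (s - 1) (dxinv a b \o Phi) B) :
  let SCH := pathwise_solution a b s P F e beta Phi u0 in
  let aux := auxiliary_variables a b s P e beta Phi phi0 in
  let sys := system_solution a b s P F e beta Phi u0 phi0 B in
  [/\ (* the auxiliary variables exist along every solution of (SCH) *)
      forall u tau, SCH u tau -> exists phi w v p, aux u phi w v p tau,
      (* in terms of the auxiliary variables, (SCH) is the system *)
      forall u phi w v p tau, aux u phi w v p tau ->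
        (SCH u tau <-> sys u phi w v p tau),
      (* every solution of the system, whatever phi, w, v, p, solves (SCH) *)
      forall u phi w v p tau, sys u phi w v p tau -> SCH u tau,
      (* in particular, both problems have the same maximal solution *)
      forall u tau, maximal_solution P SCH u tau <->
        maximal_solution P
          (fun u tau => exists phi w v p, sys u phi w v p tau) u tau
    & (* the matrix form of the system *)
      forall u phi w v p tau,
        system_class a b s P F u0 phi0 u phi w v p tau ->
        (system_equations a b s P e beta Phi B u phi w v p tau <->
         matrix_equation a b s P e beta Phi u phi w v p tau)].
Proof.
move=> SCH aux sys; split.
- move=> u tau; exact: (auxiliary_variables_exist hab hs hW hPhi).
- move=> u phi w v p tau A; split; first exact: (SCH_system hab hs hF hW hPhi hphi0 hphi0x hB).
  exact: (system_SCH hab hs hF hW hPhi hB).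
- move=> u phi w v p tau; exact: (system_SCH hab hs hF hW hPhi hB).
- exact: (maximal_solution_system hab hs hF hW hPhi hphi0 hphi0x hB).
- by move=> u phi w v p tau _; exact: (system_matrix_equation hab hs hF hW hPhi hB).
Qed.
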